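(* For each $d\in\mathbb{Z}^+$ there are constants $c_2=c_2(d)>0$ and $c_3=c_3(d)>0$ with the following property. Let $A\subseteq\mathbb{R}^2$ be finite with $|A|>c_2$. If $A$ is not contained in any curve of degree $d$, then \[ \left|\mathcal{O}_{d,\frac{3d^2-3d+4}{2}}(A)\right|\geq c_3|A|^{d}. \]
   Context: A curve of degree $d$ is a subset of $\mathbb{R}^2$ equal to the zero set of a polynomial in $\mathbb{R}[x,y]$ of degree exactly $d$; $\mathcal{C}_d$ denotes the family of curves of degree $d$. For $A\subseteq\mathbb{R}^2$, a curve $C_1\in\mathcal{C}_d$ is determined by $A$ if for every $C_2\in\mathcal{C}_d$ with $C_2\cap A\supseteq C_1\cap A$ we have $C_1=C_2$; $\mathcal{D}_d(A)$ is the family of curves of degree $d$ determined by $A$. For $n\in\mathbb{R}$, $\mathcal{O}_{d,n}(A):=\{C\in\mathcal{D}_d(A): |C\cap A|\le n\}$. *)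

(* Defs.v *)
From HB Require Import structures.
From mathcomp Require Import all_boot all_order all_algebra.
From mathcomp Require Import reals.
From mathcomp Require Import mpoly.

Set Implicit Arguments.
Unset Strict Implicit.
Unset Printing Implicit Defensive.

Import Order.TTheory GRing.Theory Num.Theory.
Local Open Scope ring_scope.

Section Curves.
Variable R : realType.

Definition point := (R * R)%type.

Definition ev2 (p : {mpoly R[2]}) (z : point) : R :=
  p.@[fun i : 'I_2 => if val i == 0%N then z.1 else z.2].

Definition zero_set (p : {mpoly R[2]}) : pred point := fun z => ev2 p z == 0.

(* C is a curve of degree d: the zero set of a polynomial of total degree
   exactly d (msize p = total degree + 1). *)
Definition is_curve (d : nat) (C : pred point) : Prop :=
  exists p : {mpoly R[2]}, msize p = d.+1 /\ C = zero_set p.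

(* C1 is determined by A (A a finite set given as a duplicate-free list). *)
Definition determined (d : nat) (A : seq point) (C1 : pred point) : Prop :=
  is_curve d C1 /\
  forall C2, is_curve d C2 ->
    (forall z, z \in A -> C1 z -> C2 z) -> C1 = C2.

Definition in_O (d : nat) (n : R) (A : seq point) (C : pred point) : Prop :=
  determined d A C /\ (count C A)%:R <= n.

Definition O_card_ge (d : nat) (n : R) (A : seq point) (k : R) : Prop :=
  exists (m : nat) (f : 'I_m -> pred point),
    injective f /\ (forall i, in_O d n A (f i)) /\ k <= m%:R.

End Curves.

(* Main.v *)
(* Let V_k be the space of polynomials of degree at most k in two variables, D k its dimension,
   and nd = (3d^2 - 3d + 4)/2 = 2d^2 + 3 - D d. It suffices to find c |A|^d subsets E of A of size
   at most nd such that, up to scalars, exactly one nonzero f in V_d vanishes on E and E is the set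
   of its zeros in A: such an f has degree d and its curve is determined by E.

   Suppose that almost all of A lies on a curve of degree e <= d, with e minimal. Fix a subset T of
   the remaining points of A that is a basis of the dual of V_(d-e), and choose the other
   D d - D (d-e) - 1 >= d points generically on the components of that curve. The curve of degree d
   through all these points is unique, has no component in common with the first one and contains
   no further point of A off the first one; by Bezout it meets A in at most D (d-e) + d e <= nd points.

   Otherwise choose D d - 3 generic points S of A, in the plane or on curves of degree at most d
   containing a positive proportion of A. The curves of degree d through S form a net none of whose
   pencils has a fixed component, and the points of A are lines in the projective plane of this net.
   By the theorem of Kelly and Moser these lines have at least linearly many ordinary crossings,
   and such a crossing is a curve meeting A in the base points of the net and two fibers, each having
   at most d^2 points together with the base points. For d = 2 three generic points may give pencils
   with a fixed line; there S is a triple s1, s2, s3 for which the lines s1 s2 and s1 s3 contain at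
   most three points of A, and the argument of Kelly and Moser gives linearly many such triples. *)
Require Import Defs.
From HB Require Import structures.
From mathcomp Require Import all_boot all_order all_algebra.
From mathcomp Require Import reals boolp.
From mathcomp Require Import mpoly ring lra zify.
Set Implicit Arguments.
Unset Strict Implicit.
Unset Printing Implicit Defensive.
Import Order.TTheory GRing.Theory Num.Theory.
Local Open Scope ring_scope.

(** * Irreducible polynomials in two variables *)

(** The exponent [d] comes from double counting. Generic tuples of K points number at least a
    constant times |A|^K, and a trace of at most nd points contains at most nd^K of them, so passing
    from tuples to traces costs only a constant factor. The bound nd is the price of a crossing in a
    net: two fibers of at most d^2 points that share at least D d - 3 base points. The obstacle is
    that A may be forced onto curves of low degree, where points are never in general position.
    Genericity is therefore relative: a new point on an irreducible curve x may be a base point of a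
    system through earlier points only if x is a fixed component of it. Each of the finitely many
    systems then excludes boundedly many points by Bezout, and fixed components can be divided out
    one by one until the remaining points impose independent conditions. The case d = 2 is special
    because D d = D e + D (d-e) + e (d-e) - 1: for 0 < e < d, generic points can leave a pencil with
    a fixed component of degree e only if e (d-e) = 1. *)

Definition irr (T : idomainType) (h : T) : Prop :=
  [/\ h != 0, h \isn't a GRing.unit &
      forall a b, h = a * b -> a \is a GRing.unit \/ b \is a GRing.unit].

Definition rdvd (T : idomainType) (h u : T) : Prop := exists q, u = q * h.

(** * Gauss's lemma: irreducible elements of F[x][y] are prime *)

Section UnivariateFactor.
Variable F : fieldType.

Lemma irreducible_factor (c : {poly F}) : (1 < size c)%N ->
  exists2 p, irreducible_poly p & p %| c.
Proof.
have [m le_cm] := ubnP (size c); elim: m c le_cm => // m IHm c le_cm c_gt1.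
have [irr_c|/not_andP[//|]] := pselect (irreducible_poly c); first by exists c.
move=> /existsNP[q] /not_implyP[q_neq1 /not_implyP[q_dv_c not_qc]].
have c0 : c != 0 by rewrite -size_poly_gt0 ltnW.
have q0 : q != 0 by apply: contraTneq q_dv_c => ->; rewrite dvd0p.
have lt_qc : (size q < size c)%N.
  rewrite ltn_neqAle dvdp_leq // andbT; apply: contra_notN not_qc => /eqP sqc.
  by rewrite -dvdp_size_eqp // sqc.
have [||p irr_p p_dv_q] := IHm q.
- by rewrite (leq_trans lt_qc).
- by rewrite ltn_neqAle eq_sym q_neq1 size_poly_gt0.
by exists p => //; apply: dvdp_trans p_dv_q q_dv_c.
Qed.

Lemma irreducible_dvdp_mul (p a b : {poly F}) :
  irreducible_poly p -> p %| a * b -> (p %| a) || (p %| b).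
Proof.
move=> irr_p pab; case: (boolP (p %| a)) => //= npa.
by rewrite -(@Gauss_dvdpr _ _ a) // irreducible_poly_coprime.
Qed.

(** Reduce all coefficients modulo [p]. If both remainders were nonzero, the leading coefficient of
    their product would be a product of two elements prime to [p], yet that product is a multiple of
    [p]. *)
Lemma gauss_mul (p : {poly F}) (A B C : {poly {poly F}}) :
  irreducible_poly p -> A * B = p%:P * C ->
  (exists A', A = p%:P * A') \/ (exists B', B = p%:P * B').
Proof.
move=> irr_p eqAB.
have dec (D : {poly {poly F}}) :
    D = map_poly (fun c => c %% p) D + p%:P * map_poly (fun c => c %/ p) D.
  apply/polyP => i; rewrite coefD coefCM !coef_map_id0 ?mod0p ?div0p //.
  by rewrite addrC mulrC -divp_eq.
set A0 := map_poly (fun c => c %% p) A; set B0 := map_poly (fun c => c %% p) B.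
have ndvd (D : {poly {poly F}}) : map_poly (fun c => c %% p) D != 0 ->
    ~~ (p %| lead_coef (map_poly (fun c => c %% p) D)).
  rewrite -lead_coef_eq0 => lc0; apply: contraL (lc0) => /eqP lcp; apply/negPn/eqP.
  by move: lcp; rewrite /dvdp lead_coefE coef_map_id0 ?mod0p // modp_id.
have [A00|A0n0] := eqVneq A0 0.
  left; exists (map_poly (fun c => c %/ p) A).
  by rewrite {1}(dec A) -/A0 A00 add0r.
have [B00|B0n0] := eqVneq B0 0.
  right; exists (map_poly (fun c => c %/ p) B).
  by rewrite {1}(dec B) -/B0 B00 add0r.
have : p %| lead_coef (A0 * B0).
  set a := map_poly (fun c => c %/ p) A; set b := map_poly (fun c => c %/ p) B.
  have eA : A0 = A - p%:P * a by rewrite {1}(dec A) addrK.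
  have eB : B0 = B - p%:P * b by rewrite {1}(dec B) addrK.
  have -> : A0 * B0 = p%:P * (C - a * B - A * b + p%:P * a * b).
    by rewrite eA eB; transitivity (A * B - p%:P * a * B - A * (p%:P * b)
      + p%:P * a * (p%:P * b)); [ring | rewrite eqAB; ring].
  by rewrite lead_coefE coefCM dvdp_mulIl.
rewrite lead_coefM => /(irreducible_dvdp_mul irr_p).
by rewrite (negPf (ndvd _ A0n0)) (negPf (ndvd _ B0n0)).
Qed.

Lemma polyC_unit (c : {poly F}) : c != 0 -> (size c <= 1)%N -> c%:P \is a GRing.unit.
Proof.
move=> c0 c_le1; have sc1 : size c == 1%N by rewrite eqn_leq c_le1 size_poly_gt0.
by case/size_poly1P: sc1 => a a0 ->; rewrite !rmorph_unit ?unitfE.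
Qed.

Lemma size_factor_lt (c p : {poly F}) : c != 0 -> irreducible_poly p -> (size c < size (c * p)%R)%N.
Proof.
move=> c0 irr_p; have [p_gt1 _] := irr_p; rewrite size_mul ?(irredp_neq0 irr_p) //.
by move: p_gt1; case: (size p) => // -[] // k _; rewrite addnS /= addnS ltnS leq_addr.
Qed.

(** Divisibility over the fraction field F(x) descends: the prime factors of [c] are cancelled one
    at a time, and none divides [h], which is irreducible of positive degree in the outer
    variable. *)
Lemma irr_dvd_of_scaled (h B q : {poly {poly F}}) (c : {poly F}) :
  irr h -> (1 < size h)%N -> c != 0 -> c%:P * B = q * h -> rdvd h B.
Proof.
move=> irr_h h_gt1; have [m le_cm] := ubnP (size c).
elim: m c B q le_cm => // m IHm c B q le_cm c0 eqB.
have [c_gt1|c_le1] := ltnP 1 (size c); last first.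
  have cu := polyC_unit c0 c_le1.
  by exists (c%:P^-1 * q); rewrite -mulrA -eqB mulrA mulVr // mul1r.
have [p irr_p /(Pdiv.Field.dvdpP _ _)[c' ec]] := irreducible_factor c_gt1.
have p0 : p != 0 by apply: irredp_neq0 irr_p.
have pP0 : p%:P != 0 by rewrite polyC_eq0.
have c'0 : c' != 0 by apply: contraNneq c0 => c'0; rewrite ec c'0 mul0r.
have /(gauss_mul irr_p) [[q' eq']|[h' eh']] : q * h = p%:P * (c'%:P * B).
- by rewrite -eqB ec polyCM mulrA [p%:P * _]mulrC.
- apply: (IHm c' _ q') => //.
    by rewrite (leq_trans _ (ltnSE le_cm)) // ec size_factor_lt.
  by apply: (mulfI pP0); rewrite mulrA [_ * c'%:P]mulrC -polyCM -ec eqB eq' mulrA.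
have [h0 hu hf] := irr_h.
have [pu|h'u] := hf _ _ eh'.
- have [p_gt1 _] := irr_p.
  move: pu; rewrite poly_unitE size_polyC p0 coefC eqxx /=.
  by rewrite poly_unitE => /andP[/eqP sp]; rewrite sp in p_gt1.
- move: h_gt1; rewrite eh' size_Cmul //.
  by move: h'u; rewrite poly_unitE => /andP[/eqP ->].
Qed.

(** Each prime factor of [c] is absorbed by [q] or by [g]. Once [c] is a unit, [g] is up to a unit
    of positive degree and divides [h], so irreducibility makes the cofactor a unit. *)
Lemma irr_primitive_part (h g q : {poly {poly F}}) (c : {poly F}) :
  irr h -> (1 < size h)%N -> (1 < size g)%N -> c != 0 -> c%:P * h = q * g ->
  rdvd h g.
Proof.
move=> irr_h h_gt1; have [m le_cm] := ubnP (size c).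
elim: m c g q le_cm => // m IHm c g q le_cm g_gt1 c0 eqB.
have [h0 hu hf] := irr_h.
have [c_gt1|c_le1] := ltnP 1 (size c); last first.
  have cu := polyC_unit c0 c_le1.
  have eh : h = (c%:P^-1 * q) * g by rewrite -mulrA -eqB mulrA mulVr // mul1r.
  have [u|gu] := hf _ _ eh; last first.
    by move: gu; rewrite poly_unitE => /andP[/eqP sg]; rewrite sg in g_gt1.
  by exists (c%:P^-1 * q)^-1; rewrite eh mulKr.
have [p irr_p /(Pdiv.Field.dvdpP _ _)[c' ec]] := irreducible_factor c_gt1.
have p0 : p != 0 by apply: irredp_neq0 irr_p.
have pP0 : p%:P != 0 by rewrite polyC_eq0.
have c'0 : c' != 0 by apply: contraNneq c0 => c'0; rewrite ec c'0 mul0r.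
have lt_c'm : (size c' < m)%N.
  by rewrite (leq_trans _ (ltnSE le_cm)) // ec size_factor_lt.
have /(gauss_mul irr_p) [[q' eq']|[g' eg']] : q * g = p%:P * (c'%:P * h).
- by rewrite -eqB ec polyCM mulrA [p%:P * _]mulrC.
- apply: (IHm c' _ q') => //.
  by apply: (mulfI pP0); rewrite mulrA [_ * c'%:P]mulrC -polyCM -ec eqB eq' mulrA.
have [||k ek] := IHm c' g' q lt_c'm _ c'0.
- by move: g_gt1; rewrite eg' size_Cmul.
- by apply: (mulfI pP0); rewrite mulrA [_ * c'%:P]mulrC -polyCM -ec eqB eg' mulrCA.
by exists (p%:P * k); rewrite eg' ek mulrA.
Qed.

Lemma irr_const_prime (h A B : {poly {poly F}}) :
  irr h -> (size h <= 1)%N -> rdvd h (A * B) -> rdvd h A \/ rdvd h B.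
Proof.
move=> [h0 hu hf] /size1_polyC eh [q eqAB].
set p := h`_0 in eh.
have p0 : p != 0 by apply: contraNneq h0 => p0; rewrite eh p0.
have irr_p : irreducible_poly p.
  split.
    by rewrite ltnNge; apply: contra hu => p_le1; rewrite eh polyC_unit.
  move=> q1 q1_neq1 /(Pdiv.Field.dvdpP _ _)[q2 ep].
  have [u|u] : q2%:P \is a GRing.unit \/ q1%:P \is a GRing.unit.
  - by apply: hf; rewrite eh ep polyCM.
    move: u; rewrite poly_unitE size_polyC coefC eqxx /= poly_unitE => /andP[_ /andP[/eqP s2 _]].
    have /size_poly1P[a a0 e2] : size q2 == 1%N by rewrite s2.
    by rewrite ep e2 mul_polyC eqp_sym eqp_scale.
  move: u; rewrite poly_unitE size_polyC coefC eqxx /= poly_unitE => /andP[_ /andP[s1 _]].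
  by rewrite s1 in q1_neq1.
have /(gauss_mul irr_p)[[A' eA]|[B' eB]] : A * B = p%:P * q.
- by rewrite eqAB eh mulrC.
- by left; exists A'; rewrite eA eh mulrC.
- by right; exists B'; rewrite eB eh mulrC.
Qed.

(** Over F(x), either [h] and [A] are coprime, and a Bezout relation with cleared denominators gives
    a multiple of [B], or their gcd has positive degree and [h] divides it up to constants. *)
Lemma irr_prime_poly2 (h A B : {poly {poly F}}) :
  irr h -> rdvd h (A * B) -> rdvd h A \/ rdvd h B.
Proof.
move=> irr_h; have [h_le1|h_gt1] := leqP (size h) 1.
  exact: irr_const_prime.
move=> [q eqAB]; have [h0 hu hf] := irr_h.
have [cop|ncop] := boolP (coprimep h A).
  right; have [[u v] /= /Pdiv.CommonIdomain.eqpP[[c1 c2] /= /andP[c10 c20] e]] :=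
    Bezout_coprimepP _ _ cop.
  apply: (@irr_dvd_of_scaled h B (c1%:P * (u * B + v * q)) c2) => //.
  transitivity (c1 *: (u * h + v * A) * B).
    by rewrite e -mul_polyC mulr1.
  rewrite -mul_polyC; transitivity (c1%:P * (u * h * B + v * (A * B))); first by ring.
  by rewrite eqAB; ring.
left; set g := gcdp h A.
have g0 : g != 0 by rewrite gcdp_eq0 negb_and h0.
have g_gt1 : (1 < size g)%N.
  by rewrite ltn_neqAle eq_sym -coprimep_def ncop size_poly_gt0.
have /Pdiv.WeakIdomain.dvdpP[[c1 q1] /= c10 e1] := dvdp_gcdl h A.
have /Pdiv.WeakIdomain.dvdpP[[c2 q2] /= c20 e2] := dvdp_gcdr h A.
have [k ek] : rdvd h g.
  by apply: (@irr_primitive_part h g q1 c1) => //; rewrite mul_polyC.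
apply: (@irr_dvd_of_scaled h A (q2 * k) c2) => //.
by rewrite mul_polyC e2 -/g ek mulrA.
Qed.

End UnivariateFactor.

Lemma irr_iso (T U : idomainType) (f : {rmorphism T -> U}) (g : {rmorphism U -> T}) h :
  cancel f g -> cancel g f -> irr h -> irr (f h).
Proof.
move=> fK gK [h0 hu hf]; split.
- by apply: contraNneq h0 => fh0; rewrite -(fK h) fh0 rmorph0.
- by apply: contraNN hu => u; rewrite -(fK h) rmorph_unit.
- move=> a b eab; have /hf : h = g a * g b by rewrite -rmorphM -eab fK.
  by case=> u; [left; rewrite -(gK a)|right; rewrite -(gK b)]; rewrite rmorph_unit.
Qed.

Section TwoVariables.
Variable F : fieldType.
Local Notation P := {mpoly F[2]}.

(** The first variable becomes the inner one and the second the outer one; the isomorphism carries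
    primality over to [P]. *)
Definition to_poly2 : P -> {poly {poly F}} :=
  mmap (polyC \o polyC) (fun i : 'I_2 => if val i == 0%N then 'X%:P else 'X).

HB.instance Definition _ := GRing.RMorphism.on to_poly2.

Definition of_poly1 : {poly F} -> P :=
  horner_eval 'X_0 \o map_poly (@mpolyC 2 F).

HB.instance Definition _ := GRing.RMorphism.on of_poly1.

Definition of_poly2 : {poly {poly F}} -> P := horner_eval 'X_1 \o map_poly of_poly1.

HB.instance Definition _ := GRing.RMorphism.on of_poly2.

Lemma to_poly2_of_poly1 c : to_poly2 (of_poly1 c) = c%:P.
Proof.
rewrite /of_poly1 /= /horner_eval -horner_map /= -map_poly_comp /=.
have -> : to_poly2 'X_0 = 'X%:P by rewrite /to_poly2 /= mmapX mmap1U.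
rewrite (eq_map_poly (g := polyC \o polyC)); last by move=> a; rewrite /= /to_poly2 /= mmapC.
by rewrite map_poly_comp /= horner_map /= -/(comp_poly 'X c) comp_polyXr.
Qed.

Lemma of_poly2K : cancel of_poly2 to_poly2.
Proof.
move=> p; rewrite /of_poly2 /= /horner_eval -horner_map /= -map_poly_comp /=.
have -> : to_poly2 'X_1 = 'X by rewrite /to_poly2 /= mmapX mmap1U.
rewrite (eq_map_poly (g := polyC)) => [|c]; last exact: to_poly2_of_poly1.
by rewrite -/(comp_poly 'X p) comp_polyXr.
Qed.

Lemma to_poly2K : cancel to_poly2 of_poly2.
Proof.
move=> p; transitivity (\sum_(m <- msupp p) of_poly2 (to_poly2 (p@_m *: 'X_[m]))).
  by rewrite -!raddf_sum -mpolyE.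
rewrite [in RHS](mpolyE p).
apply: eq_bigr => m _; rewrite -mul_mpolyC !rmorphM /=; congr (_ * _).
  rewrite /to_poly2 mmapC /= /of_poly2 /= map_polyC /= /horner_eval hornerC.
  by rewrite /of_poly1 /= map_polyC /= /horner_eval hornerC.
rewrite /to_poly2 mmapX /mmap1 big_ord_recl big_ord1 /= rmorphM !rmorphXn /=.
rewrite /of_poly2 /= map_polyX map_polyC /= /horner_eval hornerX hornerC.
rewrite /of_poly1 /= map_polyX /= /horner_eval hornerX.
rewrite [in RHS]mpolyXE_id big_ord_recl big_ord1 /=.
congr ('X_[_] ^+ _ * 'X_[_] ^+ _); congr mnm1; exact: val_inj.
Qed.

Lemma irr_prime (h a b : P) : irr h -> rdvd h (a * b) -> rdvd h a \/ rdvd h b.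
Proof.
move=> irr_h [q eq_ab].
have irr_h' : irr (to_poly2 h) by apply: irr_iso irr_h; [exact: to_poly2K|exact: of_poly2K].
have : rdvd (to_poly2 h) (to_poly2 a * to_poly2 b).
  by exists (to_poly2 q); rewrite -!rmorphM eq_ab.
case/(irr_prime_poly2 irr_h') => -[q' e]; [left|right]; exists (of_poly2 q').
  by rewrite -[a]to_poly2K e rmorphM /= to_poly2K.
by rewrite -[b]to_poly2K e rmorphM /= to_poly2K.
Qed.

End TwoVariables.

(** * Polynomials vanishing on a set of points *)

Definition D (k : nat) : nat := #|{: 'X_{1..2 < k.+1}}|.

Lemma D2E k : (D k * 2 = k.+1 * k.+2)%N.
Proof.
pose i1 : 'I_2 := lift ord0 ord0.
have mdeg2 (m : 'X_{1..2}) : mdeg m = (m ord0 + m i1)%N.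
  by rewrite mdegE big_ord_recl big_ord1.
pose f (m : 'X_{1..2 < k.+1}) : 'I_k.+1 * 'I_k.+1 := (inord (m ord0), inord (m i1)).
have lt0 (m : 'X_{1..2 < k.+1}) : (m ord0 < k.+1)%N.
  by apply: leq_ltn_trans (bmdeg m); rewrite mdeg2 leq_addr.
have lt1 (m : 'X_{1..2 < k.+1}) : (m i1 < k.+1)%N.
  by apply: leq_ltn_trans (bmdeg m); rewrite mdeg2 leq_addl.
have injf : injective f.
  move=> m m' [/(congr1 val) /= e0 /(congr1 val) /= e1].
  move: e0 e1; rewrite !inordK // => e0 e1.
  apply/val_inj/mnmP => i; case: (unliftP ord0 i) => [j ->|-> //].
  by rewrite ord1.
rewrite /D -(card_image injf).
have -> : #|[seq f x | x in {: 'X_{1..2 < k.+1}}]| = #|[pred p : 'I_k.+1 * 'I_k.+1 | p.1 + p.2 <= k]|%N.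
  apply: eq_card => -[a b]; rewrite inE /=; apply/imageP/idP => [[m _ [-> ->]]|le_k].
    rewrite !inordK //; have := bmdeg m; rewrite mdeg2; lia.
  pose m := [multinom (if i == ord0 then a : nat else b) | i < 2].
  have hm : (mdeg m < k.+1)%N by rewrite mdeg2 !mnmE /= ltnS.
  by exists (BMultinom hm) => //; rewrite /f /= !mnmE /= !inord_val.
rewrite -sum1_card (eq_bigl (fun p : 'I_k.+1 * 'I_k.+1 => predT p.1 && (p.1 + p.2 <= k)%N)) //.
rewrite -(pair_big_dep _ (fun i j : 'I_k.+1 => (i + j <= k)%N) (fun _ _ => 1%N)) /=.
transitivity ((\sum_(i < k.+1) (k.+1 - i)) * 2)%N.
  congr (_ * 2)%N; apply: eq_bigr => i _.
  rewrite sum1_card; transitivity #|'I_(k.+1 - i)|; last by rewrite card_ord.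
  have le_ik : (k.+1 - i <= k.+1)%N by rewrite leq_subr.
  rewrite -(card_image (f := widen_ord le_ik)); last first.
    by move=> x y /(congr1 val) /= e; apply: val_inj.
  apply: eq_card => j; rewrite unfold_in; apply/idP/imageP => [le_k|[x _ ->]] /=.
    have hj : (j < k.+1 - i)%N by have := ltn_ord i; lia.
    by exists (Ordinal hj) => //; apply: val_inj.
  by have := ltn_ord x; have := ltn_ord i; lia.
elim: k {f lt0 lt1 injf} => [|k IHk]; first by rewrite big_ord1.
rewrite big_ord_recl /= subn0.
rewrite (eq_bigr (fun i : 'I_k.+1 => (k.+1 - i)%N)) => [|i _]; last by rewrite /= subSS.
by rewrite mulnDl IHk; lia.
Qed.

Section Plane.
Variable R : realType.
Local Notation P := {mpoly R[2]}.
Local Notation point := (point R).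
Implicit Types (p q f g h : P) (z s t : point) (S T : seq point).

Lemma ev2_0 z : ev2 0 z = 0 :> R. Proof. exact: meval0. Qed.
Lemma ev2_1 z : ev2 1 z = 1 :> R. Proof. exact: meval1. Qed.
Lemma ev2D p q z : ev2 (p + q) z = ev2 p z + ev2 q z. Proof. exact: mevalD. Qed.
Lemma ev2B p q z : ev2 (p - q) z = ev2 p z - ev2 q z. Proof. exact: mevalB. Qed.
Lemma ev2M p q z : ev2 (p * q) z = ev2 p z * ev2 q z. Proof. exact: mevalM. Qed.
Lemma ev2Z c p z : ev2 (c *: p) z = c * ev2 p z. Proof. exact: mevalZ. Qed.
Lemma ev2_sum (I : Type) (r : seq I) (Q : pred I) (F : I -> P) z :
  ev2 (\sum_(i <- r | Q i) F i) z = \sum_(i <- r | Q i) ev2 (F i) z.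
Proof. exact: raddf_sum. Qed.
Lemma ev2_prod (I : Type) (r : seq I) (Q : pred I) (F : I -> P) z :
  ev2 (\prod_(i <- r | Q i) F i) z = \prod_(i <- r | Q i) ev2 (F i) z.
Proof. exact: rmorph_prod. Qed.

Lemma unit_ev2 p z : p \is a GRing.unit -> ev2 p z != 0.
Proof.
move=> u; have : ev2 (p * p^-1) z = 1 by rewrite divrr // ev2_1.
by rewrite ev2M => e; apply/eqP => p0; move/eqP: e; rewrite p0 mul0r eq_sym oner_eq0.
Qed.

(** The zero polynomial gets degree 0, so it belongs to every space [V k S]. *)
Definition deg p : nat := (msize p).-1.

Lemma msizeS p : p != 0 -> msize p = (deg p).+1.
Proof. by rewrite -msize_poly_eq0 /deg; case: (msize p). Qed.

Lemma degM p q : p != 0 -> q != 0 -> deg (p * q) = (deg p + deg q)%N.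
Proof. by move=> p0 q0; rewrite /deg msizeM // !msizeS // addSn addnS. Qed.

Lemma deg_prod (I : finType) (x : I -> P) (Q : pred I) : (forall c, x c != 0) ->
  deg (\prod_(c | Q c) x c) = (\sum_(c | Q c) deg (x c))%N.
Proof.
move=> x0; suff [_ ->] : \prod_(c | Q c) x c != 0 /\
    deg (\prod_(c | Q c) x c) = (\sum_(c | Q c) deg (x c))%N by [].
elim/big_rec2: _ => [|c m p _ [p0 <-]]; first by rewrite oner_eq0 /deg msize1.
by rewrite mulf_neq0 // degM.
Qed.

Lemma deg_le k p : (msize p <= k.+1)%N = (deg p <= k)%N.
Proof. by rewrite /deg; case: (msize p). Qed.

Lemma degZ_le c p : (deg (c *: p) <= deg p)%N.
Proof. by rewrite -deg_le (leq_trans (msizeZ_le _ _)) // deg_le. Qed.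

Lemma degD_le p q k : (deg p <= k)%N -> (deg q <= k)%N -> (deg (p + q) <= k)%N.
Proof.
rewrite -!deg_le => hp hq; apply: leq_trans (msizeD_le _ _) _.
by rewrite geq_max hp.
Qed.

Lemma deg_sum (I : finType) (F : I -> P) k :
  (forall i, (deg (F i) <= k)%N) -> (deg (\sum_i F i) <= k)%N.
Proof.
move=> hF; elim/big_ind: _ => //; first by rewrite /deg msize0.
by move=> p q; apply: degD_le.
Qed.

Lemma degM_le p q k l : (deg p <= k)%N -> (deg q <= l)%N -> (deg (p * q) <= k + l)%N.
Proof.
move=> hp hq; have [->|p0] := eqVneq p 0; first by rewrite mul0r /deg msize0.
have [->|q0] := eqVneq q 0; first by rewrite mulr0 /deg msize0.
by rewrite degM // leq_add.
Qed.

Definition vanish S p := all (fun z => ev2 p z == 0) S.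

Definition V k S p := (deg p <= k)%N && vanish S p.

Lemma vanishP S p : reflect (forall z, z \in S -> ev2 p z = 0) (vanish S p).
Proof. by apply: (iffP allP) => h z zS; apply/eqP; apply: h. Qed.

Lemma V_D k S p q : V k S p -> V k S q -> V k S (p + q).
Proof.
move=> /andP[dp /vanishP vp] /andP[dq /vanishP vq]; rewrite /V degD_le //.
by apply/vanishP => z zS; rewrite ev2D vp // vq // addr0.
Qed.

Lemma V_Z k S c p : V k S p -> V k S (c *: p).
Proof.
move=> /andP[dp /vanishP vp]; rewrite /V (leq_trans (degZ_le _ _)) //.
by apply/vanishP => z zS; rewrite ev2Z vp // mulr0.
Qed.

Lemma V_cons k s S p : V k (s :: S) p = (ev2 p s == 0) && V k S p.
Proof. by rewrite /V /= andbCA. Qed.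

Lemma V_cat k S T p : V k (S ++ T) p = V k S p && vanish T p.
Proof. by rewrite /V /vanish all_cat andbA. Qed.

Lemma V_div h k S S' q : h != 0 -> {subset S' <= S} -> (forall z, z \in S' -> ev2 h z != 0) ->
  V k S (q * h) -> V (k - deg h) S' q.
Proof.
move=> h0 sub hz /andP[dp /vanishP vp]; apply/andP; split.
  have [->|q0] := eqVneq q 0; first by rewrite /deg msize0.
  by move: dp; rewrite degM //; lia.
apply/vanishP => z zS; apply: (mulIf (hz z zS)); rewrite mul0r -ev2M.
exact/vp/sub.
Qed.

Definition lfree m (b : 'I_m -> P) :=
  forall c : 'I_m -> R, \sum_i c i *: b i = 0 -> forall i, c i = 0.

Section Coordinates.
Variable k : nat.
Local Notation X := ('X_{1..2 < k.+1}).

Definition pol (u : 'rV[R]_(D k)) : P := \sum_i u 0 i *: 'X_[enum_val i : X].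
Definition cof (p : P) : 'rV[R]_(D k) := \row_i p@_(enum_val i : X).

Lemma polE u (m : X) : (pol u)@_m = u 0 (enum_rank m).
Proof.
rewrite /pol raddf_sum /= (bigD1 (enum_rank m)) //= mcoeffZ mcoeffX enum_rankK eqxx mulr1.
rewrite big1 ?addr0 // => i ne; rewrite mcoeffZ mcoeffX.
have -> : (bmnm (enum_val i) == m :> 'X_{1..2}) = false.
  by apply/negP => /eqP /val_inj e; rewrite -e enum_valK eqxx in ne.
by rewrite mulr0.
Qed.

Lemma polK : cancel pol cof.
Proof. by move=> u; apply/rowP => i; rewrite mxE polE enum_valK. Qed.

Lemma deg_pol u : (deg (pol u) <= k)%N.
Proof.
apply: deg_sum => i; apply: leq_trans (degZ_le _ _) _.
by rewrite -deg_le msizeX bmdeg.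
Qed.

Lemma cofK p : (deg p <= k)%N -> pol (cof p) = p.
Proof.
rewrite -deg_le => hp; apply/mpolyP => m.
have [lt_m|ge_m] := ltnP (mdeg m) k.+1.
  by rewrite (polE _ (BMultinom lt_m)) mxE enum_rankK.
have out q : (msize q <= k.+1)%N -> q@_m = 0.
  move=> hq; apply/eqP; rewrite mcoeff_eq0; apply: msize_mdeg_ge.
  exact: leq_trans hq ge_m.
by rewrite !out // deg_le deg_pol.
Qed.

Lemma polD u v : pol (u + v) = pol u + pol v.
Proof. by rewrite /pol -big_split; apply: eq_bigr => i _; rewrite mxE scalerDl. Qed.

Lemma polZ c u : pol (c *: u) = c *: pol u.
Proof. by rewrite /pol scaler_sumr; apply: eq_bigr => i _; rewrite mxE scalerA. Qed.

Lemma pol0 : pol 0 = 0.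
Proof. by rewrite /pol big1 // => i _; rewrite mxE scale0r. Qed.

Lemma pol_sum (I : Type) (r : seq I) (Q : pred I) (F : I -> 'rV[R]_(D k)) :
  pol (\sum_(i <- r | Q i) F i) = \sum_(i <- r | Q i) pol (F i).
Proof. by elim/big_rec2: _ => [|i x y _ <-]; rewrite ?pol0 ?polD. Qed.

Lemma pol_mulmx m (c : 'rV_m) (B : 'M_(m, D k)) :
  pol (c *m B) = \sum_i c 0 i *: pol (row i B).
Proof. by rewrite mulmx_sum_row pol_sum; apply: eq_bigr => i _; rewrite polZ. Qed.

Definition evmx S : 'M[R]_(D k, size S) :=
  \matrix_(i, j) ev2 'X_[enum_val i : X] (nth 0 S j).

Lemma mulmx_evmx u S : u *m evmx S = \row_j ev2 (pol u) (nth 0 S j).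
Proof.
apply/rowP => j; rewrite !mxE ev2_sum; apply: eq_bigr => i _.
by rewrite mxE ev2Z.
Qed.

Lemma sub_kermx_evmx u S : (u <= kermx (evmx S))%MS = V k S (pol u).
Proof.
rewrite /V deg_pol /=; apply/sub_kermxP/vanishP => [e z zS|h].
  have hj : (index z S < size S)%N by rewrite index_mem.
  move/rowP/(_ (Ordinal hj)): e.
  by rewrite mulmx_evmx !mxE /= nth_index.
by apply/rowP => j; rewrite mulmx_evmx !mxE h // mem_nth.
Qed.

Lemma lfreeP m (B : 'M_(m, D k)) : reflect (lfree (fun i => pol (row i B))) (row_free B).
Proof.
apply: (iffP idP) => [/row_free_inj injB c ec i|fr].
  have : (\row_i c i) *m B = 0 *m B.
    apply: (can_inj polK); rewrite mul0mx pol0 pol_mulmx -[RHS]ec.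
    by apply: eq_bigr => j _; rewrite mxE.
  by move/injB => /rowP/(_ i); rewrite !mxE.
rewrite -kermx_eq0; apply/eqP/row_matrixP => i; rewrite row0.
apply/rowP => j; have := sub_kermxP (row_sub i (kermx B)).
move=> /(congr1 pol); rewrite pol0 pol_mulmx => /fr ->; by rewrite mxE.
Qed.

Definition vdim S := \rank (kermx (evmx S)).

(** Trades the rank for independent families, so that dimensions can be compared by injections such
    as multiplication by a fixed polynomial. *)
Lemma vdimP S m : reflect (exists b : 'I_m -> P, lfree b /\ forall i, V k S (b i))
  (m <= vdim S)%N.
Proof.
apply: (iffP idP) => [le_m|[b [fr Vb]]].
  pose B := rowsub (widen_ord le_m) (row_base (kermx (evmx S))).
  exists (fun i => pol (row i B)); split=> [|i].
    apply/lfreeP/row_freeP.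
    have /row_freeP[C eC] := row_base_free (kermx (evmx S)).
    exists (colsub (widen_ord le_m) C); apply/matrixP => i j; rewrite !mxE.
    move/matrixP/(_ (widen_ord le_m i) (widen_ord le_m j)): eC.
    rewrite !mxE /= => e; rewrite -[RHS]e; apply: eq_bigr => l _; by rewrite !mxE.
  rewrite -sub_kermx_evmx row_rowsub.
  by apply: submx_trans (row_sub _ _) _; rewrite eq_row_base.
pose B := \matrix_i cof (b i).
have eB i : pol (row i B) = b i.
  by rewrite rowK cofK //; case/andP: (Vb i).
have /eqP <- : row_free B.
  by apply/lfreeP => c; under eq_bigr do rewrite eB; apply: fr.
apply: mxrankS; apply/row_subP => i; by rewrite sub_kermx_evmx eB.
Qed.

End Coordinates.

End Plane.

(** * Dimension of the polynomials vanishing at given points *)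

Section Dimension.
Variable R : realType.
Local Notation P := {mpoly R[2]}.
Local Notation point := (point R).
Implicit Types (p q f g h : P) (z s t : point) (S T : seq point).

Lemma vdim_mono k S k' S' : (forall p, V k S p -> V k' S' p) ->
  (vdim k S <= vdim k' S')%N.
Proof.
move=> h; apply/vdimP; have /vdimP[b [fr Vb]] := leqnn (vdim k S).
by exists b; split=> // i; apply: h.
Qed.

Lemma vdim_mul k S k' S' g : g != 0 -> (forall p, V k S p -> V k' S' (p * g)) ->
  (vdim k S <= vdim k' S')%N.
Proof.
move=> g0 h; apply/vdimP; have /vdimP[b [fr Vb]] := leqnn (vdim k S).
exists (fun i => b i * g); split=> [c ec|i]; last exact: h.
apply: fr; apply: (mulIf g0); rewrite mul0r mulr_suml -[RHS]ec.
by apply: eq_bigr => i _; rewrite scalerAl.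
Qed.

Lemma vdim_div k S k' S' g : (forall p, V k S p -> exists2 q, p = q * g & V k' S' q) ->
  (vdim k S <= vdim k' S')%N.
Proof.
move=> h; apply/vdimP; have /vdimP[b [fr Vb]] := leqnn (vdim k S).
have /choice[q hq] : forall i, exists q, b i = q * g /\ V k' S' q.
  by move=> i; have [q] := h _ (Vb i); exists q.
exists q; split=> [c ec|i]; last by case: (hq i).
apply: fr; transitivity (\sum_i (c i *: q i) * g).
  by apply: eq_bigr => i _; rewrite (proj1 (hq i)) scalerAl.
by rewrite -mulr_suml ec mul0r.
Qed.

Lemma vdim_gt0P k S : reflect (exists2 p, V k S p & p != 0) (0 < vdim k S)%N.
Proof.
apply: (iffP (vdimP _ _ _)) => [[b [fr Vb]]|[p Vp p0]].
  exists (b ord0) => //; apply/eqP => b0.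
  have := fr (fun=> 1); rewrite big_ord1 b0 scaler0 => /(_ erefl ord0)/eqP.
  by rewrite oner_eq0.
exists (fun=> p); split=> // c; rewrite big_ord1 => /eqP.
by rewrite scaler_eq0 (negPf p0) orbF => /eqP c0 i; rewrite ord1.
Qed.

Lemma vdim_eq0 k S : vdim k S = 0%N -> forall p, V k S p -> p = 0.
Proof.
move=> v0 p Vp; apply/eqP; apply: contraT => p0.
by have : (0 < vdim k S)%N by [apply/vdim_gt0P; exists p]; rewrite v0.
Qed.

Lemma vdim_le1 k S p q : (vdim k S <= 1)%N -> V k S p -> V k S q -> p != 0 ->
  exists c, q = c *: p.
Proof.
move=> v1 Vp Vq p0; apply: contrapT => nq.
suff : (1 < vdim k S)%N by rewrite ltnNge v1.
apply/vdimP; exists (fun i : 'I_2 => if i == ord0 then p else q); split=> [c|i]; last by case: ifP.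
rewrite big_ord_recl big_ord1 /= => e.
have c1 : c (lift ord0 ord0) = 0.
  apply/eqP; apply: contraT => c1; exfalso; apply: nq.
  exists (- (c (lift ord0 ord0))^-1 * c ord0).
  rewrite -scalerA -[c ord0 *: p](addrK (c (lift ord0 ord0) *: q)) e sub0r.
  by rewrite scaleNr scalerN opprK scalerA mulVf // scale1r.
move: e; rewrite c1 scale0r addr0 => /eqP; rewrite scaler_eq0 (negPf p0) orbF => /eqP c0 i.
by case: (unliftP ord0 i) => [j|] -> //; rewrite ord1.
Qed.

Lemma vdim_ge2 k S : (1 < vdim k S)%N ->
  exists p q, [/\ V k S p, V k S q, p != 0 & forall c, q != c *: p].
Proof.
move/vdimP => [b [fr Vb]]; exists (b ord0), (b (lift ord0 ord0)); split=> //.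
  apply/eqP => b0.
  have := fr (fun i => (i == ord0)%:R).
  rewrite big_ord_recl big_ord1 /= b0 scaler0 scale0r add0r => /(_ erefl ord0)/eqP.
  by rewrite eqxx oner_eq0.
move=> c; apply/eqP => e.
have := fr (fun i => if i == ord0 then - c else 1).
rewrite big_ord_recl big_ord1 /= e scale1r scaleNr addNr.
by move=> /(_ erefl (lift ord0 ord0))/eqP; rewrite oner_eq0.
Qed.

Lemma vdim_basis k S m : vdim k S = m -> exists b : 'I_m -> P,
  [/\ lfree b, forall i, V k S (b i) &
      forall p, V k S p -> exists c : 'I_m -> R, p = \sum_i c i *: b i].
Proof.
move=> <-; exists (fun i => pol (row i (row_base (kermx (evmx k S))))); split.
- by apply/lfreeP; apply: row_base_free.
- move=> i; rewrite -sub_kermx_evmx.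
  by apply: submx_trans (row_sub _ _) _; rewrite eq_row_base.
- move=> p Vp; have dp : (deg p <= k)%N by case/andP: Vp.
  have : (cof k p <= row_base (kermx (evmx k S)))%MS.
    by rewrite eq_row_base sub_kermx_evmx cofK.
  case/submxP => c ec; exists (c 0).
  by rewrite -(cofK dp) ec pol_mulmx.
Qed.

Lemma vdim_nil k : vdim k ([::] : seq point) = D k.
Proof. by rewrite /vdim mxrank_ker; apply/eqP; rewrite -[X in _ == X]subn0 thinmx0 mxrank0. Qed.

Lemma vdim_cons_le k s S : (vdim k S <= (vdim k (s :: S)).+1)%N.
Proof.
rewrite /vdim; set M := kermx (evmx k S); set E := evmx k [:: s].
have le1 : (\rank (row_base M *m E) <= 1)%N by apply: leq_trans (rank_leq_col _) _.
pose N := kermx (row_base M *m E) *m row_base M.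
have rN : \rank N = (\rank M - \rank (row_base M *m E))%N.
  by rewrite /N mxrankMfree ?row_base_free // mxrank_ker.
have : (N <= kermx (evmx k (s :: S)))%MS.
  apply/row_subP => i; rewrite sub_kermx_evmx V_cons; apply/andP; split.
    have : row i N *m E = 0 by rewrite -row_mul -mulmxA mulmx_ker row0.
    move/rowP/(_ ord0); rewrite mulmx_evmx !mxE /= => ->; exact: eqxx.
  rewrite -sub_kermx_evmx; apply: submx_trans (row_sub _ _) _.
  by apply: submx_trans (submxMl _ _) _; rewrite eq_row_base.
by move/mxrankS; rewrite rN; lia.
Qed.

Lemma vdim_cons_lt k s S p : V k S p -> ev2 p s != 0 ->
  vdim k S = (vdim k (s :: S)).+1.
Proof.
move=> Vp ps; apply/eqP; rewrite eqn_leq vdim_cons_le /=.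
have le : (kermx (evmx k (s :: S)) <= kermx (evmx k S))%MS.
  apply/row_subP => i; rewrite sub_kermx_evmx.
  by have := row_sub i (kermx (evmx k (s :: S))); rewrite sub_kermx_evmx V_cons => /andP[].
have [le_rk eq_rk] := mxrank_leqif_sup le.
rewrite ltn_neqAle le_rk andbT eq_rk; apply: contra ps => sub.
have dp : (deg p <= k)%N by case/andP: Vp.
have : (cof k p <= kermx (evmx k (s :: S)))%MS.
  by apply: submx_trans sub; rewrite sub_kermx_evmx cofK.
by rewrite sub_kermx_evmx cofK // V_cons => /andP[].
Qed.

Lemma vdim_cons_eq k s S : (forall p, V k S p -> ev2 p s = 0) ->
  vdim k (s :: S) = vdim k S.
Proof.
move=> h; apply/eqP; rewrite eqn_leq; apply/andP; split; apply: vdim_mono => p.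
  by rewrite V_cons => /andP[].
by move=> Vp; rewrite V_cons h // eqxx.
Qed.

Lemma vdim_size k S : (D k <= vdim k S + size S)%N.
Proof.
elim: S => [|s S IH]; first by rewrite vdim_nil addn0.
by have := vdim_cons_le k s S; rewrite /= ; lia.
Qed.

Lemma vdim_cat_size k S T : (vdim k T <= vdim k (S ++ T) + size S)%N.
Proof.
elim: S => [|s S IH] /=; first by rewrite addn0.
by have := vdim_cons_le k s (S ++ T); lia.
Qed.

Lemma V_sub k S S' p : {subset S' <= S} -> V k S p -> V k S' p.
Proof.
move=> sub /andP[dp /vanishP vp]; rewrite /V dp; apply/vanishP => z zS.
exact/vp/sub.
Qed.

Lemma vdim_sub k S S' : {subset S' <= S} -> (vdim k S <= vdim k S')%N.
Proof. by move=> sub; apply: vdim_mono => p; apply: V_sub. Qed.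

End Dimension.

(** * Bezout's theorem *)

Section Bezout.
Variable R : realType.
Local Notation P := {mpoly R[2]}.
Local Notation point := (point R).
Implicit Types (p q f g h u v : P) (z s t : point) (S T X : seq point).

Lemma unitE_deg p : p != 0 -> (p \is a GRing.unit) = (deg p == 0%N).
Proof.
move=> p0; apply/idP/idP => [u|].
  have := degM p0 (_ : p^-1 != 0); rewrite divrr // invr_eq0 => /(_ p0).
  by rewrite /deg msize1 /=; case: (msize p).-1.
rewrite -leqn0 -deg_le => /msize1_polyC ep.
rewrite ep; apply: rmorph_unit; rewrite unitfE.
by apply: contraNneq p0 => c0; rewrite ep c0 mpolyC0.
Qed.

Lemma irr_neq0 h : irr h -> h != 0. Proof. by case. Qed.

Lemma irr_deg h : irr h -> (0 < deg h)%N.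
Proof. by case=> h0 hu _; rewrite lt0n -unitE_deg. Qed.

Lemma irr_factor p : (0 < deg p)%N -> exists2 h, irr h & rdvd h p.
Proof.
have [m le_pm] := ubnP (deg p); elim: m p le_pm => // m IHm p le_pm p_gt0.
have p0 : p != 0 by apply: contraTneq p_gt0 => ->; rewrite /deg msize0.
have [irr_p|nirr] := pselect (irr p); first by exists p => //; exists 1; rewrite mul1r.
have [a [b [eab [au bu]]]] : exists a b, p = a * b /\ (a \isn't a GRing.unit) /\ (b \isn't a GRing.unit).
  apply: contrapT => nab; apply: nirr; split=> // [|a b eab].
    by rewrite unitE_deg // -lt0n.
  have [ua|na] := boolP (a \is a GRing.unit); first by left.
  have [ub|nb] := boolP (b \is a GRing.unit); first by right.
  by case: nab; exists a, b.
have a0 : a != 0 by apply: contraNneq p0 => a0; rewrite eab a0 mul0r.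
have b0 : b != 0 by apply: contraNneq p0 => b0; rewrite eab b0 mulr0.
rewrite unitE_deg // -lt0n in au; rewrite unitE_deg // -lt0n in bu.
have [|h irr_h [q ea]] := IHm a _ au.
  by move: le_pm; rewrite eab degM //; lia.
by exists h => //; exists (b * q); rewrite eab ea; ring.
Qed.

Definition no_common f g := forall h, irr h -> rdvd h f -> ~ rdvd h g.

Lemma no_common_irr f h : irr h -> ~ rdvd h f -> no_common f h.
Proof.
move=> irr_h nf k irr_k [a ea] [b eb]; apply: nf.
have [_ _ /(_ _ _ eb)[ub|uk]] := irr_h; last by case: irr_k => _ /negP.
by exists (a * b^-1); rewrite ea eb mulrA mulrVK.
Qed.

(** Irreducible factors of [g] are peeled off: each is prime and does not divide [f], so it divides
    [u]. *)
Lemma no_common_dvd f g u v : no_common f g -> g != 0 -> u * f = v * g -> rdvd g u.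
Proof.
have [m le_gm] := ubnP (deg g); elim: m g u v le_gm => // m IHm g u v le_gm nc g0 e.
have [dg0|g_gt0] := posnP (deg g).
  by exists (u / g); rewrite mulrVK // unitE_deg // dg0.
have [h irr_h [g' eg]] := irr_factor g_gt0.
have h0 := irr_neq0 irr_h.
have g'0 : g' != 0 by apply: contraNneq g0 => g'0; rewrite eg g'0 mul0r.
have [|[u' eu]|hf] := @irr_prime _ h u f irr_h.
- by exists (v * g'); rewrite e eg mulrA.
- have [||||k ek] := IHm g' u' v.
  + by move: le_gm; rewrite eg degM //; have := irr_deg irr_h; lia.
  + move=> k irr_k kf [b eb]; apply: (nc k irr_k kf).
    by exists (b * h); rewrite eg eb mulrAC.
  + by [].
  + by apply: (mulIf h0); rewrite mulrAC -eu e eg mulrA.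
  by exists k; rewrite eu ek eg mulrA.
by case: (nc h irr_h hf); exists g'.
Qed.

Lemma line_sep x s : x != s -> exists l : P, [/\ (deg l <= 1)%N, ev2 l x = 0 & ev2 l s != 0].
Proof.
have ev0 z : ev2 'X_0 z = z.1 :> R by rewrite /ev2 mevalXU.
have ev1 z : ev2 'X_1 z = z.2 :> R by rewrite /ev2 mevalXU.
have evC (c : R) z : ev2 c%:MP z = c by rewrite /ev2 mevalC.
have dX (i : 'I_2) (c : R) : (deg ('X_i - c%:MP) <= 1)%N.
  rewrite -mpolyCN; apply: degD_le; first by rewrite -deg_le msizeX mdeg1.
  by rewrite -deg_le msizeC; case: (_ == _).
move=> nxs; have [e1|n1] := eqVneq x.1 s.1.
  exists ('X_1 - x.2%:MP); split=> //; rewrite ev2B ev1 evC ?subrr //.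
  rewrite subr_eq0 eq_sym; apply: contraNneq nxs => e2.
  by rewrite [x]surjective_pairing [s]surjective_pairing e1 e2.
by exists ('X_0 - x.1%:MP); split=> //; rewrite ev2B ev0 evC ?subrr // subr_eq0 eq_sym.
Qed.

Lemma sep_points X s : s \notin X -> exists2 p : P, V (size X) X p & ev2 p s != 0.
Proof.
elim: X => [|x X IH].
  by exists 1; rewrite ?ev2_1 ?oner_eq0 // /V /= /deg msize1.
rewrite inE negb_or eq_sym => /andP[nxs /IH[p /andP[dp vp] ps]].
have [l [dl lx ls]] := line_sep nxs.
exists (l * p); last by rewrite ev2M mulf_neq0.
rewrite V_cons ev2M lx mul0r eqxx /= /V; apply/andP; split.
  by rewrite -[X in (_ <= X)%N]add1n; apply: degM_le.
by apply/vanishP => z zX; rewrite ev2M (vanishP _ _ vp) // mulr0.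
Qed.

Lemma V_deg k k' S p : (k <= k')%N -> V k S p -> V k' S p.
Proof. by move=> le /andP[dp vp]; rewrite /V (leq_trans dp). Qed.

Lemma vdim_indep m X : uniq X -> (size X <= m.+1)%N -> (vdim m X + size X = D m)%N.
Proof.
elim: X => [|x X IH] /=; first by rewrite vdim_nil addn0.
move=> /andP[nx uX] le_m; have [p Vp px] := sep_points nx.
have Vmp : V m X p by apply: V_deg Vp.
by rewrite addnS -addSn -(vdim_cons_lt Vmp px) IH // ltnW.
Qed.

Section MultiplicationMatrix.
Variables (k m : nat) (f : P).

Definition mulpoly_mx : 'M[R]_(D k, D m) :=
  \matrix_i cof m ('X_[enum_val i : 'X_{1..2 < k.+1}] * f).

Lemma mul_mulpoly_mx (u : 'rV_(D k)) : u *m mulpoly_mx = cof m (pol u * f).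
Proof.
rewrite mulmx_sum_row; apply/rowP => j; rewrite summxE !mxE /pol mulr_suml raddf_sum /=.
by apply: eq_bigr => i _; rewrite !mxE -scalerAl mcoeffZ.
Qed.

End MultiplicationMatrix.

(** A dimension count in degree m = a + b + c with c = |X|. The combinations of [f] and [g] span at
    least D (b+c) + D (a+c) - D c dimensions of the polynomials vanishing on [X]; these have
    dimension D m - c, since m is large enough for the points to impose independent conditions. The
    difference is ab - c. *)
Lemma bezout f g X : f != 0 -> g != 0 -> no_common f g -> uniq X ->
  vanish X f -> vanish X g -> (size X <= deg f * deg g)%N.
Proof.
move=> f0 g0 nc uX vf vg.
have [a ea] : {a | deg f = a} by exists (deg f).
have [b eb] : {b | deg g = b} by exists (deg g).
have [c ec] : {c | size X = c} by exists (size X).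
rewrite ea eb ec; set m := (a + b + c)%N.
pose M := col_mx (mulpoly_mx (b + c) m f) (mulpoly_mx (a + c) m g).
have dfu (u : 'rV[R]_(D (b + c))) : (deg (pol u * f) <= m)%N.
  have -> : m = (b + c + a)%N by rewrite /m; lia.
  by apply: degM_le; rewrite ?deg_pol // ea.
have dgv (v : 'rV[R]_(D (a + c))) : (deg (pol v * g) <= m)%N.
  have -> : m = (a + c + b)%N by rewrite /m; lia.
  by apply: degM_le; rewrite ?deg_pol // eb.
have mulM (u : 'rV_(D (b + c))) (v : 'rV_(D (a + c))) : row_mx u v *m M = cof m (pol u * f + pol v * g).
  rewrite mul_row_col !mul_mulpoly_mx; apply/rowP => j.
  by rewrite !mxE mcoeffD.
have sub_ker : (M <= kermx (evmx m X))%MS.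
  apply/row_subP => i; rewrite rowE -[delta_mx _ _]hsubmxK mulM sub_kermx_evmx cofK ?degD_le //.
  rewrite /V degD_le //=; apply/vanishP => z zX.
  by rewrite ev2D !ev2M (vanishP _ _ vf) // (vanishP _ _ vg) // !mulr0 addr0.
(* Every syzygy of [f] and [g] is a multiple w (g, -f), with w of degree at most c because [f] and
   [g] have no common factor. *)
have rk_ker : (\rank (kermx M) <= D c)%N.
  pose N := row_mx (mulpoly_mx c (b + c) g) (- mulpoly_mx c (a + c) f).
  apply: leq_trans (rank_leq_row N); apply: mxrankS; apply/row_subP => i.
  set r := row i _; have : r *m M = 0 by apply: sub_kermxP; apply: row_sub.
  rewrite -[r]hsubmxK mulM => /(congr1 (@pol R m)).
  rewrite cofK ?degD_le // pol0 => /eqP; rewrite addr_eq0 -mulNr => /eqP e.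
  have [w ew] := no_common_dvd nc g0 e.
  have dw : (deg w <= c)%N.
    have [->|w0] := eqVneq w 0; first by rewrite /deg msize0.
    have := deg_pol (lsubmx r); rewrite ew degM // eb; lia.
  have e2 : pol (rsubmx r) = - (w * f).
    by apply: (mulIf g0); rewrite -[LHS]opprK -mulNr -e ew; ring.
  apply/submxP; exists (cof c w).
  rewrite mul_mx_row mulmxN !mul_mulpoly_mx !cofK // -ew polK; congr row_mx.
  by rewrite -[LHS]polK e2; apply/rowP => j; rewrite !mxE mcoeffN.
have rkM : (D (b + c) + D (a + c) = \rank M + \rank (kermx M))%N.
  by rewrite mxrank_ker subnKC // rank_leq_row.
have vX : (vdim m X + size X = D m)%N by apply: vdim_indep; rewrite // ec /m; lia.
have key : (D (b + c) + D (a + c) + a * b = D m + D c)%N.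
  have := D2E m; have := D2E c; have := D2E (a + c); have := D2E (b + c).
  rewrite /m; lia.
have := mxrankS sub_ker; rewrite -/(vdim m X) => le_rk.
rewrite ec in vX; move: vX key rkM rk_ker le_rk.
set r1 := \rank M; set r2 := \rank (kermx M); lia.
Qed.

End Bezout.

(** * Generic points on curves *)

Section Generic.
Variable R : realType.
Local Notation P := {mpoly R[2]}.
Local Notation point := (point R).
Implicit Types (p q f g h u v : P) (z s t : point) (T X : seq point).
Variables (C : finType) (x : C -> P) (d : nat) (TT : seq point -> Prop).
Implicit Types (S : seq (C * point)) (I : {set C}).

Definition pts S := [seq cs.2 | cs <- S].
Definition out I S := [seq cs <- S | cs.1 \notin I].
Definition xI I := \prod_(c in I) x c.

(* A colored point [(c, s)] is a generic point of the curve [x c], or of the plane if [x c = 0]. *)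
Definition gen_step S c s :=
  [/\ ev2 (x c) s = 0, forall c', c' != c -> ev2 (x c') s != 0 &
   forall T k S', TT T -> (k <= d)%N -> subseq S' S ->
     (forall p, V k (pts S' ++ T) p -> ev2 p s = 0) ->
     forall p, V k (pts S' ++ T) p -> rdvd (x c) p].

Fixpoint gen S : Prop :=
  if S is (c, s) :: S' then gen S' /\ gen_step S' c s else True.

Lemma gen_subseq S S' : subseq S' S -> gen S -> gen S'.
Proof.
elim: S S' => [|[c s] S IH] [|[c' s'] S'] //=.
case: eqP => [[-> ->] sub [gS [h1 h2 h3]]|_ sub [gS _]]; last exact: (IH ((c', s') :: S') sub gS).
split; first exact: IH.
split=> // T k S'' hT hk sub''; apply: h3 => //.
exact: subseq_trans sub.
Qed.

Lemma gen_mem S c s : gen S -> (c, s) \in S ->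
  ev2 (x c) s = 0 /\ forall c', c' != c -> ev2 (x c') s != 0.
Proof.
elim: S => [|[c' s'] S IH] //= [gS [h1 h2 _]].
by rewrite inE => /orP[/eqP[-> ->]|]; [split|exact: IH].
Qed.

Lemma indep_or_base k S T :
  (vdim k (pts S ++ T) + size S = vdim k T)%N \/
  exists S1 c s S2, S = S1 ++ (c, s) :: S2 /\
    forall p, V k (pts S2 ++ T) p -> ev2 p s = 0.
Proof.
elim: S => [|[c s] S [IH|[S1 [c' [s' [S2 [-> h]]]]]]] /=; first by left; rewrite addn0.
  have [/existsNP[p /not_implyP[Vp /eqP ps]]|/contrapT h] :=
      pselect (~ forall p, V k (pts S ++ T) p -> ev2 p s = 0).
    by left; rewrite addnS -addSn -(vdim_cons_lt Vp ps).
  by right; exists [::], c, s, S.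
by right; exists ((c, s) :: S1), c', s', S2.
Qed.

(** If the points are dependent, one of them is a base point of the system through the points after
    it in the list, and genericity makes its curve [x c] a fixed component. Dividing by [x c]
    removes exactly the points of color [c], since the others are off [x c]; the induction continues
    in lower degree. [I] collects the fixed components, and the points of other colors are
    independent. *)
Lemma generic_structure T S k : gen S -> TT T -> (k <= d)%N ->
  (forall c z, z \in T -> x c != 0 -> ev2 (x c) z != 0) ->
  (forall p, V k (pts S ++ T) p -> p = 0) \/
  exists I, [/\ forall c, c \in I -> x c != 0 /\ c \in [seq cs.1 | cs <- S],
    (deg (xI I) <= k)%N,
    forall p, V k (pts S ++ T) p -> rdvd (xI I) p &
    (vdim k (pts S ++ T) + size (out I S) = vdim (k - deg (xI I)) T)%N].
Proof.
move=> gS hT le_kd xT; have [m le_Sm] := ubnP (size S).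
elim: m S k le_Sm gS le_kd => // m IHm S k le_Sm gS le_kd.
have [indep|[S1 [c [s [S2 [eS base_s]]]]]] := indep_or_base k S T.
  right; exists set0; rewrite /xI big_set0 /deg msize1 subn0; split=> //.
  - by move=> c; rewrite inE.
  - by move=> p _; exists p; rewrite mulr1.
  - rewrite -indep; congr (_ + size _)%N; apply/all_filterP/allP => cs _.
    by rewrite inE.
have [gS2 [_ _ gstep]] : gen ((c, s) :: S2).
  by apply: gen_subseq gS; rewrite eS suffix_subseq.
have dvd_c p : V k (pts S ++ T) p -> rdvd (x c) p.
  move=> Vp; apply: (gstep T k S2) => //.
  apply: V_sub Vp => z; rewrite eS /pts map_cat /= !mem_cat inE.
  by case/orP=> ->; rewrite !orbT.
have [xc0|xc0] := eqVneq (x c) 0.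
  by left=> p /dvd_c[q ->]; rewrite xc0 mulr0.
have [lt_ek|le_ek] := ltnP k (deg (x c)).
  left=> p Vp; have [q eq_p] := dvd_c p Vp; apply/eqP; apply: contraT => p0.
  have q0 : q != 0 by apply: contraNneq p0 => q0; rewrite eq_p q0 mul0r.
  by move: Vp; rewrite /V eq_p degM // => /andP[]; lia.
set e := deg (x c) in le_ek *; pose S' := out [set c] S.
have lt_S' : (size S' < size S)%N.
  rewrite /S' size_filter -[X in (_ < X)%N](count_predC (fun cs => cs.1 \notin [set c])).
  rewrite -[X in (X < _)%N]addn0 ltn_add2l -has_count; apply/hasP; exists (c, s).
    by rewrite eS mem_cat inE eqxx orbT.
  by rewrite /= inE eqxx.
have gS' : gen S' by apply: gen_subseq gS; apply: filter_subseq.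
have down p : V k (pts S ++ T) p -> exists2 q, p = q * x c & V (k - e) (pts S' ++ T) q.
  move=> Vp; have [q eq_p] := dvd_c p Vp; exists q => //; rewrite eq_p in Vp.
  apply: V_div Vp => // z zS.
    move: zS; rewrite !mem_cat => /orP[/mapP[cs]|->]; last by rewrite orbT.
    by rewrite mem_filter => /andP[_ inS] ->; rewrite map_f.
  move: zS; rewrite mem_cat => /orP[/mapP[[c' z'] /=]|zT]; last exact: xT.
  rewrite mem_filter inE /= => /andP[ne inS ->].
  by have [_] := gen_mem gS inS; apply; rewrite eq_sym.
have up q : V (k - e) (pts S' ++ T) q -> V k (pts S ++ T) (q * x c).
  move=> /andP[dq /vanishP vq]; apply/andP; split.
    by rewrite -(subnK le_ek); apply: degM_le.
  apply/vanishP => z zS; rewrite ev2M.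
  move: zS; rewrite mem_cat => /orP[/mapP[[c' z'] /= inS ->]|zT].
    have [ec|ne] := eqVneq c' c.
      by have [h _] := gen_mem gS inS; rewrite -ec h mulr0.
    rewrite vq ?mul0r // mem_cat; apply/orP; left; apply/mapP; exists (c', z') => //.
    by rewrite mem_filter inE /= ne inS.
  by rewrite vq ?mul0r // mem_cat zT orbT.
have evd : vdim k (pts S ++ T) = vdim (k - e) (pts S' ++ T).
  by apply/eqP; rewrite eqn_leq; apply/andP; split; [apply: vdim_div down|apply: vdim_mul up].
have [|||z0|[I [hI dI dvdI vdI]]] := IHm S' (k - e)%N.
- by move: le_Sm lt_S'; lia.
- by [].
- by rewrite (leq_trans _ le_kd) // leq_subr.
- by left=> p /down[q -> /z0 ->]; rewrite mul0r.
have cI : c \notin I.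
  apply/negP => /hI[_ /mapP[[c' s'] /=]]; rewrite mem_filter inE /= => /andP[/eqP ne _] ec.
  by rewrite ec in ne.
have xI0 : xI I != 0 by apply/prodf_neq0 => c' /hI[].
have exI : xI (c |: I) = x c * xI I by rewrite /xI big_setU1.
right; exists (c |: I); rewrite exI degM // -/e; split.
- move=> c'; rewrite !inE => /orP[/eqP ->|/hI[x0]].
    by split=> //; rewrite eS map_cat mem_cat inE /= eqxx orbT.
  by move=> /mapP[cs]; rewrite mem_filter => /andP[_ inS] ec'; split; rewrite // ec' map_f.
- by lia.
- move=> p /down[q -> /dvdI[r ->]]; exists r; ring.
- rewrite evd subnDA -vdI; congr (_ + size _)%N.
  rewrite /S' /out -filter_predI; apply: eq_filter => cs /=.
  by rewrite !inE negb_or andbC.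
Qed.

End Generic.

(** * Ordinary crossings of lines in the projective plane *)

Section Space3.
Variable R : realFieldType.

(** Homogeneous coordinates for points and for lines of the projective plane: [dot] is incidence,
    [cross] is the meet of two lines or the join of two points. *)
Definition vec := (R * R * R)%type.
Implicit Types (a b c l u v w : vec) (s t : R).

Definition dot a u : R := a.1.1 * u.1.1 + a.1.2 * u.1.2 + a.2 * u.2.
Definition cross a b : vec :=
  (a.1.2 * b.2 - a.2 * b.1.2, a.2 * b.1.1 - a.1.1 * b.2, a.1.1 * b.1.2 - a.1.2 * b.1.1).
Definition vadd u v : vec := (u.1.1 + v.1.1, u.1.2 + v.1.2, u.2 + v.2).
Definition vscl t u : vec := (t * u.1.1, t * u.1.2, t * u.2).
Definition v0 : vec := (0, 0, 0).

Lemma vecP u v : u.1.1 = v.1.1 -> u.1.2 = v.1.2 -> u.2 = v.2 -> u = v.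
Proof. by case: u v => [[? ?] ?] [[? ?] ?] /= -> -> ->. Qed.

End Space3.

Ltac vec_ring := apply: vecP; rewrite /cross /vadd /vscl /dot /v0 /=; ring.
Ltac dot_ring := rewrite /dot /cross /vadd /vscl /v0 /=; ring.

Section Geometry.
Variable R : realFieldType.
Local Notation vec := (vec R).
Local Notation v0 := (v0 R).
Implicit Types (a b c l u v w : vec) (s t : R).

Lemma dot_crossl a b : dot a (cross a b) = 0. Proof. dot_ring. Qed.
Lemma dot_crossr a b : dot b (cross a b) = 0. Proof. dot_ring. Qed.
Lemma dotC a u : dot a u = dot u a. Proof. dot_ring. Qed.
Lemma dotD a u v : dot a (vadd u v) = dot a u + dot a v. Proof. dot_ring. Qed.
Lemma dotZ a t u : dot a (vscl t u) = t * dot a u. Proof. dot_ring. Qed.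
Lemma dot0 a : dot a v0 = 0. Proof. dot_ring. Qed.
Lemma crossC a b : cross a b = vscl (-1) (cross b a). Proof. vec_ring. Qed.
Lemma crossZr a t b : cross a (vscl t b) = vscl t (cross a b). Proof. vec_ring. Qed.
Lemma crossvv a : cross a a = v0. Proof. vec_ring. Qed.
Lemma vscl0 u : vscl 0 u = v0. Proof. vec_ring. Qed.
Lemma vscl_v0 t : vscl t v0 = v0. Proof. vec_ring. Qed.
Lemma vsclA s t u : vscl s (vscl t u) = vscl (s * t) u. Proof. vec_ring. Qed.
Lemma vscl1 u : vscl 1 u = u. Proof. vec_ring. Qed.
Lemma dot_rot a b c : dot a (cross b c) = dot b (cross c a). Proof. dot_ring. Qed.
Lemma cross_crossr u a b : cross u (cross a b) = vadd (vscl (dot u b) a) (vscl (- dot u a) b). Proof. vec_ring. Qed.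
Lemma cross_common a b l : cross (cross a l) (cross b l) = vscl (dot l (cross a b)) l. Proof. vec_ring. Qed.

Lemma dot_self_eq0 u : dot u u = 0 -> u = v0.
Proof.
rewrite /dot -!expr2 => /eqP; rewrite !paddr_eq0 ?addr_ge0 ?sqr_ge0 // !sqrf_eq0.
by case: u => [[x y] z] /= /andP[/andP[/eqP -> /eqP ->] /eqP ->].
Qed.

Lemma vscl_eq0 t u : vscl t u = v0 -> t = 0 \/ u = v0.
Proof.
have [->|t0] := eqVneq t 0; first by left.
case=> e1 e2 e3; right; apply: vecP; apply: (mulfI t0) => /=; rewrite ?e1 ?e2 ?e3 mulr0 //.
Qed.

Lemma perp_cross a b u : cross a b <> v0 -> dot a u = 0 -> dot b u = 0 ->
  exists t, u = vscl t (cross a b).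
Proof.
set w := cross a b => w0 au bu.
have ww : dot w w != 0 by apply/eqP => /dot_self_eq0.
have e : cross w u = v0.
  rewrite crossC cross_crossr [dot u b]dotC bu [dot u a]dotC au.
  by vec_ring.
exists (dot w u / dot w w).
have e' : vscl (dot w w) u = vscl (dot w u) w.
  have : cross w (cross w u) = v0 by rewrite e; vec_ring.
  rewrite cross_crossr /vadd /vscl /v0 => -[e1 e2 e3].
  have sub0 (x y z t : R) : x * y + - z * t = 0 -> z * t = x * y.
    by move/eqP; rewrite mulNr subr_eq0 => /eqP.
  by apply: vecP => /=; apply: sub0.
by rewrite mulrC -vsclA -e' vsclA mulVf // vscl1.
Qed.

(** Either one sign is opposite to the other two, which will single out the middle one of three
    concurrent lines, or all three agree. *)
Lemma sign_pattern (A B C : R) : A != 0 -> B != 0 -> C != 0 ->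
  [\/ A * C < 0 /\ B * C < 0, C * B < 0 /\ A * B < 0, B * A < 0 /\ C * A < 0 |
    B * A > 0 /\ C * A > 0].
Proof.
have pp (x y : R) : 0 < x -> 0 < y -> 0 < x * y by exact: mulr_gt0.
have nn (x y : R) : x < 0 -> y < 0 -> 0 < x * y by move=> *; rewrite nmulr_rgt0.
have pn (x y : R) : 0 < x -> y < 0 -> x * y < 0 by move=> *; rewrite pmulr_rlt0.
have np (x y : R) : x < 0 -> 0 < y -> x * y < 0 by move=> *; rewrite nmulr_rlt0.
have [a|a|//] := ltrgtP A 0; have [b|b|//] := ltrgtP B 0; have [c|c|//] := ltrgtP C 0;
  move=> *; first [by constructor 1; split; auto | by constructor 2; split; auto
          |by constructor 3; split; auto | by constructor 4; split; auto].
Qed.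

Definition lexle (x y x' y' : R) := x < x' \/ (x = x' /\ y <= y').

(** * Extreme crossings in an affine chart and the middle line through them *)

Section Arrangement.
Variables (I : finType) (L : I -> vec).
Hypothesis L_dist : forall i j, i != j -> cross (L i) (L j) <> v0.

Local Notation X := (fun i j => cross (L i) (L j)).

(* In the affine chart with [l] at infinity and coordinates [lam / l], [mu / l], the crossing [u]
   is lexicographically largest. *)
Definition extreme l lam mu u := dot l u != 0 /\
  forall i j, i != j -> dot l (X i j) != 0 ->
    lexle (dot lam (X i j) / dot l (X i j)) (dot mu (X i j) / dot l (X i j))
          (dot lam u / dot l u) (dot mu u / dot l u).

Lemma extreme_exists l lam mu :
  (exists i j, i != j /\ dot l (X i j) != 0) ->
  exists i j, i != j /\ extreme l lam mu (X i j).
Proof.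
case=> i0 [j0 [ne0 l0]].
pose Q (p : I * I) := (p.1 != p.2) && (dot l (X p.1 p.2) != 0).
pose f (p : I * I) := dot lam (X p.1 p.2) / dot l (X p.1 p.2).
pose g (p : I * I) := dot mu (X p.1 p.2) / dot l (X p.1 p.2).
have Q0 : Q (i0, j0) by rewrite /Q /= ne0.
have [p1 Q1 max1] := arg_maxP f Q0.
pose Q' p := Q p && (f p == f p1).
have Q1' : Q' p1 by rewrite /Q' Q1 eqxx.
have [p2 /andP[/andP[ne2 l2] /eqP e2] max2] := arg_maxP g Q1'.
exists p2.1, p2.2; split=> //; split=> // i j ne lij; rewrite -/(f p2) -/(g p2).
have Qij : Q (i, j) by rewrite /Q /= ne.
rewrite -/(f (i, j)) -/(g (i, j)) e2.
have : f (i, j) <= f p1 := max1 _ Qij; rewrite le_eqVlt => /orP[/eqP ef|lt]; last by left.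
by right; split=> //; apply: max2; rewrite /Q' Qij ef eqxx.
Qed.

Lemma extreme_on l lam mu u i j w : extreme l lam mu u -> i != j ->
  dot (L i) w = 0 -> dot (L j) w = 0 -> dot l w != 0 ->
  lexle (dot lam w / dot l w) (dot mu w / dot l w) (dot lam u / dot l u) (dot mu u / dot l u).
Proof.
move=> [lu ext] ne iw jw lw; have [t ew] := perp_cross (L_dist ne) iw jw.
have t0 : t != 0 by apply: contraNneq lw => t0; rewrite ew t0 vscl0 dot0.
have lX : dot l (X i j) != 0.
  by apply: contraNneq lw => lX; rewrite ew dotZ lX mulr0.
have := ext i j ne lX; rewrite ew !dotZ.
by rewrite -!mulf_div divff // !mul1r.
Qed.

Section Chart.
Variables (l lam mu u : vec).
Hypothesis frame : dot l (cross lam mu) != 0.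
Hypothesis ext_u : extreme l lam mu u.

(** For a point at infinity, that is [dot l v = 0], this says that moving in the direction [v]
    descends in the lexicographic order of the chart. *)
Definition lexneg v := dot lam v < 0 \/ (dot lam v = 0 /\ dot mu v < 0).

Lemma lexneg_comb v w s t : 0 < s -> 0 < t -> lexneg v -> lexneg w ->
  lexneg (vadd (vscl s v) (vscl t w)).
Proof.
rewrite /lexneg !dotD !dotZ => s0 t0 [h1|[e1 h1]] [h2|[e2 h2]].
- by left; nra.
- by left; rewrite e2; nra.
- by left; rewrite e1; nra.
- by right; rewrite e1 e2 !mulr0 addr0; split=> //; nra.
Qed.

Lemma lexneg_asym v : lexneg v -> ~ lexneg (vscl (-1) v).
Proof. by rewrite /lexneg !dotZ !mulN1r => -[h|[e h]] [h'|[e' h']]; lra. Qed.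

Lemma lexneg_neq0 : ~ lexneg v0.
Proof. by rewrite /lexneg !dot0 ltxx => -[//|[]]. Qed.

Lemma frame_eq0 v : dot l v = 0 -> dot lam v = 0 -> dot mu v = 0 -> v = v0.
Proof.
move=> e1 e2 e3.
have : vscl (dot l (cross lam mu)) v = v0.
  have -> : vscl (dot l (cross lam mu)) v = vadd (vscl (dot l v) (cross lam mu))
    (vadd (vscl (dot lam v) (cross mu l)) (vscl (dot mu v) (cross l lam))).
    by vec_ring.
  by rewrite e1 e2 e3 !vscl0; vec_ring.
by case/vscl_eq0 => // e; move: frame; rewrite e eqxx.
Qed.

Lemma lexneg_sign v : dot l v = 0 -> v <> v0 ->
  exists s, s * s = 1 /\ lexneg (vscl s v).
Proof.
move=> lv v0'; rewrite /lexneg.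
have [h|h|h] := ltrgtP (dot lam v) 0.
- by exists 1; rewrite mulr1 vscl1; split=> //; left.
- by exists (-1); rewrite !dotZ; split; [ring|left; lra].
have [k|k|k] := ltrgtP (dot mu v) 0.
- by exists 1; rewrite mulr1 vscl1; split=> //; right.
- by exists (-1); rewrite !dotZ h; split; [ring|right; split; lra].
- by case: v0'; apply: frame_eq0.
Qed.

(* moving from [u] along a line against its downward direction [v] stays above [u],
   so no other line can be crossed there *)
Lemma no_crossing_above x k v : k != x -> dot (L x) u = 0 -> dot (L x) v = 0 ->
  dot l v = 0 -> lexneg v -> ~ 0 < dot (L k) v * (dot (L k) u / dot l u).
Proof.
move=> nkx xu xv lv neg_v pos; have [lu _] := ext_u.
set s := dot (L k) u / dot l u in pos; set kv := dot (L k) v in pos.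
have kv0 : kv != 0 by apply: contraTneq pos => ->; rewrite mul0r ltxx.
pose t := - s / kv.
have t_lt0 : t < 0.
  rewrite /t mulNr oppr_lt0; have [kp|kn|e] := ltrgtP kv 0; last by rewrite e eqxx in kv0.
  - by rewrite nmulr_rgt0 ?invr_lt0 //; nra.
  - by rewrite mulrC pmulr_rgt0 ?invr_gt0 //; nra.
pose w := vadd (vscl (dot l u)^-1 u) (vscl t v).
have lw : dot l w = 1 by rewrite /w dotD !dotZ lv mulVf // mulr0 addr0.
have kw : dot (L k) w = 0.
  by rewrite /w dotD !dotZ -/kv /t mulNr mulNr mulfVK // mulrC -/s subrr.
have xw : dot (L x) w = 0 by rewrite /w dotD !dotZ xu xv !mulr0 addr0.
have := extreme_on ext_u nkx kw xw; rewrite lw oner_neq0 !divr1 => /(_ isT).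
rewrite /w !dotD !dotZ ![(dot l u)^-1 * _]mulrC.
by case: neg_v => [h|[e h]] [h'|[e' h']]; nra.
Qed.

(** A line [k] through the point at infinity [vm] is parallel to [m] and misses [u]. As [vm] lies
    strictly between the downward directions [vp] and [vq], the form [L k] has opposite signs on
    these two, so [k] crosses [p] or [q] above [u], against the choice of [u]. *)
Lemma middle_core m p q vm vp vq al ga e k :
  dot (L p) u = 0 -> dot (L q) u = 0 -> dot (L m) u = 0 ->
  dot (L p) vp = 0 -> dot (L q) vq = 0 -> dot (L m) vm = 0 ->
  dot l vp = 0 -> dot l vq = 0 -> lexneg vp -> lexneg vq ->
  cross vp vq = vscl e l -> e != 0 -> 0 < al -> 0 < ga ->
  vm = vadd (vscl al vp) (vscl ga vq) ->
  dot lam vm != 0 /\ (k != m -> cross (L k) l <> v0 -> dot (L k) vm != 0).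
Proof.
move=> pu qu mu_ pp qq mm lp_ lq np nq evv e0 al0 ga0 evm; split.
  apply/negP; rewrite evm dotD !dotZ => /eqP lam0.
  have [lp0 lq0] : dot lam vp = 0 /\ dot lam vq = 0.
    by case: np nq => [h|[h _]] [h'|[h' _]]; split=> //; nra.
  have : dot (cross lam mu) (cross vp vq) = 0.
    have -> : dot (cross lam mu) (cross vp vq) =
      dot lam vp * dot mu vq - dot lam vq * dot mu vp by dot_ring.
    by rewrite lp0 lq0; ring.
  move/eqP; rewrite evv dotZ mulf_eq0 (negPf e0) /= dotC => /eqP e'.
  by move: frame; rewrite e' eqxx.
move=> nkm kl; apply/negP => /eqP km.
have [lu _] := ext_u.
have neg_m : lexneg vm by rewrite evm; apply: lexneg_comb.
have lm : dot l vm = 0 by rewrite evm dotD !dotZ lp_ lq; ring.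
have ku : dot (L k) u != 0.
  apply/eqP => ku; have [t eu] := perp_cross (L_dist nkm) ku mu_.
  have [t' em] := perp_cross (L_dist nkm) km mm.
  have lX : dot l (X k m) != 0 by apply: contraNneq lu => lX; rewrite eu dotZ lX mulr0.
  move: lm; rewrite em dotZ => /eqP; rewrite mulf_eq0 (negPf lX) orbF => /eqP t'0.
  by apply: lexneg_neq0; rewrite -(vscl0 (X k m)) -t'0 -em.
have s0 : dot (L k) u / dot l u != 0 by rewrite mulf_neq0 // invr_eq0.
have kpq : al * dot (L k) vp + ga * dot (L k) vq = 0 by rewrite -!dotZ -dotD -evm.
have kp : dot (L k) vp != 0.
  apply/eqP => kp; have kq : dot (L k) vq = 0.
    by move/eqP: kpq; rewrite kp mulr0 add0r mulf_eq0 gt_eqF //= => /eqP.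
  have [|||t et] := @perp_cross vp vq (L k).
  - rewrite evv => /vscl_eq0[e'|l0]; first by rewrite e' eqxx in e0.
    by move: frame; rewrite l0 dotC dot0 eqxx.
  - by rewrite dotC.
  - by rewrite dotC.
  by apply: kl; rewrite et evv vsclA crossC crossZr crossvv !vscl_v0.
have kq : dot (L k) vq != 0.
  by apply: contraNneq kp => kq; move/eqP: kpq; rewrite kq mulr0 addr0 mulf_eq0 gt_eqF.
have nkp : k != p by apply: contraNneq kp => ->; rewrite pp.
have nkq : k != q by apply: contraNneq kq => ->; rewrite qq.
have hp := no_crossing_above nkp pu pp lp_ np.
have hq := no_crossing_above nkq qu qq lq nq.
set s := dot (L k) u / dot l u in s0 hp hq.
set y := dot (L k) vp in kpq kp hp; set y' := dot (L k) vq in kpq kq hq.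
have [h|h|h] := ltrgtP s 0; last by rewrite h eqxx in s0.
- have : 0 <= y by rewrite leNgt; apply/negP => h'; apply: hp; nra.
  have : 0 <= y' by rewrite leNgt; apply/negP => h'; apply: hq; nra.
  by rewrite !le_eqVlt ![0 == _]eq_sym (negPf kp) (negPf kq) /=; nra.
- have : y <= 0 by rewrite leNgt; apply/negP => h'; apply: hp; nra.
  have : y' <= 0 by rewrite leNgt; apply/negP => h'; apply: hq; nra.
  by rewrite !le_eqVlt (negPf kp) (negPf kq) /=; nra.
Qed.

End Chart.

(* Of three lines through an extreme crossing, the middle one meets the line at
   infinity [L i] in a point lying on no other line. *)
Lemma middle_line (i a b c : I) lam mu u :
  dot (L i) (cross lam mu) != 0 -> extreme (L i) lam mu u ->
  a != b -> b != c -> c != a ->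
  dot (L a) u = 0 -> dot (L b) u = 0 -> dot (L c) u = 0 ->
  exists m, [/\ m \in [:: a; b; c], dot lam (X m i) != 0 &
    forall k, k != m -> k != i -> dot (L k) (X m i) != 0].
Proof.
move=> frame ext nab nbc nca au bu cu; have [lu _] := ext; set l := L i in frame ext lu *.
have u0 : u <> v0 by move=> u0; rewrite u0 dot0 eqxx in lu.
have uu : dot u u != 0 by apply/eqP => /dot_self_eq0.
have ne_i x : dot (L x) u = 0 -> x != i.
  by move=> xu; apply: contraNneq lu => ei; rewrite /l -ei xu.
have coef x y : x != y -> dot (L x) u = 0 -> dot (L y) u = 0 ->
    dot u (X x y) != 0 /\ dot l (X x y) != 0.
  move=> nxy xu yu; have [t et] := perp_cross (L_dist nxy) xu yu.
  split; first by apply: contraNneq uu => e; rewrite {2}et dotZ e mulr0.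
  by apply: contraNneq lu => e; rewrite et dotZ e mulr0.
have [A0 lbc] := coef _ _ nbc bu cu; have [B0 lca] := coef _ _ nca cu au.
have [C0 lab] := coef _ _ nab au bu.
pose dd x := X x i.
(* Since the three lines are concurrent, their points at infinity on [L i] are linearly dependent.
   Once the directions are all made downward, the signs of this relation tell which line is the
   middle one. *)
have rel : vadd (vscl (dot u (X b c)) (dd a))
   (vadd (vscl (dot u (X c a)) (dd b)) (vscl (dot u (X a b)) (dd c))) = v0.
  have det0 : dot (L a) (X b c) = 0.
    have [t et] := perp_cross (L_dist nbc) bu cu.
    have t0 : t != 0 by apply/eqP => t0; apply: u0; rewrite et t0 vscl0.
    by move: au; rewrite et dotZ => /eqP; rewrite mulf_eq0 (negPf t0) => /eqP.
  have -> : vadd (vscl (dot u (X b c)) (dd a)) (vadd (vscl (dot u (X c a)) (dd b))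
     (vscl (dot u (X a b)) (dd c))) = vscl (dot (L a) (X b c)) (cross u l).
    by apply: vecP; rewrite /dd /vadd /vscl /dot /cross /l /=; ring.
  by rewrite det0 vscl0.
have ldd x : dot l (dd x) = 0 by rewrite /dd dot_crossr.
have xdd x : dot (L x) (dd x) = 0 by rewrite /dd dot_crossl.
have dd0 x : dot (L x) u = 0 -> dd x <> v0 by move=> xu; apply: L_dist; apply: ne_i.
have [sa [sa1 na]] := lexneg_sign frame (ldd a) (dd0 a au).
have [sb [sb1 nb]] := lexneg_sign frame (ldd b) (dd0 b bu).
have [sc [sc1 nc]] := lexneg_sign frame (ldd c) (dd0 c cu).
set va := vscl sa (dd a) in na; set vb := vscl sb (dd b) in nb; set vc := vscl sc (dd c) in nc.
have sg0 (s : R) : s * s = 1 -> s != 0.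
  by move=> e; apply: contraTneq isT => s0; move: e; rewrite s0 mulr0 => /eqP; rewrite eq_sym oner_eq0.
pose A := dot u (X b c) * sa; pose B := dot u (X c a) * sb; pose C := dot u (X a b) * sc.
have A0' : A != 0 by rewrite mulf_neq0 // sg0.
have B0' : B != 0 by rewrite mulf_neq0 // sg0.
have C0' : C != 0 by rewrite mulf_neq0 // sg0.
have rel' : vadd (vscl A va) (vadd (vscl B vb) (vscl C vc)) = v0.
  rewrite -rel /va /vb /vc !vsclA /A /B /C -!mulrA sa1 sb1 sc1 !mulr1 //.
have crs x y sx sy : vscl (sx * sy * dot l (X x y)) l = cross (vscl sx (dd x)) (vscl sy (dd y)).
  rewrite crossZr [cross (vscl _ _) _]crossC crossZr [cross (dd y) _]crossC /dd cross_common.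
  by rewrite !vsclA; congr vscl; ring.
have lv x s : dot l (vscl s (dd x)) = 0 by rewrite dotZ ldd mulr0.
have xv x s : dot (L x) (vscl s (dd x)) = 0 by rewrite dotZ xdd mulr0.
have core p q m sp sq sm al ga : dot (L p) u = 0 -> dot (L q) u = 0 -> dot (L m) u = 0 ->
    dot l (X p q) != 0 -> sp * sp = 1 -> sq * sq = 1 -> m \in [:: a; b; c] ->
    lexneg lam mu (vscl sp (dd p)) -> lexneg lam mu (vscl sq (dd q)) ->
    0 < al -> 0 < ga ->
    vscl sm (dd m) = vadd (vscl al (vscl sp (dd p))) (vscl ga (vscl sq (dd q))) ->
    exists m, [/\ m \in [:: a; b; c], dot lam (X m i) != 0 &
      forall k, k != m -> k != i -> dot (L k) (X m i) != 0].
  move=> pu qu mu_ lpq sp1 sq1 inm np nq al0 ga0 em; exists m.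
  have e0 : sp * sq * dot l (X p q) != 0.
    by apply: mulf_neq0 => //; apply: mulf_neq0; apply: sg0.
  have key k := @middle_core _ _ _ _ frame ext m p q _ _ _ al ga _ k pu qu mu_
    (xv p sp) (xv q sq) (xv m sm) (lv p sp) (lv q sq) np nq (esym (crs p q sp sq)) e0 al0 ga0 em.
  split=> // [|k nkm nki].
    have [+ _] := key i; rewrite dotZ; apply: contraNneq => ->; by rewrite mulr0.
  have [_ /(_ nkm (L_dist nki))] := key k; rewrite dotZ; apply: contraNneq => ->.
  by rewrite mulr0.
have solve (p q r : R) (x y z : vec) : r != 0 -> vadd (vscl p x) (vadd (vscl q y) (vscl r z)) = v0 ->
    z = vadd (vscl (- p / r) x) (vscl (- q / r) y).
  move=> r0 []; case: x y z => [[x1 x2] x3] [[y1 y2] y3] [[z1 z2] z3] /= e1 e2 e3.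
  have h (x y z : R) : p * x + (q * y + r * z) = 0 -> z = - p / r * x + - q / r * y.
    move=> e; have -> : z = (p * x + (q * y + r * z) - p * x - q * y) / r by field.
    by rewrite e; field.
  by apply: vecP => /=; apply: h.
have posr (p r : R) : p * r < 0 -> 0 < - p / r.
  move=> h; have r0 : r != 0 by apply: contraTneq h => ->; rewrite mulr0 ltxx.
  have -> : - p / r = - (p * r) / (r * r) by field.
  by rewrite divr_gt0 ?oppr_gt0 // -expr2 exprn_even_gt0.
have rot (x y z : vec) : vadd x (vadd y z) = vadd y (vadd z x).
  by vec_ring.
have := sign_pattern A0' B0' C0'.
case=> -[h1 h2].
- apply: (core a b c sa sb sc _ _ au bu cu lab sa1 sb1 _ na nb _ _ (solve _ _ _ _ _ _ C0' rel')).
  + by rewrite !inE eqxx !orbT.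
  + exact: posr.
  + exact: posr.
- rewrite rot rot in rel'.
  apply: (core c a b sc sa sb _ _ cu au bu lca sc1 sa1 _ nc na _ _ (solve _ _ _ _ _ _ B0' rel')).
  + by rewrite !inE eqxx !orbT.
  + exact: posr.
  + exact: posr.
- rewrite rot in rel'.
  apply: (core b c a sb sc sa _ _ bu cu au lbc sb1 sc1 _ nb nc _ _ (solve _ _ _ _ _ _ A0' rel')).
  + by rewrite !inE eqxx.
  + exact: posr.
  + exact: posr.
(* Equal signs would make the opposite of a downward direction a positive combination of downward
   directions. *)
- exfalso; rewrite rot in rel'; have e := solve _ _ _ _ _ _ A0' rel'.
  have pos (p r : R) : p * r > 0 -> 0 < p / r.
    move=> h; rewrite -[p]opprK; apply: posr; nra.
  have := lexneg_comb (pos _ _ h1) (pos _ _ h2) nb nc.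
  have -> : vadd (vscl (B / A) vb) (vscl (C / A) vc) = vscl (-1) va by rewrite e; vec_ring.
  exact: lexneg_asym.
Qed.

End Arrangement.
End Geometry.

Lemma leq_card_bigcup (T I : finType) (Q : pred I) (F : I -> {set T}) :
  (#|\bigcup_(i | Q i) F i| <= \sum_(i | Q i) #|F i|)%N.
Proof.
elim/big_rec2: _ => [|i m B _ IH]; first by rewrite cards0.
by apply: leq_trans (leq_card_setU _ _) _; rewrite leq_add2l.
Qed.

(** * The charging argument of Kelly and Moser *)

Section Charging.
Variable R : realFieldType.
Local Notation vec := (vec R).
Variables (I : finType) (L : I -> vec).
Hypothesis L_dist : forall i j, i != j -> cross (L i) (L j) <> v0 R.

Local Notation X := (fun i j => cross (L i) (L j)).

Definition thru (u : vec) : {set I} := [set k | dot (L k) u == 0].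

Lemma thru_scl t u : t != 0 -> thru (vscl t u) = thru u.
Proof. by move=> t0; apply/setP => k; rewrite !inE dotZ mulf_eq0 (negPf t0). Qed.

Lemma thru_X i j : i \in thru (X i j) /\ j \in thru (X i j).
Proof. by rewrite !inE dot_crossl dot_crossr eqxx. Qed.

Lemma thru_eq p q u : p != q -> u <> v0 R -> p \in thru u -> q \in thru u ->
  exists2 t, t != 0 & u = vscl t (X p q).
Proof.
move=> npq u0; rewrite !inE => /eqP pu /eqP qu.
have [t et] := perp_cross (L_dist npq) pu qu; exists t => //.
by apply/eqP => t0; apply: u0; rewrite et t0 vscl0.
Qed.

Lemma dot_neq0 (l u : vec) : dot l u != 0 -> u <> v0 R.
Proof. by move=> lu u0; rewrite u0 dot0 eqxx in lu. Qed.

Lemma extreme_scl (l lam mu u : vec) t : t != 0 -> extreme L l lam mu (vscl t u) ->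
  extreme L l lam mu u.
Proof.
move=> t0 [lu h]; have lu0 : dot l u != 0 by apply: contraNneq lu => e; rewrite dotZ e mulr0.
split=> // i j ne lX; have := h i j ne lX.
by rewrite !dotZ -!mulf_div divff // !mul1r.
Qed.

(** In a chart with [L i] at infinity, [E] is a vertex of the convex hull of the crossings off
    [L i]. A crossing is represented by the set of lines through it, so that there are finitely
    many. *)
Definition neighbour (i : I) (E : {set I}) :=
  exists lam mu p q, [/\ p != q, E = thru (X p q),
    dot (L i) (cross lam mu) != 0 & extreme L (L i) lam mu (X p q)].

Section FourNeighbours.
Variables (p q : I).
Hypothesis npq : p != q.
Let u := X p q.
Let N := [set i | `[< neighbour i (thru u) >]].

Lemma neighbour_extreme i : i \in N -> exists lam mu,
  dot (L i) (cross lam mu) != 0 /\ extreme L (L i) lam mu u.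
Proof.
rewrite inE => /asboolP[lam [mu [p' [q' [n' eE fr ext]]]]]; exists lam, mu; split=> //.
have [lX _] := ext; have [hp hq] := thru_X p q; rewrite -/u eE in hp hq.
have [t t0 et] := thru_eq npq (dot_neq0 lX) hp hq.
by apply: (extreme_scl t0); rewrite -et.
Qed.

(** For [x] through [u], the points [vadd (w x) (vscl t u)] run over the line [L x] without [u], and
    [tt x i] is the parameter of its crossing with [L i]. *)
Let w x := cross (L x) u.
Let tt x i := - (dot (L i) (w x) / dot (L i) u).

Lemma side_point_neq0 x t : x \in thru u -> vadd (w x) (vscl t u) <> v0 R.
Proof.
rewrite inE => /eqP xu e0.
have uu : dot u u != 0 by apply/eqP => /dot_self_eq0/(L_dist npq).
have : dot u (vadd (w x) (vscl t u)) = 0 by rewrite e0 dot0.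
rewrite dotD dotZ /w dot_crossr add0r => /eqP; rewrite mulf_eq0 (negPf uu) orbF => /eqP t0.
have : cross u (w x) = v0 R.
  have <- : vadd (w x) (vscl t u) = w x.
    by rewrite t0 vscl0; apply: vecP; rewrite /vadd /v0 /= addr0.
  by rewrite e0; vec_ring.
rewrite /w cross_crossr [dot u (L x)]dotC xu => h.
have : vscl (dot u u) (L x) = v0 R.
  by rewrite -h; vec_ring.
case/vscl_eq0 => [/eqP|Lx0]; first by rewrite (negPf uu).
have [y nxy] : exists y, x != y.
  by have [<-|] := eqVneq p x; [exists q|exists p; rewrite eq_sym].
by apply: (L_dist nxy); rewrite Lx0; vec_ring.
Qed.

(** With [L i] at infinity, the crossings of [L x] with [L j] and [L j'] would lie on opposite sides
    of [u], which is extreme. *)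
Lemma side_sign x i j j' : x \in thru u -> i \in N -> j \in N -> j' \in N ->
  ~ (tt x j < tt x i /\ tt x i < tt x j').
Proof.
move=> xu iN jN j'N [lt1 lt2].
have [lam [mu [frame ext]]] := neighbour_extreme iN; have [lu _] := ext.
have Lu k : k \in N -> dot (L k) u != 0.
  by move=> /neighbour_extreme[? [? [_ []]]].
have xu' : dot (L x) u = 0 by move: xu; rewrite inE => /eqP.
set e := vadd (w x) (vscl (tt x i) u).
have ie : dot (L i) e = 0 by rewrite /e dotD dotZ /tt mulNr mulfVK ?subrr ?lu.
have xw : dot (L x) (w x) = 0 by rewrite /w dot_crossl.
have e0 : e <> v0 R by exact: side_point_neq0.
have neg k : k \in N -> tt x k - tt x i != 0 ->
    lexneg lam mu (vscl (((tt x k - tt x i) * dot (L i) u)^-1) e).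
  move=> kN tau0; set tau := tt x k - tt x i in tau0 *.
  have nxk : x != k by apply: contraTneq (Lu k kN) => <-; rewrite xu' eqxx.
  set y := vadd (w x) (vscl (tt x k) u).
  have ey : y = vadd e (vscl tau u).
    by rewrite /y /e /tau; vec_ring.
  have xy : dot (L x) y = 0 by rewrite /y dotD dotZ xw xu'; ring.
  have ky : dot (L k) y = 0 by rewrite /y dotD dotZ /tt mulNr mulfVK ?subrr ?Lu.
  have iy : dot (L i) y = tau * dot (L i) u by rewrite ey dotD dotZ ie add0r.
  have iy0 : dot (L i) y != 0 by rewrite iy mulf_neq0.
  have := extreme_on L_dist ext nxk xy ky iy0; rewrite iy ey !(dotD _ e) !(dotZ _ tau).
  have red c : (c + tau * dot lam u) / (tau * dot (L i) u) =
      c / (tau * dot (L i) u) + dot lam u / dot (L i) u by field; rewrite lu tau0.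
  have red' c : (c + tau * dot mu u) / (tau * dot (L i) u) =
      c / (tau * dot (L i) u) + dot mu u / dot (L i) u by field; rewrite lu tau0.
  rewrite red red' /lexneg !dotZ ![_^-1 * _]mulrC; set a := _ / (tau * _); set b := _ / (tau * _).
  have c0 : (tau * dot (L i) u)^-1 != 0 by rewrite invr_eq0 mulf_neq0.
  case=> [h|[h1 h2]]; first by left; lra.
  have a0 : a = 0 by lra.
  right; split=> //; rewrite lt_neqAle; apply/andP; split; last by lra.
  apply/eqP => b0; apply: e0; apply: (frame_eq0 frame) => //; apply: (mulIf c0);
    by rewrite mul0r.
have n1 := neg j jN _; have n2 := neg j' j'N _.
have {}n1 := n1 (ltr0_neq0 _); rewrite subr_lt0 in n1; have {}n1 := n1 lt1.
have {}n2 := n2 (lt0r_neq0 _); rewrite subr_gt0 in n2; have {}n2 := n2 lt2.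
move: n1 n2; rewrite /lexneg !dotZ !invfM -!mulrA.
set c := (dot (L i) u)^-1; set a1 := (tt x j - tt x i)^-1; set a2 := (tt x j' - tt x i)^-1.
have a1n : a1 < 0 by rewrite invr_lt0 subr_lt0.
have a2p : 0 < a2 by rewrite invr_gt0 subr_gt0.
have a10 := ltr0_neq0 a1n; have a20 := lt0r_neq0 a2p.
set lm := dot lam e; set m := dot mu e => h1 h2.
have s1 : 0 < c * lm \/ (c * lm = 0 /\ 0 < c * m).
  case: h1 => [h|[h h']]; [left|right; split].
  - by rewrite nmulr_rlt0 in h.
  - by apply: (mulfI a10); rewrite mulr0.
  - by rewrite nmulr_rlt0 in h'.
have s2 : c * lm < 0 \/ (c * lm = 0 /\ c * m < 0).
  case: h2 => [h|[h h']]; [left|right; split].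
  - by rewrite pmulr_rlt0 in h.
  - by apply: (mulfI a20); rewrite mulr0.
  - by rewrite pmulr_rlt0 in h'.
by case: s1 => [h|[h h']]; case: s2 => [k|[k k']]; lra.
Qed.

Lemma side_eq x i j : x \in thru u -> i \in N -> j \in N ->
  [exists k in N, tt x i < tt x k] = [exists k in N, tt x j < tt x k] -> tt x i = tt x j.
Proof.
move=> xu iN jN ef; apply/eqP; rewrite eq_le; apply/andP; split; rewrite leNgt; apply/negP => lt.
  have : [exists k in N, tt x j < tt x k] by apply/existsP; exists i; rewrite iN.
  rewrite -ef => /existsP[k /andP[kN ltk]].
  by apply: (@side_sign x i j k).
have : [exists k in N, tt x i < tt x k] by apply/existsP; exists j; rewrite jN.
rewrite ef => /existsP[k /andP[kN ltk]].
by apply: (@side_sign x j i k).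
Qed.

(** By [side_sign] the neighbours meet each of the lines [p] and [q] in at most two points, and a
    line missing [u] is determined by where it meets [p] and [q]. *)
Lemma card_neighbours : (#|N| <= 4)%N.
Proof.
pose f i := ([exists k in N, tt p i < tt p k], [exists k in N, tt q i < tt q k]).
have inj : {in N &, injective f}.
  move=> i j iN jN [fp fq]; apply/eqP; apply: contraT => nij.
  have [pu qu] := thru_X p q; rewrite -/u in pu qu.
  have ep := side_eq pu iN jN fp; have eq_ := side_eq qu iN jN fq.
  have Lu k : k \in N -> dot (L k) u != 0.
    by move=> /neighbour_extreme[? [? [_ []]]].
  have on x k : k \in N -> dot (L k) (vadd (w x) (vscl (tt x k) u)) = 0.
    by move=> kN; rewrite dotD dotZ /tt mulNr mulfVK ?subrr ?Lu.
  have side0 x : x \in thru u -> tt x i = tt x j -> dot (L x) (X i j) = 0.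
    move=> xu e; have onj := on x j jN; rewrite -e in onj.
    have [t et] := perp_cross (L_dist nij) (on x i iN) onj.
    have t0 : t != 0.
      by apply/eqP => t0; apply: (@side_point_neq0 x (tt x i) xu); rewrite et t0 vscl0.
    have : dot (L x) (vadd (w x) (vscl (tt x i) u)) = 0.
      by move: xu; rewrite inE dotD dotZ /w dot_crossl => /eqP ->; rewrite mulr0 addr0.
    by rewrite et dotZ => /eqP; rewrite mulf_eq0 (negPf t0) => /eqP.
  have [r er] := perp_cross (L_dist npq) (side0 p pu ep) (side0 q qu eq_).
  have : dot (L i) (X i j) = 0 by rewrite dot_crossl.
  rewrite er dotZ => /eqP; rewrite mulf_eq0 (negPf (Lu i iN)) orbF => /eqP r0.
  by case: (L_dist nij); rewrite er r0 vscl0.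
rewrite -(card_in_imset inj); apply: leq_trans (max_card _) _.
by rewrite card_prod card_bool.
Qed.

End FourNeighbours.

Lemma frame_cross (l lam : vec) : cross l lam <> v0 R -> dot l (cross lam (cross l lam)) != 0.
Proof.
move=> h; have -> : dot l (cross lam (cross l lam)) = dot (cross l lam) (cross l lam).
  by dot_ring.
by apply/eqP => /dot_self_eq0.
Qed.

Lemma thru_pair m i : (forall k, k != m -> k != i -> dot (L k) (X m i) != 0) ->
  [set m; i] = thru (X m i).
Proof.
move=> only; apply/setP => k; rewrite !inE; apply/idP/idP.
  by case/orP => /eqP ->; rewrite ?dot_crossl ?dot_crossr eqxx.
by move=> k0; apply: contraLR k0; rewrite negb_or => /andP[nkm nki]; apply: only.
Qed.

Lemma scale_positive (l v w : vec) : dot l w != 0 -> dot v w != 0 ->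
  exists s, s != 0 /\ 0 < dot (vscl s v) w / dot l w.
Proof.
move=> lw vw; have [h|h|h] := ltrgtP (dot v w / dot l w) 0.
- by exists (-1); rewrite oppr_eq0 oner_eq0 dotC dotZ dotC mulN1r mulNr; split=> //; lra.
- by exists 1; rewrite oner_eq0 vscl1.
- by move/eqP: h; rewrite mulf_eq0 invr_eq0 (negPf vw) (negPf lw).
Qed.

Lemma X_self_prop (a b c : vec) l : dot l (cross a b) = 0 -> dot l (cross b c) = 0 ->
  dot a (cross b c) != 0 -> cross l b = v0 R.
Proof.
move=> h1 h2 d0; have e : cross (cross a b) (cross b c) = vscl (dot a (cross b c)) b.
  by vec_ring.
have [||| t et] := @perp_cross R (cross a b) (cross b c) l.
- rewrite e => /vscl_eq0[e0|b0]; first by rewrite e0 eqxx in d0.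
  have z : dot a (cross (v0 R) c) = 0 by dot_ring.
  by move: d0; rewrite b0 z eqxx.
- by rewrite dotC.
- by rewrite dotC.
by rewrite et e crossC !crossZr crossvv !vscl_v0.
Qed.

Section OrdinaryOffLine.
Variable v : vec.
Hypothesis v_dist : forall i, cross (L i) v <> v0 R.
Hypothesis not_conc : forall u, u <> v0 R -> exists i, dot (L i) u != 0.

(** The auxiliary line [v] lets unwanted crossings be avoided: for a net it is evaluation at a point
    [z] through which the chosen curve must not pass. *)
Definition ordinary : {set {set I}} :=
  [set E | [exists p, exists q, [&& p != q, E == [set p; q], E == thru (X p q) &
    dot v (X p q) != 0]]].

Lemma ordinaryP E : reflect (exists p q, [/\ p != q, E = [set p; q], E = thru (X p q) &
    dot v (X p q) != 0]) (E \in ordinary).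
Proof.
rewrite inE; apply: (iffP existsP) => [[p /existsP[q /and4P[a /eqP b /eqP c e]]]|[p [q [a b c e]]]].
  by exists p, q.
by exists p; apply/existsP; exists q; rewrite a -b -c !eqxx.
Qed.

(** Some three lines other than [i] form a triangle. A line different from its sides contains at
    most one vertex, so [L i] and [v] together miss a vertex. *)
Lemma crossing_off_two i : (forall u, u <> v0 R -> exists2 k, k != i & dot (L k) u != 0) ->
  (2 < #|I|)%N -> exists a b, [/\ a != b, dot (L i) (X a b) != 0 & dot v (X a b) != 0].
Proof.
move=> nc; rewrite cardE => gt2.
have [a [b [ai bi nab]]] : exists a b, [/\ a != i, b != i & a != b].
  have : (1 < #|[set~ i]|)%N by rewrite cardsC1 cardE; lia.
  by move=> /card_gt1P[a [b [ha hb nab]]]; exists a, b; rewrite !inE in ha hb.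
have [c ci cab] := nc _ (L_dist nab).
have nac : a != c by apply: contraNneq cab => <-; rewrite dot_crossl.
have nbc : b != c by apply: contraNneq cab => <-; rewrite dot_crossr.
have d1 : dot (L a) (X b c) != 0 by rewrite dot_rot dot_rot.
have d2 : dot (L b) (X c a) != 0 by rewrite dot_rot.
have d3 : dot (L c) (X a b) != 0 by [].
have two (m : vec) : (forall k, k != i -> cross m (L k) <> v0 R) ->
  [\/ dot m (X a b) != 0 /\ dot m (X b c) != 0,
     dot m (X b c) != 0 /\ dot m (X c a) != 0 |
     dot m (X c a) != 0 /\ dot m (X a b) != 0].
  move=> hm; have [h1|h1] := eqVneq (dot m (X a b)) 0.
    constructor 2; split; apply/eqP => h2.
      exact: hm b bi (X_self_prop h1 h2 d1).
    exact: hm a ai (X_self_prop h2 h1 d3).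
  have [h2|h2] := eqVneq (dot m (X b c)) 0; last by constructor 1.
  constructor 3; split=> //; apply/eqP => h3.
  exact: hm c ci (X_self_prop h2 h3 d2).
have v_dist' k : k != i -> cross v (L k) <> v0 R.
  move=> _; rewrite crossC => /vscl_eq0[/eqP|]; last exact: v_dist.
  by rewrite oppr_eq0 oner_eq0.
have i_dist k : k != i -> cross (L i) (L k) <> v0 R.
  by rewrite eq_sym; apply: L_dist.
have nca : c != a by rewrite eq_sym.
case: (two _ i_dist) => -[h1 h2]; case: (two _ v_dist') => -[h3 h4];
  first [by exists a, b; split | by exists b, c; split | by exists c, a; split].
Qed.

(** The first coordinate of the chart is [v], scaled to be positive at some crossing. It is then
    positive at the extreme crossing, and nonzero where the middle line meets [L i]; both candidates
    for the ordinary crossing are thus off [v]. *)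
Lemma ordinary_or_neighbour i :
  (forall u, u <> v0 R -> exists2 k, k != i & dot (L k) u != 0) -> (2 < #|I|)%N ->
  exists2 E, E \in ordinary & i \in E \/ neighbour i E.
Proof.
move=> nc gt2; have [a [b [nab lX vX]]] := crossing_off_two nc gt2.
have [s [s0 pos]] := scale_positive lX vX.
set lam := vscl s v in pos.
have lamE u : dot lam u = s * dot v u by rewrite /lam dotC dotZ dotC.
have cr : cross (L i) lam <> v0 R.
  rewrite crossZr => /vscl_eq0[e|]; last exact: v_dist.
  by rewrite e eqxx in s0.
have fr := frame_cross cr.
have [p [q [npq ext]]] := extreme_exists lam (cross (L i) lam) (ex_intro _ a (ex_intro _ b (conj nab lX))).
have vu : dot v (X p q) != 0.
  have [_ /(_ a b nab lX)] := ext; apply: contraPneq => e.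
  by rewrite !lamE e mulr0 mul0r -lamE; case=> [|[]]; lra.
have [pu qu] := thru_X p q.
have [[c [cu ncp ncq]]|no3] := pselect (exists c, [/\ c \in thru (X p q), c != p & c != q]).
  rewrite !inE in pu qu cu; rewrite eq_sym in ncq.
  have [m [_ lm only]] := middle_line L_dist fr ext npq ncq ncp (eqP pu) (eqP qu) (eqP cu).
  have nmi : m != i by apply: contraNneq lm => ->; rewrite crossvv dot0.
  exists [set m; i]; last by left; rewrite !inE eqxx orbT.
  apply/ordinaryP; exists m, i; split=> //; first exact: thru_pair.
  by apply: contraNneq lm => e; rewrite lamE e mulr0.
have eE : [set p; q] = thru (X p q).
  apply: thru_pair => k nkp nkq; apply/negP => ku; apply: no3; exists k; split=> //.
  by rewrite inE.
exists [set p; q]; last by right; exists lam, (cross (L i) lam), p, q.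
by apply/ordinaryP; exists p, q.
Qed.

(** The near-pencil, where charging breaks down: all crossings with [L i] are ordinary, and at most
    one of them lies on [v]. *)
Lemma few_ordinary_concurrent i u : u <> v0 R -> (forall k, k != i -> dot (L k) u = 0) ->
  (#|I| <= #|ordinary| + 2)%N.
Proof.
move=> u0 conc; have iu : dot (L i) u != 0.
  have [k ku] := not_conc u0; have [<- //|nki] := eqVneq k i.
  by rewrite conc ?eqxx in ku.
have Xu k k' : k != i -> k' != i -> dot (L k') (X k i) = 0 -> k' = k.
  move=> ki k'i h; apply/eqP; apply: contraT => nk.
  have [t et] := perp_cross (L_dist nk) (conc k' k'i) (conc k ki).
  have [t' et'] := perp_cross (L_dist nk) h (dot_crossl _ _).
  have t'0 : t' != 0 by apply/eqP => t'0; apply: (L_dist ki); rewrite et' t'0 vscl0.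
  have : dot (L i) (X k i) = 0 by rewrite dot_crossr.
  rewrite et' dotZ => /eqP; rewrite mulf_eq0 (negPf t'0) /= => /eqP e.
  by move: iu; rewrite et dotZ e mulr0 eqxx.
have vXu k k' : k != i -> k' != i -> dot v (X k i) = 0 -> dot v (X k' i) = 0 -> k' = k.
  move=> ki k'i h h'; have vi : cross v (L i) <> v0 R.
    by rewrite crossC => /vscl_eq0[/eqP|]; [rewrite oppr_eq0 oner_eq0|apply: v_dist].
  have [t et] := perp_cross vi h (dot_crossr _ _).
  have [t' et'] := perp_cross vi h' (dot_crossr _ _).
  have t'0 : t' != 0 by apply/eqP => t'0; apply: (L_dist k'i); rewrite et' t'0 vscl0.
  apply: (Xu _ _ ki k'i); rewrite et; have : dot (L k') (X k' i) = 0 by rewrite dot_crossl.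
  by rewrite et' !dotZ => /eqP; rewrite mulf_eq0 (negPf t'0) /= => /eqP ->; rewrite mulr0.
pose K := [set k | (k != i) && (dot v (X k i) != 0)].
pose K2 := [set k | (k != i) && (dot v (X k i) == 0)].
have le1 : (#|K2| <= 1)%N.
  apply/card_le1P => k; rewrite inE => /andP[ki /eqP kv] k'; rewrite !inE.
  apply/idP/eqP => [/andP[k'i /eqP k'v]|->]; first exact: vXu kv k'v.
  by rewrite ki kv eqxx.
have leK : (#|K| <= #|ordinary|)%N.
  have inj : {in K &, injective (fun k => [set k; i])}.
    move=> k k'; rewrite !inE => /andP[ki _] /andP[k'i _] /setP/(_ k).
    by rewrite !inE eqxx /= (negPf ki) orbF => /esym/eqP ->.
  rewrite -(card_in_imset inj); apply: subset_leq_card; apply/subsetP => E.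
  case/imsetP => k; rewrite inE => /andP[ki kv] ->; apply/ordinaryP; exists k, i; split=> //.
  apply: thru_pair => k' k'k k'i; apply/eqP => k'0.
  by rewrite (Xu _ _ ki k'i k'0) eqxx in k'k.
have : [set: I] \subset K :|: K2 :|: [set i].
  apply/subsetP => k _; rewrite !inE; have [->|ki] := eqVneq k i; first by rewrite !orbT.
  by case: eqP.
move/subset_leq_card; rewrite cardsT => /leq_trans; apply.
apply: leq_trans (leq_card_setU _ _) _; rewrite cards1.
rewrite addn2 addn1 ltnS; apply: leq_trans (leq_card_setU _ _) _.
by rewrite -addn1 leq_add.
Qed.

(** An ordinary crossing is charged by the two lines through it and by at most four neighbours. *)
Theorem many_ordinary : (#|I| <= 6 * #|ordinary| + 2)%N.
Proof.
have [small|gt2] := leqP #|I| 2; first lia.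
have [[i [u [u0 conc]]]|nconc] :=
    pselect (exists i u, u <> v0 R /\ forall k, k != i -> dot (L k) u = 0).
  by have := few_ordinary_concurrent u0 conc; lia.
have cover : [set: I] \subset \bigcup_(E in ordinary) (E :|: [set i | `[< neighbour i E >]]).
  apply/subsetP => i _; have [|E oE h] := @ordinary_or_neighbour i _ gt2.
    move=> u u0; apply: contrapT => h; apply: nconc; exists i, u; split=> // k ki.
    by apply/eqP; apply: contraT => ku; case: h; exists k.
  apply/bigcupP; exists E => //; rewrite !inE; apply/orP.
  by case: h => [|/asboolP]; [left|right].
move/subset_leq_card: cover; rewrite cardsT => /leq_trans; apply.
apply: leq_trans (leq_card_bigcup _ _) _.
apply: (@leq_trans (\sum_(E in ordinary) 6)); last by rewrite sum_nat_const; lia.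
apply: leq_sum => E /ordinaryP[p [q [npq eE eT _]]].
apply: leq_trans (leq_card_setU _ _) _.
have := card_neighbours npq; rewrite -eT {2}eE cards2 npq; lia.
Qed.

End OrdinaryOffLine.
End Charging.

(** * Crossings of at most three lines *)

Section GoodVertices.
Variable R : realFieldType.
Local Notation vec := (vec R).
Variables (I : finType) (L : I -> vec).
Hypothesis L_dist : forall i j, i != j -> cross (L i) (L j) <> v0 R.
Hypothesis I_gt1 : (1 < #|I|)%N.
Hypothesis not_collinear : forall i m, cross (L i) m <> v0 R ->
  exists p q, [/\ p != q, dot (L i) (cross (L p) (L q)) != 0 & dot m (cross (L p) (L q)) != 0].

Local Notation X := (fun i j => cross (L i) (L j)).

(** By duality these will be the lines that join points of A and carry at most three of them. *)
Definition good : {set {set I}} :=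
  [set E : {set I} | [exists p, exists q, (p != q) && (E == thru L (X p q))] && (#|E| <= 3)%N].

Definition good_at i : {set {set I}} := [set E in good | i \in E].

Lemma goodP E : reflect ((exists p q, p != q /\ E = thru L (X p q)) /\ (#|E| <= 3)%N) (E \in good).
Proof.
rewrite inE; apply: (iffP andP) => -[h le3]; split=> //.
  by case/existsP: h => p /existsP[q /andP[n /eqP e]]; exists p, q.
by case: h => p [q [n e]]; apply/existsP; exists p; apply/existsP; exists q; rewrite n e eqxx.
Qed.

(** Four lines through an extreme crossing would give two middle lines: one for all of them, another
    after removing the first. Each meets [L i] in an ordinary crossing, so [i] would have two good
    ones. *)
Lemma extreme_good i lam mu p q : (#|good_at i| <= 1)%N -> p != q ->
  dot (L i) (cross lam mu) != 0 -> extreme L (L i) lam mu (X p q) ->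
  thru L (X p q) \in good.
Proof.
move=> g1 npq fr ext; apply/goodP; split; first by exists p, q.
rewrite leqNgt; apply/negP => gt3; set E := thru L (X p q) in gt3.
have mid (F : {set I}) : F \subset E -> (2 < #|F|)%N -> exists2 m, m \in F &
    m != i /\ [set m; i] \in good_at i.
  move=> /subsetP sFE /card_gt2P[a [b [c [[aF bF cF] [nab nbc nca]]]]].
  have h x : x \in F -> dot (L x) (X p q) = 0 by move/sFE; rewrite inE => /eqP.
  have [m [inm lm only]] := middle_line L_dist fr ext nab nbc nca (h a aF) (h b bF) (h c cF).
  have nmi : m != i by apply: contraNneq lm => ->; rewrite crossvv dot0.
  exists m; first by move: inm; rewrite !inE => /or3P[] /eqP ->.
  split=> //; rewrite inE set22 andbT; apply/goodP; rewrite cards2 nmi; split=> //.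
  by exists m, i; split=> //; apply: thru_pair.
have [|m1 m1E [m1i g1i]] := mid E (subxx _); first lia.
have [|m2 m2E [m2i g2i]] := mid (E :\ m1) (subsetDl _ _).
  by rewrite (cardsD1 m1) m1E in gt3; lia.
have : [set m1; i] = [set m2; i] by apply: (card_le1_eqP g1).
move/setP/(_ m1); rewrite !inE eqxx (negPf m1i) !orbF => /esym/eqP e.
by move: m2E; rewrite e !inE eqxx.
Qed.

(** The crossings off [L i] do not lie on one line, so their convex hull has three vertices: the two
    extremes of one lexicographic order, and an extreme in the direction across the line [m] joining
    these. *)
Lemma three_neighbours i : (#|good_at i| <= 1)%N ->
  (3 <= #|[set E in good | `[< neighbour L i E >]]|)%N.
Proof.
move=> g1; set l := L i.
have ext_nb lam mu p q : p != q -> dot l (cross lam mu) != 0 ->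
    extreme L l lam mu (X p q) -> thru L (X p q) \in [set E in good | `[< neighbour L i E >]].
  move=> npq fr ext; rewrite inE (extreme_good g1 npq fr ext) /=.
  by apply/asboolP; exists lam, mu, p, q.
have [j nij] : exists j, i != j.
  have : (0 < #|[set~ i]|)%N by rewrite cardsC1; lia.
  by case/card_gt0P => j; rewrite !inE eq_sym; exists j.
have cij : cross l (L j) <> v0 R by apply: L_dist.
set lam := L j in cij; set mu := cross l lam.
have fr : dot l (cross lam mu) != 0 by apply: frame_cross.
have fr' : dot l (cross (vscl (-1) lam) (vscl (-1) mu)) != 0.
  suff -> : dot l (cross (vscl (-1) lam) (vscl (-1) mu)) = dot l (cross lam mu) by [].
  by dot_ring.
have exX : exists a b, a != b /\ dot l (X a b) != 0.
  by have [p [q [npq lX _]]] := not_collinear cij; exists p, q.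
have [p1 [q1 [n1 ext1]]] := extreme_exists lam mu exX.
have [p2 [q2 [n2 ext2]]] := extreme_exists (vscl (-1) lam) (vscl (-1) mu) exX.
set u1 := X p1 q1 in ext1; set u2 := X p2 q2 in ext2.
have [lu1 _] := ext1; have [lu2 _] := ext2.
(* If the two extremes coincided, all crossings off [L i] would be this single point of [L p1]. *)
have nprop : forall t, u2 <> vscl t u1.
  move=> t et; have t0 : t != 0 by apply: contraNneq lu2 => t0; rewrite et t0 vscl0 dot0.
  rewrite et in ext2; have {ext2} [_ ext2] := extreme_scl t0 ext2; have [_ ext1'] := ext1.
  have [|a [b [nab lX pX]]] := @not_collinear i (L p1).
    by apply: L_dist; apply: contraNneq lu1 => e; rewrite /u1 /l e dot_crossl.
  have := ext1' a b nab lX; have := ext2 a b nab lX.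
  have neg (m w : vec) : dot (vscl (-1) m) w = - dot m w by rewrite dotC dotZ dotC mulN1r.
  rewrite !neg !mulNr; set xa := dot lam _ / _; set ya := dot mu _ / _.
  set xu := dot lam u1 / _; set yu := dot mu u1 / _ => h h'.
  have [ex ey] : xa = xu /\ ya = yu by case: h h' => [h|[h k]] [h'|[h' k']]; split; lra.
  pose e := vadd (vscl (dot l (X a b))^-1 (X a b)) (vscl (- (dot l u1)^-1) u1).
  have e0 : e = v0 R.
    apply: (frame_eq0 fr); rewrite /e dotD !dotZ mulNr.
    - by rewrite !mulVf // subrr.
    - by rewrite ![_^-1 * _]mulrC -/xa -/xu ex subrr.
    - by rewrite ![_^-1 * _]mulrC -/ya -/yu ey subrr.
  have : dot (L p1) e = 0 by rewrite e0 dot0.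
  rewrite /e dotD !dotZ /u1 dot_crossl mulr0 addr0 => /eqP.
  by rewrite mulf_eq0 invr_eq0 (negPf lX) (negPf pX).
set m := cross u1 u2.
have m0 : m <> v0 R.
  move=> m0; have : cross u1 m = v0 R by rewrite m0; vec_ring.
  have uu : dot u1 u1 != 0 by apply/eqP => /dot_self_eq0/(L_dist n1).
  rewrite cross_crossr => e; apply: (nprop (dot u1 u2 / dot u1 u1)).
  have e' : vscl (dot u1 u1) u2 = vscl (dot u1 u2) u1.
    move: e; rewrite /vadd /vscl /v0 /= => -[]; rewrite !mulNr.
    by move=> /eqP + /eqP + /eqP; rewrite !subr_eq0 => /eqP -> /eqP -> /eqP ->.
  by rewrite mulrC -vsclA -e' vsclA mulVf // vscl1.
have cm : cross l m <> v0 R.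
  move=> cm; have : cross u1 (cross l m) = v0 R by rewrite cm; vec_ring.
  rewrite cross_crossr /m dot_crossl vscl0 -/m => e.
  have : vscl (- dot u1 l) m = v0 R by rewrite -e; vec_ring.
  by case/vscl_eq0 => // /eqP; rewrite oppr_eq0 dotC (negPf lu1).
have [a [b [nab lX mX]]] := not_collinear cm.
have [s [s0 pos]] := scale_positive lX mX.
have mE u : dot (vscl s m) u = s * dot m u by rewrite dotC dotZ dotC.
have cr : cross l (vscl s m) <> v0 R.
  by rewrite crossZr => /vscl_eq0[e|//]; rewrite e eqxx in s0.
have fr3 := frame_cross cr.
have [p3 [q3 [n3 ext3]]] := extreme_exists (vscl s m) (cross l (vscl s m)) exX.
have mu3 : dot m (X p3 q3) != 0.
  have [_ /(_ a b nab lX)] := ext3; apply: contraPneq => e.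
  by rewrite !mE e mulr0 mul0r -mE; case=> [|[]]; lra.
have E1 := ext_nb _ _ _ _ n1 fr ext1; have E2 := ext_nb _ _ _ _ n2 fr' ext2.
have E3 := ext_nb _ _ _ _ n3 fr3 ext3.
have sep p q p' q' : p != q -> p' != q' -> thru L (X p q) = thru L (X p' q') ->
    exists t, X p' q' = vscl t (X p q).
  move=> n n' e; have [hp hq] := thru_X L p q; rewrite e in hp hq.
  by have [t _ et] := thru_eq L_dist n (L_dist n') hp hq; exists t.
apply/card_gt2P; exists (thru L u1), (thru L u2), (thru L (X p3 q3)); split=> //; split.
- by apply/eqP => e; have [t /nprop] := sep _ _ _ _ n1 n2 e.
- apply/eqP => e; have [t et] := sep _ _ _ _ n2 n3 e.
  by move: mu3; rewrite et dotZ /m dotC dot_crossr mulr0 eqxx.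
- apply/eqP => /esym e; have [t et] := sep _ _ _ _ n1 n3 e.
  by move: mu3; rewrite et dotZ /m dotC dot_crossl mulr0 eqxx.
Qed.

(** Lines with at most one good crossing have three good neighbours each, and a crossing is
    neighbour to at most four lines, so 3 |N1| <= 4 |good|. As good crossings lie on two lines at
    least, the sum Y satisfies 2 |good| <= Y + |N1|, hence |N1| <= 2 Y; add 2 (|I| - |N1|) <= Y. *)
Theorem many_good_pairs : (2 * #|I| <= 5 * \sum_(i | (1 < #|good_at i|)%N) #|good_at i|)%N.
Proof.
pose N1 := [set i | (#|good_at i| <= 1)%N].
have h1 : (#|N1| * 3 <= 4 * #|good|)%N.
  rewrite -sum_nat_const.
  pose nbs i := [set E in good | `[< neighbour L i E >]].
  apply: (@leq_trans (\sum_(i in N1) \sum_(E in nbs i) 1)%N).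
    by apply: leq_sum => i; rewrite inE => /three_neighbours h; rewrite sum1_card.
  rewrite (exchange_big_dep (mem good)) /=; last by move=> i E _; rewrite inE => /andP[].
  rewrite mulnC -sum_nat_const; apply: leq_sum => E Eg.
  have /goodP[[p [q [npq eE]]] _] := Eg.
  rewrite sum1_card; apply: leq_trans (card_neighbours L_dist npq).
  apply: subset_leq_card; apply/subsetP => i /andP[_ /setIdP[_ nb]].
  by rewrite inE -eE.
have h2 : (2 * #|good| <= \sum_i #|good_at i|)%N.
  rewrite mulnC -sum_nat_const.
  apply: (@leq_trans (\sum_(E in good) \sum_(i in E) 1)%N).
    apply: leq_sum => E /goodP[[p [q [npq ->]]] _]; rewrite sum1_card.
    have [hp hq] := thru_X L p q.
    have sub : [set p; q] \subset thru L (X p q).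
      by apply/subsetP => k; rewrite in_set2 => /orP[] /eqP ->.
    by have := subset_leq_card sub; rewrite cards2 npq.
  rewrite (exchange_big_dep predT) //=; apply: leq_sum => i _.
  by rewrite sum1_card; apply: subset_leq_card; apply/subsetP => E EP; apply/setIdP; apply/andP.
rewrite (bigID (fun i => 1 < #|good_at i|)%N) /= in h2.
set Y := \sum_(i | (1 < _)%N) _ in h2 *.
have h3 : (\sum_(i | ~~ (1 < #|good_at i|)) #|good_at i| <= #|N1|)%N.
  rewrite -sum1_card [leqRHS](eq_bigl (fun i => ~~ (1 < #|good_at i|)%N)).
    by apply: leq_sum => i; rewrite -leqNgt.
  by move=> i; rewrite inE leqNgt.
have h4 : (2 * (#|I| - #|N1|) <= Y)%N.
  have -> : (#|I| - #|N1| = #|[pred i | 1 < #|good_at i|]|)%N.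
    rewrite -(cardC N1) addKn; apply: eq_card => i; rewrite !inE.
    by rewrite ltnNge.
  rewrite mulnC -sum_nat_const; apply: leq_sum => i //.
have h5 : (#|N1| <= #|I|)%N by apply: max_card.
have h6 := leq_trans h2 (leq_add (leqnn _) h3).
move: h1 h4 h5 h6; clear; move: #|N1| #|good| #|I| Y => a b c y; lia.
Qed.

End GoodVertices.

(** * Counting generic tuples *)

Lemma leq_card_bigcup_const (T I : finType) (F : I -> {set T}) z :
  (forall i, #|F i| <= z)%N -> (#|\bigcup_i F i| <= #|I| * z)%N.
Proof.
move=> h; apply: leq_trans (leq_card_bigcup _ _) _.
by rewrite -sum_nat_const; apply: leq_sum.
Qed.

Lemma count_extensions (n K w : nat) (Q : seq 'I_n -> Prop) :
  Q [::] ->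
  (forall t, (size t < K)%N -> Q t -> (w <= #|[set i | `[< Q (i :: t) >]]|)%N) ->
  (w ^ K <= #|[set t : K.-tuple 'I_n | `[< Q t >]]|)%N.
Proof.
move=> Q0; elim: K => [|K IH] Qext.
  rewrite expn0 card_gt0; apply/set0Pn; exists [tuple].
  by rewrite inE; apply/asboolP.
have /IH le_w : forall t, (size t < K)%N -> Q t ->
    (w <= #|[set i | `[< Q (i :: t) >]]|)%N.
  by move=> t lt_t; apply: Qext; apply: ltnW.
rewrite expnSr; set SK := [set t : K.-tuple 'I_n | `[< Q t >]] in le_w.
pose X := [set p : K.-tuple 'I_n * 'I_n | (p.1 \in SK) && `[< Q (p.2 :: p.1) >]].
apply: (@leq_trans #|X|).
  rewrite -sum1_card (eq_bigl (fun p : K.-tuple 'I_n * 'I_n => (p.1 \in SK) &&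
    `[< Q (p.2 :: p.1) >])); last by move=> p; rewrite inE.
  rewrite -(pair_big_dep (mem SK) (fun t i => `[< Q (i :: tval t) >]) (fun _ _ => 1%N)) /=.
  apply: (@leq_trans (\sum_(t in SK) w)); first by rewrite sum_nat_const leq_mul2r le_w orbT.
  apply: leq_sum => t; rewrite inE => /asboolP Qt.
  rewrite sum1_card; apply: leq_trans (Qext t _ Qt) _; first by rewrite size_tuple.
  by apply: subset_leq_card; apply/subsetP => i; rewrite inE.
have inj : injective (fun p : K.-tuple 'I_n * 'I_n => [tuple of p.2 :: p.1]).
  by move=> [t i] [t' i'] /(congr1 val) /= [-> /val_inj ->].
rewrite -(card_imset _ inj); apply: subset_leq_card; apply/subsetP => t.
by case/imsetP=> p; rewrite /X inE => /andP[_ Qp] ->; rewrite inE.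
Qed.

Section GenericCount.
Variable R : realType.
Local Notation P := {mpoly R[2]}.
Local Notation point := (point R).
Variables (C : finType) (x : C -> P) (d n z : nat) (TL : seq (seq point)).
Variables (a : 'I_n -> point) (src : C -> {set 'I_n}).
Hypothesis src_zero : forall c i, i \in src c -> ev2 (x c) (a i) = 0.
Hypothesis src_few : forall c f, (deg f <= d)%N -> ~ rdvd (x c) f ->
  (#|[set i in src c | ev2 f (a i) == 0%R]| <= z)%N.
Hypothesis x_deg : forall c, (deg (x c) <= d)%N.
Hypothesis x_dist : forall c c', c' != c -> ~ rdvd (x c) (x c').

Local Notation inTL := (fun T => T \in TL).

(** A point of [src c] that is not generic lies on another curve [x c'], or is a base point of a
    system, given by a base set, a subsequence of [S] and a degree, that has a member not divisible
    by [x c]. Fixing one such member per system leaves at most [z] bad points for each event. *)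
Lemma gen_step_count (S : seq (C * point)) c :
  (#|src c| <= #|[set i | `[< gen_step x d inTL S c (a i) >]]| +
     (#|C| + size TL * 2 ^ size S * d.+1) * z)%N.
Proof.
pose B1 c' := [set i in src c | (c' != c) && (ev2 (x c') (a i) == 0)].
pose ev := ('I_(size TL) * (size S).-tuple bool * 'I_d.+1)%type.
pose U (e : ev) p := V e.2 (pts (mask e.1.2 S) ++ nth [::] TL e.1.1) p.
pose B2 (e : ev) := [set i in src c | `[< (~ forall p, U e p -> rdvd (x c) p) /\
   (forall p, U e p -> ev2 p (a i) = 0) >]].
have B1z c' : (#|B1 c'| <= z)%N.
  have [->|ne] := eqVneq c' c.
    by rewrite (_ : B1 c = set0) ?cards0 //; apply/setP => i; rewrite !inE eqxx andbF.
  apply: leq_trans (src_few (x_deg c') (x_dist ne)); apply: subset_leq_card.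
  by apply/subsetP => i; rewrite !inE => /and3P[-> _ ->].
have B2z e : (#|B2 e| <= z)%N.
  have [h|nh] := pselect (forall p, U e p -> rdvd (x c) p).
    rewrite (_ : B2 e = set0) ?cards0 //; apply/setP => i; rewrite !inE.
    by apply/negP => /andP[_ /asboolP[]].
  move/existsNP: (nh) => [f /not_implyP[Uf nf]].
  have df : (deg f <= d)%N by case/andP: Uf => df _; apply: leq_trans df (leq_ord _).
  apply: leq_trans (src_few df nf); apply: subset_leq_card; apply/subsetP => i.
  by rewrite !inE => /andP[-> /asboolP[_ /(_ f Uf) ->]]; rewrite eqxx.
have sub : src c \subset [set i | `[< gen_step x d inTL S c (a i) >]] :|:
    (\bigcup_c' B1 c' :|: \bigcup_e B2 e).
  apply/subsetP => i ic; rewrite !inE.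
  have [//|/= ng] := boolP `[< _ >].
  apply: contrapT => /negP; rewrite negb_or => /andP[/bigcupP nB1 /bigcupP nB2].
  move/asboolP: ng; apply; split; first exact: src_zero.
    move=> c' ne; apply/negP => e; apply: nB1; exists c' => //.
    by rewrite inE ic ne.
  move=> T k S' TT le_kd /subseqP[m sm eS'] hb.
  apply: contrapT => nd; apply: nB2.
  have hT : (index T TL < size TL)%N by rewrite index_mem.
  have hm : size m == size S by rewrite sm.
  exists (Ordinal hT, Tuple hm, inord k) => //.
  rewrite inE ic /U /=; apply/asboolP.
  by rewrite !inordK // nth_index // -eS'; split.
apply: leq_trans (subset_leq_card sub) _.
apply: leq_trans (leq_card_setU _ _) _; rewrite leq_add2l.
apply: leq_trans (leq_card_setU _ _) _; rewrite mulnDl; apply: leq_add.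
  exact: leq_card_bigcup_const.
apply: leq_trans (leq_card_bigcup_const B2z) _.
by rewrite !card_prod !card_ord card_tuple card_bool.
Qed.

Variables (cs : seq C) (w : nat).
Hypothesis src_large : forall c, c \in cs ->
  (w + (#|C| + size TL * 2 ^ size cs * d.+1) * z <= #|src c|)%N.

(** Tuples grow at the head, so a partial tuple receives the last [size t] colors. *)
Definition ann (t : seq 'I_n) := zip (drop (size cs - size t) cs) (map a t).

Lemma generic_count :
  (w ^ size cs <= #|[set t : (size cs).-tuple 'I_n | `[< gen x d inTL (ann t) >]]|)%N.
Proof.
apply: (@count_extensions n (size cs) w (fun t => gen x d inTL (ann t))) => [|t lt_t gt].
  by rewrite /ann /=; case: (drop _ _).
case ecs : cs => [|c0 cs'] ; first by rewrite ecs in lt_t.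
set c := nth c0 cs (size cs - (size t).+1).
have lt_j : (size cs - (size t).+1 < size cs)%N by lia.
have eann i : ann (i :: t) = (c, a i) :: ann t.
  rewrite /ann /= (drop_nth c0) //= -/c; congr (_ :: zip (drop _ _) _); lia.
have sz_ann : (size (ann t) <= size cs)%N.
  by rewrite size_zip size_drop size_map; lia.
have := gen_step_count (ann t) c.
have := @src_large c (mem_nth _ lt_j).
have le2 : ((#|C| + size TL * 2 ^ size (ann t) * d.+1) * z <=
            (#|C| + size TL * 2 ^ size cs * d.+1) * z)%N.
  by rewrite leq_mul2r leq_add2l leq_mul2r leq_mul2l leq_exp2l // sz_ann !orbT.
move=> h1 h2; have h3 : (w <= #|[set i | `[< gen_step x d inTL (ann t) c (a i) >]]|)%N by lia.
apply: leq_trans h3 _; apply: subset_leq_card; apply/subsetP => i; rewrite !inE.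
by move=> /asboolP gi; apply/asboolP; rewrite eann /=.
Qed.

Lemma pts_ann (t : (size cs).-tuple 'I_n) : pts (ann t) = map a t.
Proof. by rewrite /ann size_tuple subnn drop0 /pts -/unzip2 unzip2_zip // size_map size_tuple. Qed.

Lemma colors_ann (t : (size cs).-tuple 'I_n) : [seq c.1 | c <- ann t] = cs.
Proof. by rewrite /ann size_tuple subnn drop0 -/unzip1 unzip1_zip // size_map size_tuple. Qed.

End GenericCount.

(** * Nets of curves *)

Section Traces.
Variable R : realType.
Local Notation P := {mpoly R[2]}.
Local Notation point := (point R).
Variables (n d : nat) (a : 'I_n -> point).
Implicit Types (f g : P) (S : seq point).

Definition Zset f : {set 'I_n} := [set i | ev2 f (a i) == 0].

(* traces on the point set of the curves counted by the theorem *)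
Definition traces (nd : nat) : {set {set 'I_n}} :=
  [set E | `[< exists f, [/\ f != 0, (deg f <= d)%N, E = Zset f, (#|E| <= nd)%N &
     forall g, (deg g <= d)%N -> (forall i, i \in E -> ev2 g (a i) = 0) -> exists c, g = c *: f] >]].

Definition traces_over nd S := [set E in traces nd |
  all (fun s => [forall i, (a i == s) ==> (i \in E)]) S].

Section Net.
Variables (S : seq point) (z : point).
Hypothesis S_in : forall s, s \in S -> exists i, a i = s.
Hypothesis vdimS : vdim d S = 3%N.

Definition isbase i := forall f, V d S f -> ev2 f (a i) = 0.
(** Points set aside because their fibers may be too large: a curve of the net that avoids the
    single point [z] avoids them all. *)
Definition isbad i := forall f, V d S f -> ev2 f (a i) = 0 -> ev2 f z = 0.
Definition fib i := [set j | `[< forall f, V d (a i :: S) f -> ev2 f (a j) = 0 >]].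
Definition usable := [set i | ~~ `[< isbase i >] && ~~ `[< isbad i >]].

Hypothesis fib_le : forall i, i \in usable -> (#|fib i| <= d ^ 2)%N.
Hypothesis not_on_one : forall f, V d S f -> f != 0 ->
  exists2 i, i \in usable & ev2 f (a i) != 0.

(* Evaluation at a point is a linear form on the three-dimensional space [V d S], that is, a line
   of its projectivization. An ordinary crossing of these lines is a curve through [S] that meets
   the point set in the base points and in at most two fibers. *)
Lemma net_traces :
  (#|usable| <= (6 * #|traces_over (2 * d ^ 2 + 3 - D d) S| + 2) * d ^ 2)%N.
Proof.
have [b [bfree bV bspan]] := vdim_basis vdimS.
pose i1 : 'I_3 := lift ord0 ord0; pose i2 : 'I_3 := lift ord0 (lift ord0 ord0).
pose fu (u : vec R) : P := u.1.1 *: b ord0 + u.1.2 *: b i1 + u.2 *: b i2.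
pose Lv q : vec R := (ev2 (b ord0) q, ev2 (b i1) q, ev2 (b i2) q).
have sum3 (F : 'I_3 -> P) : \sum_i F i = F ord0 + F i1 + F i2.
  by rewrite !big_ord_recl big_ord0 addr0 addrA.
have evfu u q : ev2 (fu u) q = dot (Lv q) u.
  by rewrite /fu !ev2D !ev2Z /dot /=; ring.
have fuV u : V d S (fu u) by rewrite /fu !V_D // V_Z.
have fu0 u : fu u = 0 -> u = v0 R.
  move=> e; pose c (i : 'I_3) := if i == ord0 then u.1.1 else if i == i1 then u.1.2 else u.2.
  have : \sum_i c i *: b i = 0 by rewrite sum3 /c /=.
  by move/bfree => h; apply: vecP; [exact: (h ord0)|exact: (h i1)|exact: (h i2)].
have fu_span f : V d S f -> exists u, f = fu u.
  by move/bspan => [c ->]; exists (c ord0, c i1, c i2); rewrite sum3.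
have prop p q : Lv p <> v0 R -> cross (Lv p) (Lv q) = v0 R -> exists t, Lv q = vscl t (Lv p).
  move=> p0 e; have pp : dot (Lv p) (Lv p) != 0 by apply/eqP => /dot_self_eq0.
  exists (dot (Lv p) (Lv q) / dot (Lv p) (Lv p)).
  have : cross (Lv p) (cross (Lv p) (Lv q)) = v0 R.
    by rewrite e; vec_ring.
  rewrite cross_crossr /vadd {1}/vscl /v0 => -[/= e1 e2 e3].
  have sol (x y w t : R) : w != 0 -> x * y + - w * t = 0 -> t = x / w * y.
    by move=> w0 h; have -> : t = (x * y - (x * y + - w * t)) / w by [field]; rewrite h; field.
  by apply: vecP => /=; apply: sol.
have nbase i : ~ isbase i -> Lv (a i) <> v0 R.
  by move=> nb e; apply: nb => f /fu_span[u ->]; rewrite evfu e dotC dot0.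
have usableP i : i \in usable -> ~ isbase i /\ ~ isbad i.
  by rewrite inE => /andP[/asboolP h1 /asboolP h2].
have us0 i : i \in usable -> Lv (a i) <> v0 R by move=> /usableP[/nbase].
have usz i : i \in usable -> cross (Lv (a i)) (Lv z) <> v0 R.
  move=> iu e; have [_] := usableP i iu; apply => f /fu_span[u ->].
  by have [t et] := prop _ _ (us0 i iu) e; rewrite !evfu et ![dot _ u]dotC dotZ => ->; rewrite mulr0.
have fibP i j : i \in usable -> cross (Lv (a i)) (Lv (a j)) = v0 R -> j \in fib i.
  move=> iu e; rewrite inE; apply/asboolP => f; rewrite V_cons => /andP[/eqP fi /fu_span[u eu]].
  have [t et] := prop _ _ (us0 i iu) e.
  by move: fi; rewrite eu !evfu et ![dot _ u]dotC dotZ => ->; rewrite mulr0.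
pose Ppair (J : {set 'I_n}) := (J \subset usable) &&
  [forall i in J, forall j in J, (i != j) ==> (cross (Lv (a i)) (Lv (a j)) != v0 R)].
have PpairP (J : {set 'I_n}) : reflect ({subset J <= usable} /\ forall i j, i \in J -> j \in J ->
    i != j -> cross (Lv (a i)) (Lv (a j)) <> v0 R) (Ppair J).
  apply: (iffP andP) => [[/subsetP h1 /forall_inP h2]|[h1 h2]]; split=> //.
  - move=> i j iJ jJ; have /forall_inP h3 := h2 i iJ.
    by move: (h3 j jJ) => /implyP h4 /h4 /eqP.
  - exact/subsetP.
  - apply/forall_inP => i iJ; apply/forall_inP => j jJ; apply/implyP => ne; apply/eqP.
    exact: h2.
(* Points of one fiber define the same line, so a maximal set [J] with pairwise distinct lines
   chooses one usable point per line. *)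
have [J /maxsetP[/PpairP[JU Jpair] Jmax] _] : {J | maxset Ppair J & set0 \subset J}.
  by apply: maxset_exists; apply/PpairP; split=> [i|i j]; rewrite inE.
have crossC0 u w : cross u w = v0 R -> cross w u = v0 R.
  by move=> e; rewrite crossC e vscl_v0.
have rep i : i \in usable -> exists2 j, j \in J & cross (Lv (a j)) (Lv (a i)) = v0 R.
  move=> iu; apply: contrapT => no.
  have iJ : i \in J.
    rewrite -(Jmax (i |: J)) ?setU11 ?subsetU1 //; apply/PpairP; split.
      by move=> k; rewrite in_setU1 => /orP[/eqP -> //|/JU].
    move=> k l; rewrite !inE => /orP[/eqP ->|kJ] /orP[/eqP ->|lJ] ne.
    - by rewrite eqxx in ne.
    - by move=> /crossC0 e; apply: no; exists l.
    - by move=> e; apply: no; exists k.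
    - exact: Jpair.
  by apply: no; exists i => //; rewrite crossvv.
pose I : finType := {x : 'I_n | x \in J}.
pose L (x : I) := Lv (a (val x)).
have Ldist x y : x != y -> cross (L x) (L y) <> v0 R.
  by move=> ne; apply: Jpair; [exact: valP|exact: valP|].
have Lz x : cross (L x) (Lv z) <> v0 R by apply: usz; apply: JU; apply: valP.
have Lconc u : u <> v0 R -> exists x, dot (L x) u != 0.
  move=> u0; have fu0' : fu u != 0 by apply/eqP => /fu0.
  have [i iu] := not_on_one (fuV u) fu0'; rewrite evfu => h.
  have [j jJ e] := rep i iu; exists (exist _ j jJ).
  have [t et] := prop _ _ (us0 j (JU j jJ)) e.
  by apply: contraNneq h => e0; rewrite et dotC dotZ dotC [dot _ _]e0 mulr0.
have card_us : (#|usable| <= #|{: I}| * d ^ 2)%N.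
  rewrite card_sig -sum_nat_const.
  have sub : usable \subset \bigcup_(j in J) fib j.
    apply/subsetP => i iu; have [j jJ e] := rep i iu; apply/bigcupP; exists j => //.
    by apply: fibP => //; apply: JU.
  apply: leq_trans (subset_leq_card sub) _; apply: leq_trans (leq_card_bigcup _ _) _.
  by apply: leq_sum => j jJ; apply: fib_le; apply: JU.
apply: leq_trans card_us _; rewrite leq_mul2r; apply/orP; right.
apply: leq_trans (many_ordinary Ldist Lz Lconc) _.
rewrite leq_add2r leq_mul2l /=.
pose res (Z : {set 'I_n}) : {set I} := [set x | val x \in Z].
apply: leq_trans (leq_imset_card res _); apply: subset_leq_card; apply/subsetP => E.
move=> /ordinaryP[x [y [nxy eE eT zu]]]; set u := cross (L x) (L y) in eT zu.
apply/imsetP; exists (Zset (fu u)); last first.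
  by rewrite eT; apply/setP => k; rewrite !inE evfu.
(* There are at least D d - 3 base points, all contained in both fibers; this overlap turns 2 d^2
   into the required bound. *)
pose B := [set i | `[< isbase i >]].
have dB : (D d <= 3 + #|B|)%N.
  have := vdim_size d (map a (enum B)); rewrite size_map -cardE => h.
  apply: leq_trans h _; rewrite leq_add2r -vdimS; apply: vdim_sub => s sS.
  have [i ei] := S_in sS; rewrite -ei map_f // mem_enum inE; apply/asboolP => f.
  by case/andP=> _ /vanishP; rewrite ei; apply.
have subB i : B \subset fib i.
  apply/subsetP => k; rewrite !inE => /asboolP kb; apply/asboolP => f.
  by rewrite V_cons => /andP[_]; apply: kb.
have fibB i : i \in J -> (#|fib i :\: B| + #|B| <= d ^ 2)%N.
  move=> iJ; by have := fib_le (JU i iJ); rewrite -(cardsID B (fib i)) (setIidPr (subB i)) addnC.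
have [xu yu] := thru_X L x y.
have zcover : Zset (fu u) \subset B :|: (fib (val x) :\: B) :|: (fib (val y) :\: B).
  apply/subsetP => i; rewrite !in_setU !in_setD [i \in Zset _]inE evfu => /eqP iu.
  have [//|/= iB] := boolP (i \in B).
  have ius : i \in usable.
    rewrite inE; apply/andP; split; first by rewrite inE in iB.
    apply/asboolP => /(_ (fu u) (fuV u)); rewrite !evfu => /(_ iu) e.
    by rewrite e eqxx in zu.
  have [j jJ e] := rep i ius; have jE : exist _ j jJ \in E.
    rewrite eT inE /L /=; have [t et] := prop _ _ (us0 j (JU j jJ)) e.
    have t0 : t != 0.
      by apply/eqP => t0; apply: (us0 i ius); rewrite et t0 vscl0.
    by move: iu; rewrite et dotC dotZ dotC => /eqP; rewrite mulf_eq0 (negPf t0).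
  move: jE; rewrite eE in_set2 => /orP[] /eqP ej.
    by rewrite -ej /= (fibP _ _ (JU j jJ) e).
  by rewrite -ej /= (fibP _ _ (JU j jJ) e) orbT.
rewrite inE; apply/andP; split; last first.
  apply/allP => s sS; apply/forallP => i; apply/implyP => /eqP ei.
  by rewrite inE; have /andP[_ /vanishP h] := fuV u; rewrite ei h.
rewrite inE; apply/asboolP; exists (fu u); split=> //.
- by apply/eqP => /fu0; apply: Ldist.
- by case/andP: (fuV u).
- apply: leq_trans (subset_leq_card zcover) _.
  have [h1 _] := leq_card_setU (B :|: (fib (val x) :\: B)) (fib (val y) :\: B).
  have [h2 _] := leq_card_setU B (fib (val x) :\: B).
  have h3 := fibB (val x) (valP x); have h4 := fibB (val y) (valP y).
  move: dB h1 h2 h3 h4; clear.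
  move: #|B| #|fib (val x) :\: B| #|fib (val y) :\: B| (d ^ 2)%N (D d) => p q r e f.
  move: #|B :|: (fib (val x) :\: B) :|: (fib (val y) :\: B)| #|B :|: (fib (val x) :\: B)| => s t; lia.
- move=> g dg gE; have gV : V d S g.
    apply/andP; split=> //; apply/vanishP => s sS; have [i ei] := S_in sS.
    rewrite -ei gE // inE ei; have /andP[_ /vanishP h] := fuV u; by rewrite h.
  have [w ew] := fu_span g gV.
  have on k : k \in thru L u -> dot (L k) w = 0.
    by rewrite inE -evfu => ku; rewrite -evfu -ew gE // inE.
  have [t et] := perp_cross (Ldist _ _ nxy) (on x xu) (on y yu).
  exists t; rewrite ew et /fu /vscl /=.
  by rewrite !scalerDr !scalerA.
Qed.

End Net.
End Traces.

Lemma D_split k e : (D (k + e) + 1 = D k + D e + k * e)%N.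
Proof. have := D2E (k + e); have := D2E k; have := D2E e; lia. Qed.

Lemma D_0 : D 0 = 1%N.
Proof. by have := D2E 0; lia. Qed.

Lemma leq_count_in (T : eqType) (p q : pred T) (s : seq T) :
  (forall y, y \in s -> p y -> q y) -> (count p s <= count q s)%N.
Proof.
move=> h; rewrite -!size_filter; elim: s h => //= y s IH h.
have {}IH := IH (fun z (zs : z \in s) => h z (@mem_behead _ (y :: s) z zs)).
case: ifP => [py|_]; first by rewrite h ?mem_head.
by case: ifP => //= _; apply: leq_trans IH _.
Qed.

Lemma count_nseqs (C : finType) (m : C -> nat) (I : {set C}) :
  (count (fun c => c \in I) (flatten [seq nseq (m c) c | c <- index_enum C]) = \sum_(c in I) m c)%N.
Proof.
rewrite count_flatten -map_comp sumnE big_map [RHS]big_mkcond; apply: eq_bigr => c _.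
by rewrite /= count_nseq; case: (c \in I); rewrite ?mul1n ?mul0n.
Qed.

Lemma size_nseqs (C : finType) (m : C -> nat) :
  (size (flatten [seq nseq (m c) c | c <- index_enum C]) = \sum_c m c)%N.
Proof.
by rewrite size_flatten /shape -map_comp sumnE big_map; apply: eq_bigr => c _; rewrite /= size_nseq.
Qed.

(** A set of at most [nd] points contains at most nd^K tuples of length [K]. *)
Lemma double_count (n K nd w C : nat) (T : {set K.-tuple 'I_n}) (G : {set {set 'I_n}}) :
  (forall E, E \in G -> (#|E| <= nd)%N) ->
  (forall t, t \in T -> (w <= C * #|[set E in G | all (mem E) t]|)%N) ->
  (#|T| * w <= C * #|G| * nd ^ K)%N.
Proof.
move=> small many; rewrite -sum_nat_const.
have /leq_trans : (\sum_(t in T) w <= \sum_(t in T) C * #|[set E in G | all (mem E) t]|)%N.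
  exact: leq_sum.
apply; rewrite -big_distrr /= -mulnA leq_mul2l; apply/orP; right.
have -> : (\sum_(t in T) #|[set E in G | all (mem E) t]| =
    \sum_(t in T) \sum_(E in G | all (mem E) t) 1)%N.
  apply: eq_bigr => t _; rewrite sum1_card; apply: eq_card => E.
  by rewrite inE.
rewrite (exchange_big_dep (mem G)) /=; last by move=> t E _ /andP[].
rewrite -sum_nat_const; apply: leq_sum => E EG; rewrite sum1_card.
apply: (@leq_trans #|[set t : K.-tuple 'I_n | all (mem E) t]|).
  apply: subset_leq_card; apply/subsetP => t /and3P[_ _ h]; by rewrite inE.
pose h (t : K.-tuple 'I_n) := [ffun k => tnth t k].
have injh : injective h.
  by move=> t t' /ffunP e; apply: eq_from_tnth => k; have := e k; rewrite !ffunE.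
rewrite -(card_imset _ injh); apply: (@leq_trans #|[set f : {ffun 'I_K -> 'I_n} | f \in ffun_on (mem E)]|).
  apply: subset_leq_card; apply/subsetP => f /imsetP[t]; rewrite !inE => /allP tE ->.
  by apply/ffun_onP => k; rewrite ffunE; apply: tE; apply: mem_tnth.
rewrite cardsE card_ffun_on card_ord.
by elim: K {T many h injh} => // k IH; rewrite !expnS leq_mul ?small.
Qed.

(** * Generic nets: no pencil has a fixed component *)

Section GenericNet.
Variable R : realType.
Local Notation P := {mpoly R[2]}.
Local Notation point := (point R).
Variables (C : finType) (x : C -> P) (d : nat).
Implicit Types (S : seq (C * point)) (I : {set C}) (f g h : P).
Hypothesis d_ne2 : d != 2%N.
Hypothesis x_irr : forall c, x c != 0 -> irr (x c).
Variable S : seq (C * point).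
Hypothesis genS : gen x d (fun T => T \in [:: [::]]) S.
Hypothesis sizeS : (size S + 3 = D d)%N.
Hypothesis balanced : forall I, (exists c, c \in I) -> (forall c, c \in I -> x c != 0) ->
  (deg (xI x I) <= d)%N ->
  (count (fun cs => cs.1 \in I) S + 2 + D (d - deg (xI x I)) <= D d)%N.

Lemma net_structure S' k : subseq S' S -> (k <= d)%N ->
  (forall p, V k (pts S') p -> p = 0) \/
  exists I, [/\ forall c, c \in I -> x c != 0 /\ c \in [seq cs.1 | cs <- S'],
    (deg (xI x I) <= k)%N,
    forall p, V k (pts S') p -> rdvd (xI x I) p &
    (vdim k (pts S') + size (out I S') = D (k - deg (xI x I)))%N].
Proof.
move=> sub le_kd.
have := generic_structure (gen_subseq sub genS) (mem_head [::] [::]) le_kd.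
rewrite cats0; case=> [c z|z|[I [h1 h2 h3 h4]]]; [by rewrite in_nil|by left|right].
by exists I; split=> //; rewrite -(vdim_nil R).
Qed.

Lemma count_out I S' : (count (fun cs => cs.1 \in I) S' + size (out I S') = size S')%N.
Proof. by rewrite /out size_filter -[RHS](count_predC (fun cs => cs.1 \in I)). Qed.

Lemma net_vdim : vdim d (pts S) = 3%N.
Proof.
have ge3 : (3 <= vdim d (pts S))%N.
  by have := vdim_size d (pts S); rewrite /pts size_map; lia.
have [z|[I [hI dI _ vd]]] := net_structure (subseq_refl S) (leqnn d).
  have /vdim_gt0P[p /z ->] : (0 < vdim d (pts S))%N by lia.
  by rewrite eqxx.
have := count_out I S; have [I0|/set0Pn Ine] := eqVneq I set0.
  move: vd; rewrite I0 /xI big_set0 /deg msize1 subn0.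
  have -> : out set0 S = S by apply/all_filterP/allP => cs _; rewrite inE.
  lia.
by have := balanced Ine (fun c ci => (hI c ci).1) dI; lia.
Qed.

(** A common factor [h] of degree e splits [S] into the points off [h], which still leave a pencil
    of degree d - e, and those on [h]. If the latter are independent in degree e, they number at
    most D e - 1, and [D_split] together with [balanced] contradicts |S| = D d - 3 unless e (d-e) <=
    1. Otherwise [h] is one of the curves [x c], and [balanced] applies to [c |: I]. *)
Lemma net_no_common f g : V d (pts S) f -> V d (pts S) g -> f != 0 ->
  (forall c, g != c *: f) -> no_common f g.
Proof.
move=> Vf Vg f0 ind h irr_h [qf ef] [qg eg]; have h0 := irr_neq0 irr_h.
set e := deg h; have e_gt0 : (0 < e)%N := irr_deg irr_h.
have qf0 : qf != 0 by apply: contraNneq f0 => q0; rewrite ef q0 mul0r.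
have le_ed : (e <= d)%N by case/andP: Vf => + _; rewrite ef degM // -/e; lia.
pose S2 := [seq cs <- S | ev2 h cs.2 != 0].
have down q u : u = q * h -> V d (pts S) u -> V (d - e) (pts S2) q.
  move=> eu; rewrite eu; apply: V_div => // z /mapP[cs]; rewrite mem_filter => /andP[hs inS ->] //.
  exact: map_f.
have ge2 : (2 <= vdim (d - e) (pts S2))%N.
  rewrite leqNgt ltnS; apply/negP => le1.
  have [c ec] := vdim_le1 le1 (down _ _ ef Vf) (down _ _ eg Vg) qf0.
  by have := ind c; rewrite eg ec ef scalerAl eqxx.
have lt_ed : (e < d)%N.
  rewrite ltn_neqAle le_ed andbT; apply/eqP => ed.
  have sub : {subset [::] <= pts S2} by [].
  have de : (d - e = 0)%N by rewrite ed subnn.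
  by have := leq_trans ge2 (vdim_sub _ sub); rewrite vdim_nil de D_0.
have [z|[I [hI dI _ vd]]] := net_structure (filter_subseq (fun cs => ev2 h cs.2 != 0) S) (leq_subr e d).
  by have := z _ (down _ _ ef Vf); move/eqP; rewrite (negPf qf0).
rewrite -/S2 in vd.
pose S3 := [seq cs <- S | (cs.1 \notin I) && (ev2 h cs.2 == 0)].
have sizes : (size S = count (fun cs => cs.1 \in I) S + size S3 + size (out I S2))%N.
  rewrite /S3 /S2 /out -filter_predI !size_filter.
  elim: S => //= cs S' IH; rewrite [in LHS]IH.
  by case: (cs.1 \in I) => /=; case: (ev2 h cs.2 == 0) => /=; lia.
have cI_le : (exists c, c \in I) ->
    (count (fun cs => cs.1 \in I) S + 2 + D (d - deg (xI x I)) <= D d)%N.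
  move=> I0; apply: balanced => //; first by move=> c /hI[].
  exact: leq_trans dI (leq_subr _ _).
have hS3 : V e (pts S3) h.
  rewrite /V leqnn; apply/vanishP => s /mapP[cs]; rewrite mem_filter.
  by move=> /andP[/andP[_ /eqP hs] _] ->.
have [z|[I3 [hI3 _ dvdI3 vd3]]] := 
    net_structure (filter_subseq (fun cs => (cs.1 \notin I) && (ev2 h cs.2 == 0)) S) le_ed.
  by move/eqP: (z _ hS3); rewrite (negPf h0).
rewrite -/S3 in vd3 dvdI3 hI3.
have [I30|/set0Pn[c cI3]] := eqVneq I3 set0.
  have a_le : (size S3 + 1 <= D e)%N.
    have v1 : (0 < vdim e (pts S3))%N by apply/vdim_gt0P; exists h.
    move: vd3; rewrite I30 /xI big_set0 /deg msize1 subn0.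
    have -> : out set0 S3 = S3 by apply/all_filterP/allP => cs _; rewrite inE.
    lia.
  have [I0|/set0Pn /cI_le cI] := eqVneq I set0.
    move: sizes vd; rewrite I0 /xI big_set0 /deg msize1 subn0.
    have -> : count (fun cs : C * point => cs.1 \in set0) S = 0%N.
      by apply/eqP; rewrite -leqn0 leqNgt -has_count; apply/hasPn => cs _; rewrite inE.
    have := D_split (d - e) e; rewrite subnK // => hD sz vd.
    have : ((d - e) * e <= 1)%N by lia.
    move: lt_ed e_gt0 d_ne2; clear; move=> h1 h2 h3 h4.
    move: h4; rewrite leq_eqVlt ltnS leqn0 muln_eq1 muln_eq0.
    by case/orP => [/andP[/eqP h5 /eqP h6]|/orP[] /eqP]; lia.
  have e1 : (d - e - deg (xI x I) + e = d - deg (xI x I))%N by lia.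
  have := D_split (d - e - deg (xI x I)) e; rewrite e1 => hD.
  have := leq0n ((d - e - deg (xI x I)) * e); lia.
have [_ cS3] := hI3 c cI3; have x_c := (hI3 c cI3).1.
have cnI : c \notin I.
  by case/mapP: cS3 => cs; rewrite mem_filter => /andP[/andP[h1 _] _] ->.
have [u hu ehu] : exists2 u : P, u \is a GRing.unit & h = u * x c.
  have [q eq_h] := dvdI3 h hS3; rewrite /xI (bigD1 c) //= in eq_h.
  have [_ _ /(_ (q * \prod_(i in I3 | i != c) x i) (x c))] := irr_h.
  case; first by rewrite eq_h; ring.
    by move=> uq; exists (q * \prod_(i in I3 | i != c) x i) => //; rewrite eq_h; ring.
  by have [_ /negPf -> _] := x_irr x_c.
have u0 : u != 0 by apply: contraNneq h0 => u0; rewrite ehu u0 mul0r.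
have dxc : deg (x c) = e.
  by rewrite /e ehu degM //; move: hu; rewrite unitE_deg // => /eqP ->.
have xI0 : xI x I != 0 by apply/prodf_neq0 => c' /hI[].
have exI : deg (xI x (c |: I)) = (e + deg (xI x I))%N.
  by rewrite /xI big_setU1 //= degM // dxc.
have cnt : (count (fun cs => cs.1 \in I) S + size S3 <= count (fun cs => cs.1 \in c |: I) S)%N.
  rewrite /S3 size_filter -count_predUI.
  rewrite [X in (_ + X)%N](_ : _ = 0%N) ?addn0.
    apply: leq_count_in => -[c' s] inS /=; rewrite in_setU1.
    case/orP=> [->|/andP[_ /eqP hs]]; first by rewrite orbT.
    have [_ hc'] := gen_mem genS inS.
    apply/orP; left; apply: contraT => ne; have := hc' c; rewrite eq_sym => /(_ ne).
    by move/eqP: hs; rewrite ehu ev2M mulf_eq0 (negPf (unit_ev2 _ hu)) /= => ->.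
  apply/eqP; rewrite -leqn0 leqNgt -has_count; apply/hasPn => cs _ /=.
  by case: (cs.1 \in I).
have h1 : (count (fun cs => cs.1 \in c |: I) S + 2 + D (d - (e + deg (xI x I))) <= D d)%N.
  rewrite -exI; apply: balanced; first by exists c; rewrite setU11.
    by move=> c'; rewrite in_setU1 => /orP[/eqP ->|/hI[]].
  by rewrite exI -(subnKC le_ed) leq_add2l.
rewrite subnDA in h1; move: h1 cnt sizes vd ge2 sizeS; clear.
move: (count _ S) (count _ S) (size S3) (size S) (size (out I S2)) (vdim _ _) (D d) (D _).
lia.
Qed.

End GenericNet.

(** * Traces from a net without fixed components *)

Section NetFromGeneric.
Variable R : realType.
Local Notation P := {mpoly R[2]}.
Local Notation point := (point R).
Variables (n d : nat) (a : 'I_n -> point) (S : seq point).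
Hypothesis a_inj : injective a.
Hypothesis d_gt0 : (0 < d)%N.
Hypothesis S_in : forall s, s \in S -> exists i, a i = s.
Hypothesis vdimS : vdim d S = 3%N.
Hypothesis pencil_free : forall f g : P, V d S f -> V d S g -> f != 0 ->
  (forall c, g != c *: f) -> no_common f g.
Hypothesis spread : forall f : P, f != 0 -> (deg f <= d)%N ->
  (d ^ 2 < #|[set i | ev2 f (a i) != 0%R]|)%N.
Hypothesis n_large : (6 * d ^ 2 <= n)%N.

Lemma pencil_fib i : ~ isbase d a S i -> (#|fib d a S i| <= d ^ 2)%N.
Proof.
move=> /existsNP[f0 /not_implyP[Vf0 /eqP f0i]].
have v2 : vdim d (a i :: S) = 2%N by have := vdim_cons_lt Vf0 f0i; rewrite vdimS => -[].
have [|f [g [Vf Vg fn0 ind]]] := @vdim_ge2 _ d (a i :: S); first by rewrite v2.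
have gn0 : g != 0 by have := ind 0; rewrite scale0r.
have VS u : V d (a i :: S) u -> V d S u by rewrite V_cons => /andP[].
have nc := pencil_free (VS _ Vf) (VS _ Vg) fn0 ind.
have van u : V d (a i :: S) u -> vanish (map a (enum (fib d a S i))) u.
  move=> Vu; apply/vanishP => q /mapP[j]; rewrite mem_enum inE => /asboolP hj ->.
  exact: hj.
have := bezout fn0 gn0 nc _ (van _ Vf) (van _ Vg); rewrite size_map -cardE.
rewrite map_inj_uniq ?enum_uniq // => /(_ isT) /leq_trans; apply.
by rewrite -mulnn leq_mul //; [case/andP: Vf|case/andP: Vg].
Qed.

(** Bezout bounds every fiber here, so any point [a i0] that is not a base point can serve as [z]:
    the discarded points then all lie in the fiber of [i0]. *)
Lemma generic_net_traces :
  (n <= 12 * d ^ 2 * #|traces_over d a (2 * d ^ 2 + 3 - D d) S|)%N.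
Proof.
have [f0 Vf0 f0n0] : exists2 f, V d S f & f != 0 by apply/vdim_gt0P; rewrite vdimS.
have df0 : (deg f0 <= d)%N by case/andP: Vf0.
have [i0 f0i] : exists i, ev2 f0 (a i) != 0.
  have : (0 < #|[set i | ev2 f0 (a i) != 0%R]|)%N by apply: leq_trans (spread f0n0 df0).
  by case/card_gt0P => i; rewrite inE; exists i.
have nb0 : ~ isbase d a S i0 by move=> /(_ _ Vf0) /eqP; rewrite (negPf f0i).
have v2 i : ~ isbase d a S i -> vdim d (a i :: S) = 2%N.
  move=> /existsNP[f /not_implyP[Vf /eqP fi]].
  by have := vdim_cons_lt Vf fi; rewrite vdimS => -[].
pose U := usable d a S (a i0).
have subU : ~: U \subset fib d a S i0.
  apply/subsetP => i; rewrite !inE negb_and !negbK => h; apply/asboolP => f Vf.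
  have VSf : V d S f by move: Vf; rewrite V_cons => /andP[].
  have [bi|nbi] := pselect (isbase d a S i); first exact: bi.
  case/orP: h => /asboolP // bad; apply: contrapT => /eqP fi.
  have := vdim_cons_lt Vf fi; rewrite v2 //.
  suff -> : vdim d (a i :: a i0 :: S) = vdim d (a i :: S) by rewrite v2.
  apply/eqP; rewrite eqn_leq; apply/andP; split; apply: vdim_mono => u.
    by rewrite !V_cons => /and3P[-> _ ->].
  by rewrite !V_cons => /andP[/eqP ui Vu]; rewrite ui (bad u Vu ui) eqxx.
have cardU : (n <= #|U| + d ^ 2)%N.
  rewrite -[leqLHS](card_ord n) -(cardsC U) leq_add2l.
  exact: leq_trans (subset_leq_card subU) (pencil_fib nb0).
have key : (#|U| <= (6 * #|traces_over d a (2 * d ^ 2 + 3 - D d) S| + 2) * d ^ 2)%N.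
  apply: net_traces => //.
    by move=> i; rewrite inE => /andP[/asboolP nb _]; apply: pencil_fib.
  move=> f Vf fn0; have df : (deg f <= d)%N by case/andP: Vf.
  have : ~~ ([set i | ev2 f (a i) != 0] \subset fib d a S i0).
    apply/negP => /subset_leq_card; have := spread fn0 df; have := pencil_fib nb0; lia.
  case/subsetPn => i; rewrite inE => fi nfib; exists i => //.
  by apply: contraNT nfib => iU; apply: (subsetP subU); rewrite inE.
move: key cardU n_large; clear; move: #|U| (d ^ 2)%N #|_| => u e t; nia.
Qed.

End NetFromGeneric.

(** * Points spread over the plane *)

Section Spread.
Variable R : realType.
Local Notation P := {mpoly R[2]}.
Local Notation point := (point R).
Variables (n d : nat) (a : 'I_n -> point).
Hypothesis a_inj : injective a.
Implicit Types (f g h : P) (X : {set 'I_n}).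

Local Notation nd := (2 * d ^ 2 + 3 - D d)%N.

Lemma few_common_zeros f g : f != 0 -> g != 0 -> no_common f g ->
  (#|[set i | (ev2 f (a i) == 0%R) && (ev2 g (a i) == 0%R)]| <= deg f * deg g)%N.
Proof.
move=> f0 g0 nc; set X := [set i | _].
have := @bezout R f g (map a (enum X)) f0 g0 nc; rewrite size_map -cardE; apply.
- by rewrite map_inj_uniq // enum_uniq.
- by apply/vanishP => q /mapP[i]; rewrite mem_enum inE => /andP[/eqP h _] ->.
- by apply/vanishP => q /mapP[i]; rewrite mem_enum inE => /andP[_ /eqP h] ->.
Qed.

Lemma irr_few_zeros h f : irr h -> (deg h <= d)%N -> (deg f <= d)%N -> ~ rdvd h f ->
  (#|[set i in [set i | ev2 h (a i) == 0%R] | ev2 f (a i) == 0%R]| <= d ^ 2)%N.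
Proof.
move=> irr_h dh df nd.
have f0 : f != 0 by apply/eqP => f0; apply: nd; exists 0; rewrite f0 mul0r.
have := few_common_zeros f0 (irr_neq0 irr_h) (no_common_irr irr_h nd) => le.
apply: (@leq_trans (deg f * deg h)); last by rewrite -mulnn leq_mul.
by apply: leq_trans le; apply: subset_leq_card; apply/subsetP => i; rewrite !inE andbC.
Qed.

(** Pigeonhole over the at most [m] irreducible factors of [f]. *)
Lemma rich_factor m f X : f != 0 -> (deg f <= m)%N -> X != set0 ->
  (forall i, i \in X -> ev2 f (a i) = 0) ->
  exists h, [/\ irr h, (deg h <= m)%N & (#|X| <= m * #|[set i in X | ev2 h (a i) == 0%R]|)%N].
Proof.
elim: m f X => [|m IHm] f X f0 df /set0Pn[i0 iX] fX.
  have fu : f \is a GRing.unit by rewrite unitE_deg // -leqn0.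
  by have := unit_ev2 (a i0) fu; rewrite fX ?eqxx.
have [d0|d_gt0] := posnP (deg f).
  have [||h [h1 h2 h3]] := IHm f X f0 _ _ fX; [by rewrite d0|by apply/set0Pn; exists i0|].
  exists h; split=> //; first exact: leqW.
  by apply: leq_trans h3 _; rewrite leq_mul2r leqnSn orbT.
have [h irr_h [f' ef]] := irr_factor d_gt0.
have h0 := irr_neq0 irr_h.
have f'0 : f' != 0 by apply: contraNneq f0 => f'0; rewrite ef f'0 mul0r.
have degs : deg f = (deg f' + deg h)%N by rewrite ef degM.
have hgt := irr_deg irr_h.
pose Y := [set i in X | ev2 h (a i) == 0].
have [le|gt] := leqP #|X| (m.+1 * #|Y|); first by exists h; split=> //; lia.
pose X' := X :\: Y.
have cX : (#|X| = #|Y| + #|X'|)%N.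
  rewrite -(cardsID Y X); congr (_ + _)%N; congr #|pred_of_set _|; apply/setIidPr.
  by apply/subsetP => i; rewrite inE => /andP[].
have X'0 : X' != set0 by rewrite -card_gt0; move: gt cX; lia.
have f'X' i : i \in X' -> ev2 f' (a i) = 0.
  rewrite in_setD => /andP[nY iX']; have hi : ev2 h (a i) != 0.
    by apply: contra nY => hi; rewrite /Y inE iX'.
  by apply: (mulIf hi); rewrite mul0r -ev2M -ef fX.
have [|h' [irr_h' dh' le']] := IHm f' X' f'0 _ X'0 f'X'; first by lia.
exists h'; split=> //; first exact: leqW.
have le2 : (#|[set i in X' | ev2 h' (a i) == 0%R]| <= #|[set i in X | ev2 h' (a i) == 0%R]|)%N.
  by apply: subset_leq_card; apply/subsetP => i; rewrite !inE => /andP[/andP[_ ->] ->].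
have le3 := leq_trans le' (leq_mul (leqnn m) le2).
move: gt cX le3; clear.
move: #|X| #|X'| #|Y| #|[set i in X | _]| => p q r t h1 h2 h3.
have [le|lt] := leqP r t; first by rewrite h2 mulSn leq_add.
have := leq_mul (leqnn m) (ltnW lt); rewrite mulSn in h1; lia.
Qed.

Section GenericCase.
Variables (C : finType) (x : C -> P) (z w C2 : nat) (src : C -> {set 'I_n}) (cs : seq C).
Hypothesis d_ne2 : d != 2%N.
Hypothesis d_gt0 : (0 < d)%N.
Hypothesis spread : forall f, f != 0 -> (deg f <= d)%N ->
  (d ^ 2 < #|[set i | ev2 f (a i) != 0%R]|)%N.
Hypothesis n_large : (6 * d ^ 2 <= n)%N.
Hypothesis src_zero : forall c i, i \in src c -> ev2 (x c) (a i) = 0.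
Hypothesis src_few : forall c f, (deg f <= d)%N -> ~ rdvd (x c) f ->
  (#|[set i in src c | ev2 f (a i) == 0%R]| <= z)%N.
Hypothesis x_deg : forall c, (deg (x c) <= d)%N.
Hypothesis x_irr : forall c, x c != 0 -> irr (x c).
Hypothesis x_dist : forall c c', c' != c -> ~ rdvd (x c) (x c').
Hypothesis src_large : forall c, c \in cs -> (w + (#|C| + 2 ^ size cs * d.+1) * z <= #|src c|)%N.
Hypothesis size_cs : (size cs + 3 = D d)%N.
Hypothesis balanced : forall I : {set C}, (exists c, c \in I) -> (forall c, c \in I -> x c != 0) ->
  (deg (xI x I) <= d)%N ->
  (count (fun c => c \in I) cs + 2 + D (d - deg (xI x I)) <= D d)%N.
Hypothesis n_le : (n <= C2 * w)%N.

Lemma traces_over_map (t : seq 'I_n) :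
  traces_over d a nd (map a t) \subset [set E in traces d a nd | all (mem E) t].
Proof.
apply/subsetP => E; rewrite !inE => /andP[-> /allP h] /=; apply/allP => i it.
by have /forallP/(_ i)/implyP := h (a i) (map_f a it); apply.
Qed.

Lemma traces_le nd' E : E \in traces d a nd' -> (#|E| <= nd')%N.
Proof. by rewrite inE => /asboolP[f []]. Qed.

Lemma generic_case :
  (n ^ d <= C2 ^ size cs * (12 * d ^ 2) * nd ^ size cs * #|traces d a nd|)%N.
Proof.
set K := size cs.
pose T := [set t : K.-tuple 'I_n | `[< gen x d (fun T => T \in [:: [::]]) (ann a cs t) >]].
have src_large' c : c \in cs -> (w + (#|C| + size [:: [::] : seq point] * 2 ^ size cs * d.+1) * z <= #|src c|)%N.
  by move=> /src_large; rewrite mul1n.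
have cT : (w ^ K <= #|T|)%N := generic_count src_zero src_few x_deg x_dist src_large'.
have over t : t \in T -> (n <= 12 * d ^ 2 * #|[set E in traces d a nd | all (mem E) t]|)%N.
  rewrite inE => /asboolP gt; set S := ann a cs t in gt.
  have ptsS : pts S = map a t by apply: pts_ann.
  have szS : (size S + 3 = D d)%N by rewrite -(size_map snd) -/(pts S) ptsS size_map size_tuple.
  have bal (I : {set C}) : (exists c, c \in I) -> (forall c, c \in I -> x c != 0) ->
      (deg (xI x I) <= d)%N ->
      (count (fun cs => cs.1 \in I) S + 2 + D (d - deg (xI x I)) <= D d)%N.
    move=> h1 h2 h3; have := balanced h1 h2 h3.
    by rewrite -{1}(colors_ann a t) -/S count_map.
  have vd := net_vdim d_ne2 gt szS bal.
  have nc := net_no_common d_ne2 x_irr gt szS bal.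
  have Sin s : s \in pts S -> exists i, a i = s.
    by rewrite ptsS => /mapP[i _ ->]; exists i.
  have := generic_net_traces a_inj d_gt0 Sin vd nc spread n_large.
  move=> /leq_trans; apply; rewrite leq_mul2l; apply/orP; right.
  by apply: subset_leq_card; rewrite ptsS; apply: traces_over_map.
have := double_count (@traces_le nd) over => h.
have n_gt0 : (0 < n)%N by apply: leq_trans n_large; rewrite muln_gt0 expn_gt0 d_gt0.
(* Here K + 1 = D d - 2, which is at least d: the tuples contribute n^K and the curves through each
   of them one more factor n. *)
have le1 : (n ^ d <= n ^ K.+1)%N.
  rewrite leq_pexp2l //; have := D2E d; rewrite -size_cs -/K.
  by move: d_gt0; case: d => // d' _; nia.
have le2 : (n ^ K <= C2 ^ K * w ^ K)%N by rewrite -expnMn; elim: K {T cT over h le1} => // k IH; rewrite !expnS leq_mul.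
apply: leq_trans le1 _; rewrite expnSr.
apply: (@leq_trans (C2 ^ K * #|T| * n)); first by rewrite leq_mul2r (leq_trans le2) ?orbT // leq_mul2l cT orbT.
move: h; move: (C2 ^ K)%N (d ^ 2)%N (nd ^ K)%N #|T| #|traces _ _ _| => p q r s t h.
by rewrite -mulnA -[leqRHS]mulnA -mulnA leq_mul2l; apply/orP; right; lia.
Qed.

End GenericCase.
End Spread.

(** * Irreducible curves rich in points *)

Section Sources.
Variable R : realType.
Local Notation P := {mpoly R[2]}.
Local Notation point := (point R).
Implicit Types (f g h : P) (xs : seq P).

Fixpoint unrelated xs : Prop :=
  if xs is h :: ys then (forall g, g \in ys -> ~ rdvd h g /\ ~ rdvd g h) /\ unrelated ys
  else True.

Lemma unrelated_nth xs i j : unrelated xs -> (i < size xs)%N -> (j < size xs)%N -> i != j ->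
  ~ rdvd (nth 0 xs i) (nth 0 xs j).
Proof.
elim: xs i j => [|h ys IH] [|i] [|j] //= [un uys] hi hj ne.
- by have [] := un _ (mem_nth 0 hj).
- by have [] := un _ (mem_nth 0 hi).
- exact: IH.
Qed.

Lemma irr_rdvd_assoc h g z : irr h -> irr g -> rdvd h g -> (ev2 h z == 0) = (ev2 g z == 0).
Proof.
move=> irr_h irr_g [q eg]; have [_ _ /(_ _ _ eg)[uq|uh]] := irr_g; last by case: irr_h => _ /negP.
by rewrite eg ev2M mulf_eq0 (negPf (unit_ev2 z uq)).
Qed.

Lemma deg_prod_seq xs : (forall h, h \in xs -> h != 0) ->
  \prod_(h <- xs) h != 0 /\ deg (\prod_(h <- xs) h) = sumn (map (@deg R) xs).
Proof.
elim: xs => [|h xs IH] nz; first by rewrite big_nil oner_eq0 /deg msize1.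
have [|p0 dp] := IH; first by move=> g gx; apply: nz; rewrite inE gx orbT.
have h0 : h != 0 by apply: nz; rewrite mem_head.
by rewrite big_cons mulf_neq0 // degM // dp.
Qed.

Variables (n d : nat) (a : 'I_n -> point).
Hypothesis a_inj : injective a.
Variables (M Q : nat).
Hypothesis d_gt0 : (0 < d)%N.
Hypothesis spread : forall f, f != 0 -> (deg f <= d)%N ->
  (n < M * #|[set i | ev2 f (a i) != 0%R]|)%N.

Definition off xs := [set i | all (fun h => ev2 h (a i) != 0) xs].

Definition rich h := (n < d * Q * #|[set i | ev2 h (a i) == 0%R]|)%N.

Lemma off_prod xs : off xs = [set i | ev2 (\prod_(h <- xs) h) (a i) != 0].
Proof.
apply/setP => i; rewrite !inE ev2_prod.
elim: xs => [|h xs IH]; first by rewrite big_nil oner_eq0.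
by rewrite big_cons /= IH mulf_eq0 negb_or.
Qed.

(** Greedy choice: if a curve of degree at most [d] holds more than n/Q of the points off the curves
    found so far, one of its factors is rich, and it is new because it has a zero off the others.
    For j = d + 1, either the total degree exceeds [d] or the remaining points are well spread over
    the plane. *)
Lemma rich_curves j : (j <= d.+1)%N -> exists xs,
  [/\ forall h, h \in xs -> [/\ irr h, (deg h <= d)%N & rich h], unrelated xs, (size xs <= j)%N &
   (j <= sumn (map (@deg R) xs))%N \/ ((sumn (map (@deg R) xs) <= d)%N /\
     forall f, f != 0 -> (deg f <= d)%N -> (Q * #|[set i in off xs | ev2 f (a i) == 0%R]| <= n)%N)].
Proof.
elim: j => [|j IH] le_j; first by exists [::]; split=> //; left.
have [xs [h1 h2 h3 h4]] := IH (ltnW le_j).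
have [big|small] := leqP j.+1 (sumn (map (@deg R) xs)).
  by exists xs; split=> //; [exact: leqW|left].
case: h4 => [h4|h4]; last by exists xs; split=> //; [exact: leqW|right].
have [pl|] := pselect (forall f, f != 0 -> (deg f <= d)%N ->
    (Q * #|[set i in off xs | ev2 f (a i) == 0%R]| <= n)%N).
  exists xs; split=> //; first exact: leqW.
  by right; split=> //; apply: leq_trans (ltnSE small) (ltnSE le_j).
move=> /existsNP[f /not_implyP[f0 /not_implyP[df /negP]]]; rewrite -ltnNge => big.
set X := [set i in off xs | ev2 f (a i) == 0%R] in big.
have X0 : X != set0.
  by rewrite -card_gt0; move: big; case: #|X| => //; rewrite muln0.
have fX i : i \in X -> ev2 f (a i) = 0 by rewrite inE => /andP[_ /eqP].
have [h [irr_h dh le_h]] := rich_factor f0 df X0 fX.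
have [i0] : exists i, i \in [set i in X | ev2 h (a i) == 0%R].
  apply/set0Pn; rewrite -card_gt0.
  rewrite lt0n; apply/eqP => e; move: le_h; rewrite e muln0 leqn0 => /eqP e'.
  by move: X0; rewrite -card_gt0 e'.
rewrite inE => /andP[]; rewrite inE => /andP[ioff _] hi0.
exists (h :: xs); split=> //.
- move=> g; rewrite inE => /orP[/eqP ->|/h1//]; split=> //.
  rewrite /rich; apply: leq_trans big _; rewrite [(d * Q)%N]mulnC -mulnA leq_mul2l; apply/orP; right.
  apply: leq_trans le_h _; rewrite leq_mul2l; apply/orP; right.
  by apply: subset_leq_card; apply/subsetP => i; rewrite !inE => /andP[_ ->].
- split=> // g gx; have [irr_g _ _] := h1 g gx.
  have gi0 : ev2 g (a i0) != 0 by move: ioff; rewrite inE => /allP; apply.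
  by split=> dv; [have := irr_rdvd_assoc (a i0) irr_h irr_g dv
    |have := irr_rdvd_assoc (a i0) irr_g irr_h dv]; rewrite hi0 (negPf gi0).
- by left => /=; have := irr_deg irr_h; lia.
Qed.

End Sources.

(* how many of the chosen points may lie on a source curve, per unit of its degree *)
Definition cap (d : nat) : nat := if d == 3%N then 2%N else (d + 3)./2.

(** This is the [balanced] condition. For d = 3 the general value (d + 3)/2 = 3 would fail at e = 1,
    as 3 + 2 + D 2 = 11 while D 3 = 10; hence the exceptional value 2. *)
Lemma cap_small d e : d != 2%N -> (0 < e)%N -> (e < d)%N ->
  (e * cap d + 2 + D (d - e) <= D d)%N.
Proof.
move=> d2 e0 ed; have := D_split (d - e) e; rewrite subnK ?(ltnW ed) // => h.
have he := D2E e; set m := (d - e)%N in h *.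
have m0 : (0 < m)%N by rewrite /m subn_gt0.
have ed' : d = (m + e)%N by rewrite /m subnK // ltnW.
clearbody m.
suff : (2 * (e * cap d) + 4 <= 2 * (m * e) + e * (e + 3))%N.
  move: h he; move: (D d) (D m) (D e) (e * cap d)%N (m * e)%N => p q r s t h he h'.
  by move: he h'; rewrite mulSn !mulnS mulnDr; lia.
have em : (e + m <= e * m + 1)%N.
  by clear -e0 m0; case: e e0 => // e _; case: m m0 => // m _; rewrite mulSn mulnS; lia.
rewrite /cap; case: eqP => d3.
  have : (e = 1 /\ m = 2 \/ e = 2 /\ m = 1)%N by lia.
  by case=> -[-> ->].
have [d4|d4] := eqVneq d 4.
  have : ((e = 1 /\ m = 3) \/ (e = 2 /\ m = 2) \/ (e = 3 /\ m = 1))%N by lia.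
  by rewrite d4 => -[[-> ->]|[[-> ->]|[-> ->]]].
have d5 : (4 <= e * m)%N by lia.
have c2 : (2 * ((d + 3)./2) <= d + 3)%N by have := odd_double_half (d + 3); lia.
apply: (@leq_trans (e * (d + 3) + 4)).
  by rewrite leq_add2r mulnCA leq_mul2l c2 orbT.
by rewrite ed' !mulnDr [(m * e)%N]mulnC; lia.
Qed.

Lemma cap_large d E : d != 2%N -> (d < E)%N -> (D d <= E * cap d + 3)%N.
Proof.
move=> d2 dE; have h := D2E d.
apply: (@leq_trans (d.+1 * cap d + 3)); last by rewrite leq_add2r leq_mul2r dE orbT.
rewrite /cap; case: eqP => [e3|d3]; first by rewrite e3 in h *; lia.
have [d0|d0] := eqVneq d 0%N; first by rewrite d0 in h *; lia.
have [d1|d1] := eqVneq d 1%N; first by rewrite d1 in h *; lia.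
have c2 : (d + 2 <= 2 * ((d + 3)./2))%N by have := odd_double_half (d + 3); case: odd => /=; lia.
have := leq_mul (leqnn d.+1) c2; rewrite mulnCA -addn2; move: h; rewrite addn2 => h; lia.
Qed.

Lemma leq_sum5 p q r s t :
  [/\ p <= p + q + r + s + t, q <= p + q + r + s + t, r <= p + q + r + s + t,
      s <= p + q + r + s + t & t <= p + q + r + s + t]%N.
Proof. by split; lia. Qed.

Section SpreadCase.
Variables (d M : nat).
Hypothesis d_gt0 : (0 < d)%N.
Hypothesis d_ne2 : d != 2%N.

Let K := (D d - 3)%N.
(** [B] bounds the number of bad events in one generic step: at most d + 1 curves, and a single base
    set with 2^K subsequences and d + 1 degrees. With [Q] as chosen next, B n/Q is at most n/(2M),
    half of the guaranteed number of points off a curve. *)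
Let B := (d.+1 + 2 ^ K * d.+1)%N.
Let Q := (2 * M * B)%N.
Let nd := (2 * d ^ 2 + 3 - D d)%N.
Let N1 := ((2 * M) ^ K * (12 * d ^ 2) * nd ^ K)%N.
Let N2 := ((4 * d * Q) ^ K * (12 * d ^ 2) * nd ^ K)%N.

Lemma KD : (K + 3 = D d)%N.
Proof. by rewrite /K; have := D2E d; move: d_gt0; case: d => // d' _; nia. Qed.

Theorem spread_case : exists C, forall (R : realType) n (a : 'I_n -> point R),
  injective a -> (C <= n)%N ->
  (forall f : {mpoly R[2]}, f != 0 -> (deg f <= d)%N ->
     (n < M * #|[set i | ev2 f (a i) != 0%R]|)%N) ->
  (n ^ d <= C * #|traces d a nd|)%N.
Proof.
exists (6 * d ^ 2 + M * d ^ 2 + (2 * d * Q * (B * d ^ 2) + 2 * d * Q) + N1 + N2)%N.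
have [] := leq_sum5 (6 * d ^ 2) (M * d ^ 2) (2 * d * Q * (B * d ^ 2) + 2 * d * Q) N1 N2.
set C := (_ + N2)%N => c1 c2 c3 le_C1 le_C2 R n a a_inj n_ge spread.
have n_large := leq_trans c1 n_ge; have n_large2 := leq_trans c2 n_ge.
have n_large3 := leq_trans c3 n_ge.
have M_gt0 : (0 < M)%N.
  by have := spread 1 (oner_neq0 _); rewrite {1}/deg msize1 => /(_ isT); case: (M).
have B_gt0 : (0 < B)%N by rewrite /B addn_gt0.
have Q_gt0 : (0 < Q)%N by rewrite /Q !muln_gt0 M_gt0 B_gt0.
have sp f : f != 0 -> (deg f <= d)%N -> (d ^ 2 < #|[set i | ev2 f (a i) != 0%R]|)%N.
  by move=> f0 df; have := leq_ltn_trans n_large2 (spread f f0 df); rewrite ltn_pmul2l.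
have [xs [xsP un sz [big|[small plane]]]] := rich_curves a Q d_gt0 (leqnn d.+1).
  pose C' : finType := 'I_(size xs).
  pose x (c : C') := nth 0 xs c; have xin (c : C') : x c \in xs by apply: mem_nth.
  pose src (c : C') := [set i | ev2 (x c) (a i) == 0].
  pose w := (n %/ (2 * d * Q))%N.
  (* Each curve may receive [cap d] points per unit of degree. As the total degree exceeds [d] there
     are at least [K] such places, and truncation preserves the upper bounds needed for
     [balanced]. *)
  pose cs := take K (flatten [seq nseq (deg (x c) * cap d) c | c <- index_enum C']).
  have szcs : size cs = K.
    rewrite size_takel // size_nseqs -big_distrl /=.
    have -> : (\sum_c deg (x c) = sumn (map (@deg R) xs))%N.
      by rewrite sumnE big_map (big_nth 0) big_mkord.
    by have := cap_large d_ne2 big; rewrite -KD leq_add2r.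
  apply: (@leq_trans (N2 * #|traces d a nd|)); last by rewrite leq_mul2r le_C2 orbT.
  have := @generic_case R n d a a_inj C' x (d ^ 2) w (4 * d * Q) src cs d_ne2 d_gt0 sp n_large.
  rewrite szcs; apply.
  - by move=> c i; rewrite inE => /eqP.
  - move=> c f df nd0; have [irr_x dx _] := xsP _ (xin c).
    exact: irr_few_zeros.
  - by move=> c; have [] := xsP _ (xin c).
  - by move=> c _; have [] := xsP _ (xin c).
  - by move=> c c' ne; apply: unrelated_nth => //; rewrite eq_sym.
  - move=> c _; have [_ _] := xsP _ (xin c); rewrite /rich => rc.
    have le1 : (w + (#|C'| + 2 ^ K * d.+1) * d ^ 2 <= w + B * d ^ 2)%N.
      by rewrite leq_add2l leq_mul2r /B leq_add2r card_ord sz orbT.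
    apply: leq_trans le1 _; have dQ : (0 < d * Q)%N by rewrite muln_gt0 d_gt0 Q_gt0.
    rewrite -(leq_pmul2l dQ).
    apply: leq_trans (ltnW rc).
    have := leq_divM n (2 * d * Q); rewrite -/w.
    move: n_large3; rewrite mulnDr [(w * _)%N]mulnC -!mulnA; move: (B * (d ^ 2))%N => b.
    rewrite !mulnA -!(mulnA 2); move: (d * Q * b)%N (d * Q * w)%N (d * Q)%N; clear; lia.
  - by rewrite KD.
  - move=> I [c cI] _ dI.
    have x0 c' : x c' != 0 by have [/irr_neq0] := xsP _ (xin c').
    have dxI : deg (xI x I) = (\sum_(c in I) deg (x c))%N by exact: deg_prod.
    have e_gt0 : (0 < deg (xI x I))%N.
      have [/irr_deg h _ _] := xsP _ (xin c).
      by rewrite dxI (bigD1 c) //= addn_gt0 h.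
    have cnt : (count (fun c => c \in I) cs <= deg (xI x I) * cap d)%N.
      have le1 (l : seq C') : (count (fun c => c \in I) (take K l) <= count (fun c => c \in I) l)%N.
        by rewrite -[X in (_ <= count _ X)%N](cat_take_drop K) count_cat leq_addr.
      by apply: leq_trans (le1 _) _; rewrite count_nseqs dxI big_distrl.
    have [lt_ed|ge_ed] := ltnP (deg (xI x I)) d.
      by apply: leq_trans (cap_small d_ne2 e_gt0 lt_ed); rewrite !leq_add2r.
    have -> : deg (xI x I) = d by apply/eqP; rewrite eqn_leq dI.
    rewrite subnn D_0 -addnA -KD leq_add2r -szcs; exact: count_size.
  - have Q0 : (0 < 2 * d * Q)%N by rewrite muln_gt0 muln_gt0 d_gt0 Q_gt0.
    have w_gt0 : (0 < w)%N.
      by rewrite /w divn_gt0 //; apply: leq_trans n_large3; rewrite leq_addl.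
    apply: leq_trans (ltnW (ltn_ceil n Q0)) _; rewrite -/w mulnC.
    rewrite (_ : 4 * d * Q * w = 2 * d * Q * (2 * w))%N; last by rewrite !mulnA; lia.
    by rewrite leq_mul2l; apply/orP; right; lia.
(* A single color with zero polynomial stands for the plane: being divisible by 0 means being 0. *)
pose x (c : unit) : {mpoly R[2]} := 0.
pose src (c : unit) := off a xs.
pose z := (n %/ Q)%N.
pose w := (#|off a xs| - (1 + 2 ^ K * d.+1) * z)%N.
have A0 : (n < M * #|off a xs|)%N.
  have [p0 dp] := deg_prod_seq (fun h hx => (let: And3 i _ _ := xsP h hx in irr_neq0 i)).
  by rewrite off_prod; apply: spread; rewrite ?dp.
have zQ : (z * Q <= n)%N by apply: leq_divM.
have le_BQ : (2 * M * ((1 + 2 ^ K * d.+1) * z) <= n)%N.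
  apply: leq_trans zQ; rewrite mulnA [leqRHS]mulnC leq_mul2r /Q leq_mul2l /B.
  by rewrite leq_add2r ltnS leq0n !orbT.
apply: (@leq_trans (N1 * #|traces d a nd|)); last by rewrite leq_mul2r le_C1 orbT.
have := @generic_case R n d a a_inj unit x z w (2 * M) src (nseq K tt) d_ne2 d_gt0 sp n_large.
rewrite size_nseq; apply.
- by move=> c i _; rewrite /x ev2_0.
- move=> c f df nd0; rewrite /z leq_divRL // mulnC; apply: plane => //.
  by apply/eqP => f0; apply: nd0; rewrite f0 /x; exists 0; rewrite mul0r.
- by move=> c; rewrite /x /deg msize0.
- by move=> c; rewrite eqxx.
- by move=> [] [].
- move=> c _; rewrite card_unit /w subnK //.
  by rewrite -(@leq_pmul2l (2 * M)) ?muln_gt0 ?M_gt0 //; apply: leq_trans le_BQ _; rewrite -mulnA;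
    move: A0; clear; move: (M * _)%N => u; lia.
- by rewrite KD.
- by move=> I [c cI] /(_ c cI); rewrite eqxx.
- rewrite /w mulnBr -[(2 * M * #|_|)%N]mulnA; move: A0 le_BQ; clear.
  move: (M * #|_|)%N (2 * M * _)%N => p q; lia.
Qed.

End SpreadCase.

(** * Points concentrated on a curve *)

Section Bases.
Variable R : realType.
Local Notation P := {mpoly R[2]}.
Local Notation point := (point R).
Implicit Types (f g h p : P) (T X : seq point).

Lemma basis_points k X : exists T, [/\ subseq T X, forall p, V k T p -> V k X p &
  (vdim k T + size T = D k)%N].
Proof.
elim: X => [|s X [T [sub gen ind]]]; first by exists [::]; rewrite vdim_nil addn0.
have [h|/existsNP[p /not_implyP[Vp /eqP ps]]] := pselect (forall p, V k T p -> ev2 p s = 0).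
  exists T; split=> //; first exact: subseq_trans (subseq_cons _ _).
  by move=> p Vp; rewrite V_cons h // eqxx gen.
exists (s :: T); split=> /=; first by rewrite eqxx.
  by move=> q; rewrite !V_cons => /andP[-> /gen].
by rewrite addnS -addSn -(vdim_cons_lt Vp ps).
Qed.

Lemma indep_up k k' T : (k <= k')%N -> (vdim k T + size T = D k)%N ->
  (vdim k' T + size T = D k')%N.
Proof.
move=> le_k; elim: T => [|s T IH] /= e; first by rewrite vdim_nil addn0.
have h1 := vdim_cons_le k s T; have h2 := vdim_size k T.
have [h|/existsNP[p /not_implyP[Vp /eqP ps]]] := pselect (forall p, V k T p -> ev2 p s = 0).
  by move: e; rewrite (vdim_cons_eq h); lia.
by rewrite addnS -addSn -(vdim_cons_lt (V_deg le_k Vp) ps) IH //; lia.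
Qed.

(** Shows that a further point costs an independent condition as soon as the degree exceeds [k]. The
    Lagrange polynomials of [T] sum to 1, so one of them does not vanish at [t]. *)
Lemma basis_cut_out k T t : uniq T -> vdim k T = 0%N -> size T = D k -> t \notin T ->
  exists2 p, V k.+1 T p & ev2 p t != 0.
Proof.
move=> uT v0 sT tT.
have lag s : s \in T -> exists g, [/\ (deg g <= k)%N, ev2 g s = 1 &
    forall s', s' \in T -> s' != s -> ev2 g s' = 0].
  move=> sin; have pos : (0 < vdim k (rem s T))%N.
    by have := vdim_size k (rem s T); rewrite size_rem // sT; have := D2E k; lia.
  have /vdim_gt0P[g /andP[dg /vanishP vg] g0] := pos.
  have g1 s' : s' \in T -> s' != s -> ev2 g s' = 0.
    by move=> s'T ne; apply: vg; rewrite mem_rem_uniq // inE ne.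
  have gs : ev2 g s != 0.
    apply: contra g0 => /eqP gs; apply/eqP; apply: (vdim_eq0 v0).
    apply/andP; split=> //; apply/vanishP => s' s'T.
    by have [->//|] := eqVneq s' s; apply: g1.
  exists ((ev2 g s)^-1 *: g); split.
  - exact: leq_trans (degZ_le _ _) _.
  - by rewrite ev2Z mulVf.
  - by move=> s' s'T ne; rewrite ev2Z (g1 s') // mulr0.
have /choice[G hG] : forall s, exists g, s \in T -> [/\ (deg g <= k)%N, ev2 g s = 1 &
    forall s', s' \in T -> s' != s -> ev2 g s' = 0].
  move=> s; have [sT'|nsT] := boolP (s \in T); last by exists 0.
  by have [g hg] := lag s sT'; exists g.
pose f := 1 - \sum_(s <- T) G s.
have degS (S : seq point) : {subset S <= T} -> (deg (\sum_(s <- S) G s) <= k)%N.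
  elim: S => [|s S IH] sub; first by rewrite big_nil /deg msize0.
  rewrite big_cons; apply: degD_le; first by have [] := hG s (sub s (mem_head _ _)).
  by apply: IH => s' s'S; apply: sub; rewrite inE s'S orbT.
have f0 : f = 0.
  apply: (vdim_eq0 v0); apply/andP; split.
    rewrite /f -scaleN1r; apply: degD_le; first by rewrite /deg msize1.
    by apply: leq_trans (degZ_le _ _) _; apply: degS.
  apply/vanishP => s sin; rewrite /f ev2B ev2_1 ev2_sum (bigD1_seq s) //=.
  have [_ -> _] := hG s sin; rewrite big_seq_cond big1 ?addr0 ?subrr // => s' /andP[s'T ne].
  by have [_ _] := hG s' s'T; apply=> //; rewrite eq_sym.
have [s sin gt] : exists2 s, s \in T & ev2 (G s) t != 0.
  apply: contrapT => no; have : ev2 f t = 0 by rewrite f0 ev2_0.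
  rewrite /f ev2B ev2_1 ev2_sum big_seq big1 ?subr0 => [/eqP|s sin]; first by rewrite oner_eq0.
  by apply/eqP; apply: contraT => ne; case: no; exists s.
(* multiply a Lagrange polynomial not vanishing at [t] by a line through its node *)
have nst : s != t by apply: contraNneq tT => <-.
have [l [dl ls lt]] := line_sep nst; have [dg gs g0] := hG s sin.
exists (l * G s); last by rewrite ev2M mulf_neq0.
apply/andP; split; first by rewrite -[k.+1]add1n; apply: degM_le.
apply/vanishP => s' s'T; rewrite ev2M; have [->|ne] := eqVneq s' s; first by rewrite ls mul0r.
by rewrite g0 // mulr0.
Qed.

End Bases.

(** * Distributing the points among the components *)

Section Budget.
Variables (r d : nat) (e : 'I_r -> nat).
Hypothesis e_gt0 : forall c, (0 < e c)%N.
Hypothesis e_le : (\sum_c e c <= d)%N.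
Local Open Scope nat_scope.

Let before (c : 'I_r) := \sum_(c' : 'I_r | (c' < c)) e c'.

(* number of points to pick on the component [c]: the increments of [e |-> D d - D (d - e)],
   one fewer on the first component *)
Definition budget (c : 'I_r) : nat :=
  D (d - before c) - D (d - before c - e c) - (c == 0 :> nat).

Lemma before_le c : before c + e c <= d.
Proof.
apply: leq_trans e_le; rewrite /before [leqRHS](bigID (fun c' : 'I_r => c' < c)) /= leq_add2l.
by rewrite (bigD1 c) ?ltnn //= leq_addr.
Qed.

Lemma budgetE c : budget c + (c == 0 :> nat) + 1 = D (e c) + (d - before c - e c) * e c.
Proof.
have := before_le c => h; rewrite /budget.
have := D_split (d - before c - e c) (e c); rewrite subnK; last by lia.
move=> hD; have := D2E (e c); have := e_gt0 c; case: (c == 0 :> nat) => /=; nia.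
Qed.

(** Concavity of [e |-> D d - D (d - e)]: an increment only grows when some earlier components are
    left out. Removing the last component of [I] gives the induction. The spare 1 comes from a
    singleton: the first component has one point fewer, and any other has a nonzero degree before
    it. *)
Lemma budget_le (I : {set 'I_r}) : I != set0 ->
  \sum_(c in I) budget c + 1 + D (d - \sum_(c in I) e c) <= D d.
Proof.
have [m] := ubnP #|I|; elim: m I => // m IHm I; rewrite ltnS => cI I0.
have [i0 i0I] := set0Pn _ I0.
have [c cin cmax] : exists2 c, c \in I & forall c', c' \in I -> c' <= c.
  by have [c cI' h] := arg_maxnP (fun c : 'I_r => c : nat) i0I; exists c.
have eI (F : 'I_r -> nat) : \sum_(c in I) F c = F c + \sum_(c' in I :\ c) F c'.
  by rewrite (big_setD1 c).
have hb := before_le c; have hE := budgetE c.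
have rest : \sum_(c' in I :\ c) e c' <= before c.
  rewrite /before [leqRHS](bigID (mem I)) /=.
  apply: leq_trans (leq_addr _ _); apply: eq_leq; apply: eq_bigl => c'.
  rewrite !inE andbC; have [c'I|] := boolP (c' \in I); last by rewrite andbF.
  by rewrite andbT ltn_neqAle (cmax c' c'I) andbT.
have hS := D_split (d - \sum_(c' in I :\ c) e c' - e c) (e c).
rewrite subnK in hS; last by lia.
rewrite !eI subnDA [d - e c - _]subnAC.
have [I'0|I'n] := eqVneq (I :\ c) set0.
  rewrite I'0 !big_set0 subn0 addn0 in hS *.
  have : (c == 0 :> nat) || (0 < before c).
    have [c0|c0] := posnP c; first by [].
    have r_gt0 : 0 < r by apply: leq_ltn_trans (ltn_ord c).
    by rewrite /before (bigD1 (Ordinal r_gt0)) //= addn_gt0 e_gt0.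
  have := e_gt0 c; move: hE hS hb; clear; move: (budget c) (before c) (e c) => q b ec hE hS hb ec_gt0.
  case: (c == 0 :> nat) hE => /= hE.
    move=> _; have : (d - b - ec) * ec <= (d - ec) * ec by rewrite leq_mul2r; lia.
    by move: hS hE; clear; lia.
  move=> b_gt0; have : (d - b - ec).+1 * ec <= (d - ec) * ec by rewrite leq_mul2r; lia.
  by rewrite mulSn; move: hS hE ec_gt0; clear; lia.
have := IHm (I :\ c) _ I'n; rewrite (cardsD1 c) cin in cI => /(_ cI) IH.
move: IH hE hS rest hb.
move: (\sum_(_ in _ :\ c) budget _) (\sum_(_ in _ :\ c) e _) (budget c) (before c) (e c) => Q s q b ec.
move=> IH hE hS rest hb; have : (d - b - ec) * ec <= (d - s - ec) * ec by rewrite leq_mul2r; lia.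
by move: IH hE hS; clear; lia.
Qed.

Lemma budget_sum : 0 < r -> \sum_c budget c + 1 + D (d - \sum_c e c) = D d.
Proof.
move=> r_gt0.
have step m : m <= r -> \sum_(c : 'I_r | c < m) budget c + (0 < m) +
    D (d - \sum_(c : 'I_r | c < m) e c) = D d.
  elim: m => [|m IH] lt_m; first by rewrite !big_pred0 // subn0.
  pose c := Ordinal lt_m.
  have split (F : 'I_r -> nat) : \sum_(c' : 'I_r | c' < m.+1) F c' = F c + \sum_(c' : 'I_r | c' < m) F c'.
    rewrite (bigD1 c) //=; congr (_ + _); apply: eq_bigl => c'.
    by rewrite ltnS [RHS]ltn_neqAle andbC.
  rewrite !split; have := IH (ltnW lt_m); have := budgetE c; have := before_le c.
  have := D_split (d - before c - e c) (e c); rewrite subnK; last by have := before_le c; lia.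
  rewrite /before /= => hS hb hE IH'.
  have -> : d - (e c + \sum_(c' : 'I_r | c' < m) e c') = d - \sum_(c' : 'I_r | c' < m) e c' - e c by lia.
  move: hS hb hE IH'; case: (m) => [|m'] /=; lia.
have := step r (leqnn r); rewrite r_gt0.
have all_lt (F : 'I_r -> nat) : \sum_(c : 'I_r | c < r) F c = \sum_c F c.
  by apply: eq_bigl => c; rewrite ltn_ord.
by rewrite !all_lt.
Qed.

End Budget.

Section Factors.
Variable R : realType.
Local Notation P := {mpoly R[2]}.
Implicit Types (f g h p : P) (xs : seq P).

Lemma irr_factorization f : f != 0 -> exists xs, (forall h, h \in xs -> irr h) /\
  exists2 u, u \is a GRing.unit & f = u * \prod_(h <- xs) h.
Proof.
have [m le] := ubnP (deg f); elim: m f le => // m IHm f le f0.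
have [d0|d_gt0] := posnP (deg f).
  by exists [::]; split=> //; exists f; rewrite ?unitE_deg ?d0 // big_nil mulr1.
have [h irr_h [q eq_f]] := irr_factor d_gt0.
have q0 : q != 0 by apply: contraNneq f0 => q0; rewrite eq_f q0 mul0r.
have [|xs [hxs [u uu eq_q]]] := IHm q _ q0.
  by have := irr_deg irr_h; move: le; rewrite eq_f (degM q0 (irr_neq0 irr_h)); lia.
exists (h :: xs); split; first by move=> g; rewrite inE => /orP[/eqP ->|/hxs].
by exists u => //; rewrite big_cons eq_f eq_q; ring.
Qed.

Variables (n : nat) (a : 'I_n -> point R).
Definition nonzeros f := [set i | ev2 f (a i) != 0].

(** The number of points allowed off the curve drops by a factor [M] with each degree. For a curve
    of minimal degree e, deleting a component leaves more than n/M^e points off, while at most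
    n/M^(e+1) were off before; the difference lies on that component. A repeated factor could be
    deleted without changing the zeros. *)
Lemma minimal_curve M f : (2 <= M)%N -> (0 < n)%N -> f != 0 ->
  (#|nonzeros f| * M ^ (deg f).+1 <= n)%N ->
  exists r (x : 'I_r -> P), let e := (\sum_c deg (x c))%N in
  [/\ [/\ forall c, irr (x c), (0 < r)%N, (e <= deg f)%N &
      forall c c', c' != c -> ~ rdvd (x c) (x c')],
     (#|nonzeros (\prod_c x c)| * M ^ e.+1 <= n)%N &
     forall c, (n <= 2 * M ^ e * #|[set i | ev2 (x c) (a i) == 0%R]|)%N].
Proof.
move=> M2 n0; have M0 : (0 < M)%N by apply: leq_trans M2.
have [m le] := ubnP (deg f); elim: m f le => // m IHm f le f0 conc.
have [[g [g0 lt_gf concg]]|nmin] := pselect (exists g, [/\ g != 0, (deg g < deg f)%N &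
    (#|nonzeros g| * M ^ (deg g).+1 <= n)%N]).
  have [|r [x [[h1 h2 h3 h4] h5 h6]]] := IHm g _ g0 concg; first by lia.
  by exists r, x; split=> //; split=> //; apply: leq_trans h3 (ltnW lt_gf).
have minf g : g != 0 -> (deg g < deg f)%N -> (n < #|nonzeros g| * M ^ (deg g).+1)%N.
  by move=> g0 lt; rewrite ltnNge; apply/negP => h; apply: nmin; exists g.
have [xs [irr_xs [u uu ef]]] := irr_factorization f0.
pose x (c : 'I_(size xs)) := nth 0 xs c.
have irr_x c : irr (x c) by apply: irr_xs; apply: mem_nth.
have x0 c : x c != 0 := irr_neq0 (irr_x c).
have {}ef : f = u * \prod_c x c by rewrite ef (big_nth 0) big_mkord.
have u0 : u != 0 by apply: contraNneq f0 => u0; rewrite ef u0 mul0r.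
have p0 : \prod_c x c != 0 by apply: contraNneq f0 => p0; rewrite ef p0 mulr0.
have df : deg f = (\sum_c deg (x c))%N.
  rewrite ef degM // deg_prod // -[RHS]add0n; congr (_ + _)%N.
  by apply/eqP; rewrite -unitE_deg.
have nzf : nonzeros f = nonzeros (\prod_c x c).
  by apply/setP => i; rewrite !inE ef ev2M mulf_eq0 (negPf (unit_ev2 _ uu)).
pose rest c := \prod_(c' | c' != c) x c'.
have rest0 c : rest c != 0 by apply/prodf_neq0.
have prodE c : \prod_c x c = x c * rest c by rewrite (bigD1 c).
have drest c : (deg (rest c) < deg f)%N.
  rewrite df /rest deg_prod // [ltnRHS](bigD1 c) //=.
  by have := irr_deg (irr_x c); rewrite -[X in (_ -> X < _)%N]add0n ltn_add2r.
have lpow k l : (k <= l)%N -> (M ^ k <= M ^ l)%N by apply: leq_pexp2l.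
exists (size xs), x; rewrite -df; split; last 1 first.
- move=> c; have := minf _ (rest0 c) (drest c).
  set X := [set i | ev2 (x c) (a i) == 0].
  have le1 : (#|nonzeros (rest c)| <= #|nonzeros f| + #|X|)%N.
    apply: leq_trans (leq_card_setU _ _); apply: subset_leq_card; apply/subsetP => i.
    by rewrite nzf !inE (prodE c) ev2M mulf_eq0 => /negPf ->; rewrite orbF orNb.
  move/leq_trans/(_ (leq_mul le1 (lpow _ _ (drest c)))); rewrite mulnDl.
  move: conc; rewrite expnS; move: (M ^ deg f)%N #|nonzeros f| #|X| M2; clear.
  move=> p s t M2; rewrite mulnCA => conc; have := leq_trans (leq_mul M2 (leqnn (s * p))) conc.
  by rewrite -mulnA [(p * t)%N]mulnC; lia.
- split=> //.
    rewrite lt0n; apply/eqP => xs0; move: conc; have df0 : deg f = 0%N.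
      by rewrite df big1 // => -[c hc]; exfalso; rewrite xs0 in hc.
    have -> : nonzeros f = setT.
      by apply/setP => i; rewrite !inE unit_ev2 // unitE_deg // df0.
    rewrite df0 cardsT card_ord expn1 => h.
    by have := leq_trans (leq_mul (leqnn n) M2) h; lia.
  move=> c c' ne dv; have := minf _ (rest0 c') (drest c').
  have eqz : nonzeros (rest c') = nonzeros f.
    apply/setP => i; rewrite nzf !inE (prodE c') ev2M mulf_eq0.
    have [h|//] := eqVneq (ev2 (x c') (a i)) 0.
    have := irr_rdvd_assoc (a i) (irr_x c) (irr_x c') dv; rewrite h eqxx => /eqP xc.
    rewrite /rest (bigD1 c) 1?eq_sym //= ev2M xc mul0r eqxx //.
  rewrite eqz => /leq_trans/(_ (leq_trans (leq_mul (leqnn _) (lpow _ _ (leqW (drest c')))) conc)).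
  by rewrite ltnn.
- by rewrite -nzf.
Qed.

End Factors.

Ltac lia_atoms := repeat match goal with
  | |- context [vdim ?k ?T] => move: (vdim k T) => ?
  | |- context [D ?k] => move: (D k) => ?
  | |- context [count ?p ?s] => move: (count p s) => ?
  | |- context [size ?s] => move: (size s) => ?
  end; lia.

(** * The unique curve through the basis [T] and the generic points *)

Section OnePencil.
Variable R : realType.
Local Notation P := {mpoly R[2]}.
Local Notation point := (point R).
Variables (r d : nat) (x : 'I_r -> P) (X T : seq point) (S : seq ('I_r * point)).
Implicit Types (I : {set 'I_r}) (f g : P).

Local Notation e c := (deg (x c)).
Local Notation E := (\sum_c deg (x c))%N.
Hypothesis r_gt0 : (0 < r)%N.
Hypothesis x_irr : forall c, irr (x c).
Hypothesis E_le : (E <= d)%N.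
Hypothesis x_X : forall c t, t \in X -> ev2 (x c) t != 0.
Hypothesis T_X : {subset T <= X}.
Hypothesis uniq_T : uniq T.
Hypothesis T_free : vdim (d - E) T = 0%N.
Hypothesis size_T : size T = D (d - E).
Hypothesis gen_S : gen x d (fun T' => T' \in T :: [seq t :: T | t <- X]) S.
Hypothesis count_S : forall I, (count (fun cs => cs.1 \in I) S = \sum_(c in I) budget d (fun c => e c) c)%N.

Let x0 c : x c != 0 := irr_neq0 (x_irr c).
Let e_gt0 c : (0 < e c)%N := irr_deg (x_irr c).

Lemma deg_xI I : deg (xI x I) = (\sum_(c in I) e c)%N.
Proof. exact: deg_prod. Qed.

Lemma deg_xI_le I : (deg (xI x I) <= E)%N.
Proof. by rewrite deg_xI [leqRHS](bigID (mem I)) leq_addr. Qed.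

Lemma size_pts : (size S + 1 + D (d - E) = D d)%N.
Proof.
rewrite -(budget_sum e_gt0 E_le r_gt0); congr (_ + _ + _)%N.
have := count_S setT; rewrite (eq_bigl xpredT) => [<-|c]; last by rewrite inE.
by rewrite -[LHS](count_predT S); apply: eq_count => cs; rewrite /= in_setT.
Qed.

Lemma count_le I : I != set0 ->
  (count (fun cs => cs.1 \in I) S + 1 + D (d - deg (xI x I)) <= D d)%N.
Proof. by move=> I0; rewrite count_S deg_xI budget_le. Qed.

Lemma size_out I : (size (out I S) + count (fun cs => cs.1 \in I) S = size S)%N.
Proof. by rewrite /out size_filter addnC -[RHS](count_predC (fun cs => cs.1 \in I)). Qed.

Lemma vdim_T k : (d - E <= k)%N -> (vdim k T + size T = D k)%N.
Proof. by move=> le; apply: indep_up le _; rewrite T_free size_T. Qed.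

Lemma vdim_tT k t : t \in X -> t \notin T -> (d - E < k)%N ->
  (vdim k (t :: T) + (size T).+1 = D k)%N.
Proof.
move=> tX tT lt; have [p Vp pt] := basis_cut_out uniq_T T_free size_T tT.
by rewrite -(vdim_T (ltnW lt)) (vdim_cons_lt (V_deg lt Vp) pt) addnS addSn.
Qed.

Lemma vdim_one : vdim d (pts S ++ T) = 1%N.
Proof.
have ge1 : (0 < vdim d (pts S ++ T))%N.
  have := vdim_cat_size d (pts S) T; rewrite [size (pts S)]size_map.
  have := vdim_T (leq_subr E d); have := size_pts; rewrite size_T; clear.
  lia_atoms.
case: (generic_structure gen_S (mem_head _ _) (leqnn d)) => [c z /T_X zX _|z|[I [_ _ _ h]]].
- exact: x_X.
- by have /vdim_gt0P[p /z ->] := ge1; rewrite eqxx.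
have := vdim_T (leq_sub2l d (deg_xI_le I)); rewrite size_T.
have := size_out I; have := size_pts; have [I0|/count_le] := eqVneq I set0; last first.
  by move: h ge1; clear; lia_atoms.
move: h ge1; rewrite I0 /xI big_set0 /deg msize1 subn0.
by rewrite count_S big_set0; clear; lia_atoms.
Qed.

(** After division by [x c], the points of other colors still exhaust the quotient space: [count_le]
    for [c |: I] leaves too many of them for a nonzero quotient. *)
Lemma no_component c f : V d (pts S ++ T) f -> f != 0 -> ~ rdvd (x c) f.
Proof.
move=> Vf f0 [g ef]; rewrite ef in Vf.
have g0 : g != 0 by apply: contraNneq f0 => g0; rewrite ef g0 mul0r.
pose S' := out [set c] S.
have Vg : V (d - e c) (pts S' ++ T) g.
  apply: V_div Vf => // s.
    rewrite !mem_cat => /orP[/mapP[cs]|->]; last by rewrite orbT.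
    by rewrite mem_filter => /andP[_ inS] ->; rewrite map_f.
  rewrite mem_cat => /orP[/mapP[[c' s']]|/T_X]; last exact: x_X.
  rewrite mem_filter inE /= => /andP[ne inS ->].
  by have [_] := gen_mem gen_S inS; apply; rewrite eq_sym.
have gen_S' : gen x d (fun T' => T' \in T :: [seq t :: T | t <- X]) S'.
  exact: gen_subseq (filter_subseq _ _) gen_S.
case: (generic_structure gen_S' (mem_head _ _) (leq_subr (e c) d)) => [c' z /T_X zX _|z|[I [hI dI _ h]]].
- exact: x_X.
- by have := z _ Vg; move/eqP: g0.
rewrite -/S' in h hI.
have cI : c \notin I.
  apply/negP => /hI[_ /mapP[cs]]; rewrite mem_filter inE => /andP[ne _] ec.
  by rewrite -ec eqxx in ne.
have exI : deg (xI x (c |: I)) = (e c + deg (xI x I))%N by rewrite !deg_xI big_setU1.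
have ge1 : (0 < vdim (d - e c) (pts S' ++ T))%N by apply/vdim_gt0P; exists g.
have I0 : c |: I != set0 by apply/set0Pn; exists c; rewrite setU11.
have := count_le I0; have := size_out (c |: I); have := size_pts.
have -> : out (c |: I) S = out I S'.
  by rewrite /S' /out -filter_predI; apply: eq_filter => cs /=; rewrite !inE negb_or andbC.
have := vdim_T (leq_sub2l d (deg_xI_le (c |: I))); rewrite size_T exI.
by rewrite subnDA; move: h ge1; clear; lia_atoms.
Qed.

(** [S] is generic for the base set [t :: T] as well. If the fixed components have total degree
    below that of the whole curve, [t] imposes one more condition and no dimension is left;
    otherwise the quotient has degree d - E and vanishes by [T_free]. *)
Lemma no_extra_zero f t : V d (pts S ++ T) f -> f != 0 -> t \in X -> t \notin T -> ev2 f t != 0.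
Proof.
move=> Vf f0 tX tT; apply/eqP => ft.
have Vft : V d (pts S ++ t :: T) f.
  by move: Vf; rewrite !V_cat /= ft eqxx.
have ge1 : (0 < vdim d (pts S ++ t :: T))%N by apply/vdim_gt0P; exists f.
have tTL : t :: T \in T :: [seq t :: T | t <- X] by rewrite inE map_f ?orbT.
case: (generic_structure gen_S tTL (leqnn d)) => [c z|z|[I [_ _ _ h]]].
- by rewrite inE => /orP[/eqP ->|/T_X zX] _; apply: x_X.
- by have := z _ Vft; move/eqP: f0.
have cI : (count (fun cs => cs.1 \in I) S + D (d - deg (xI x I)) <= D d)%N.
  have [->|/count_le] := eqVneq I set0; last by clear; lia_atoms.
  by rewrite count_S big_set0 /xI big_set0 /deg msize1 subn0.
have [lt|ge] := ltnP (d - E) (d - deg (xI x I)).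
  by have := vdim_tT tX tT lt; have := size_out I; have := size_pts; rewrite size_T; move: h cI ge1; clear; lia_atoms.
have eE : (d - deg (xI x I) = d - E)%N by have := deg_xI_le I; lia.
have : (vdim (d - deg (xI x I)) (t :: T) <= vdim (d - E) T)%N.
  by rewrite eE; apply: vdim_sub => s sT; rewrite inE sT orbT.
by rewrite T_free; lia.
Qed.

End OnePencil.

Section Concentrated.
Variable d : nat.
Hypothesis d_gt0 : (0 < d)%N.

Let b := (2 ^ D d * d.+1 * d ^ 2)%N.
(** Each point [t] off the curve adds a base set [t :: T], which excludes at most [b] points of a
    component. The factor 8 keeps these exclusions below a quarter of the component, see
    [source_bound]. *)
Definition conc_ratio := (8 * b)%N.
Local Notation M := conc_ratio.
Let nd := (2 * d ^ 2 + 3 - D d)%N.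
Let N1 := ((8 * M ^ d) ^ D d * nd.+1 ^ D d)%N.

Lemma conc_ratio_gt1 : (1 < M)%N.
Proof. by rewrite /M /b (@leq_trans (8 * 1)) // leq_mul2l /= !muln_gt0 !expn_gt0 d_gt0. Qed.

(** The bound is tight for d = 1, and for d = 2 with either value of [e]. *)
Lemma trace_bound e : (0 < e)%N -> (e <= d)%N -> (D (d - e) + d * e <= nd)%N.
Proof.
move=> e_gt0 le_ed; rewrite /nd -[in leqRHS](subnK le_ed) -[X in (X * e)%N](subnK le_ed).
move: (d - e)%N => k; have := D2E (k + e); have := D2E k; move: (D _) (D _) => u v hu hv.
suff : (u * 2 + v * 2 + 2 * ((k + e) * e) <= 4 * (k + e) ^ 2 + 6)%N by lia.
rewrite -mulnn {}hu {}hv.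
case: e e_gt0 {le_ed} => // -[|e] _; first by have := leq0n k; clear; case: k => // k; nia.
by clear; nia.
Qed.

Lemma source_bound p n s o w q : (0 < p)%N -> (n <= 2 * p * s)%N -> (o * (8 * b * p) <= n)%N ->
  (8 * p * q <= n)%N -> (w * (4 * p) <= n)%N -> (w + (q + o * b) <= s)%N.
Proof.
move=> p0 h1 h2 h3 h4.
have k1 : (2 * w <= s)%N by rewrite -(@leq_pmul2l (2 * p)) ?muln_gt0 ?p0 //; lia.
have k2 : (4 * (o * b) <= s)%N.
  rewrite -(@leq_pmul2l (2 * p)) ?muln_gt0 ?p0 //; apply: leq_trans h1; apply: leq_trans h2.
  by move: (o) (b) (p); clear; lia.
have k3 : (4 * q <= s)%N by rewrite -(@leq_pmul2l (2 * p)) ?muln_gt0 ?p0 //; lia.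
by move: k1 k2 k3; clear; lia.
Qed.

Theorem concentrated_case : exists C, forall (R : realType) n (a : 'I_n -> point R),
  injective a -> (C <= n)%N ->
  (forall f : {mpoly R[2]}, f != 0 -> (deg f <= d)%N -> exists i, ev2 f (a i) != 0) ->
  (exists f : {mpoly R[2]}, [/\ f != 0, (deg f <= d)%N &
     (#|nonzeros a f| * M ^ (deg f).+1 <= n)%N]) ->
  (n ^ d <= C * #|traces d a nd|)%N.
Proof.
pose q := (d * d ^ 2 + b)%N.
exists (8 * M ^ d * q + 4 * M ^ d + N1)%N => R n a a_inj n_ge not_on [f [f0 df conc]].
have M_gt0 : (0 < M)%N by apply: ltnW conc_ratio_gt1.
have [n1 n2 n3] : [/\ (8 * M ^ d * q <= n)%N, (4 * M ^ d <= n)%N & (0 < n)%N].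
  have : (0 < M ^ d)%N by rewrite expn_gt0 M_gt0.
  by move: n_ge; clear; move: (8 * M ^ d * q)%N N1 (M ^ d)%N => u v p; split; lia.
have [r [x /= [[x_irr r_gt0 e_le x_dist] off_le rich]]] := minimal_curve conc_ratio_gt1 n3 f0 conc.
set e := (\sum_c deg (x c))%N in off_le rich e_le.
have {}e_le : (e <= d)%N by apply: leq_trans e_le df.
have e_gt0 : (0 < e)%N.
  by rewrite /e (bigD1 (Ordinal r_gt0)) //= addn_gt0 irr_deg.
have x0 c : x c != 0 := irr_neq0 (x_irr c).
have ec_le c : (deg (x c) <= d)%N by apply: leq_trans e_le; rewrite /e (bigD1 c) //= leq_addr.
have r_le : (r <= d)%N.
  apply: leq_trans e_le; rewrite -[leqLHS]card_ord -sum1_card; apply: leq_sum => c _.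
  exact: irr_deg.
set y := \prod_c x c in off_le.
have y0 : y != 0 by apply/prodf_neq0.
have dy : deg y = e by apply: deg_prod.
pose X := map a (enum (nonzeros a y)).
have [T [subT genT indT]] := basis_points (d - e) X.
have uX : uniq X by rewrite map_inj_uniq // enum_uniq.
have uT : uniq T := subseq_uniq subT uX.
have TX : {subset T <= X} := mem_subseq subT.
have yX i : a i \in X = (ev2 y (a i) != 0) by rewrite mem_map // mem_enum inE.
(* A polynomial of degree d - e vanishing on [T] vanishes on [X]; its product with [y] would then
   have degree at most [d] and contain all points. *)
have T_free : vdim (d - e) T = 0%N.
  apply/eqP; rewrite -leqn0 leqNgt; apply/negP => /vdim_gt0P[p /genT /andP[dp /vanishP vp] p0].
  have [||i] := not_on (p * y); first by rewrite mulf_neq0.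
    by rewrite degM // dy -(subnK e_le) leq_add2r.
  by rewrite ev2M mulf_eq0 negb_or -yX => /andP[/eqP pi /vp].
have size_T : size T = D (d - e) by rewrite -indT T_free.
have x_X c t : t \in X -> ev2 (x c) t != 0.
  move=> /mapP[i]; rewrite mem_enum inE => yi ->; apply: contra yi => /eqP xi.
  by rewrite /y (bigD1 c) //= ev2M xi mul0r.
pose bud := budget d (fun c => deg (x c)).
pose cs := flatten [seq nseq (bud c) c | c <- index_enum 'I_r].
have count_cs (I : {set 'I_r}) : (count (fun c => c \in I) cs = \sum_(c in I) bud c)%N.
  exact: count_nseqs.
have size_cs : (size cs + 1 + D (d - e) = D d)%N.
  rewrite -(budget_sum (fun c => irr_deg (x_irr c)) e_le r_gt0); congr (_ + _ + _)%N.
  exact: size_nseqs.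
pose src c := [set i | ev2 (x c) (a i) == 0].
pose w := (n %/ (4 * M ^ e))%N.
pose TL := T :: [seq t :: T | t <- X].
have Me : (M ^ e <= M ^ d)%N by apply: leq_pexp2l.
have Me0 : (0 < M ^ e)%N by rewrite expn_gt0 M_gt0.
have szcs_le : (size cs <= D d)%N by lia.
have cT : (w ^ size cs <= #|[set t : (size cs).-tuple 'I_n |
    `[< gen x d (fun T' => T' \in TL) (ann a cs t) >]]|)%N.
  apply: (@generic_count R _ x d n (d ^ 2) TL a src) => //.
  - by move=> c i; rewrite inE => /eqP.
  - move=> c g dg nd0.
    exact: irr_few_zeros (x_irr c) (ec_le c) dg nd0.
  - move=> c _.
    have sTL : size TL = #|nonzeros a y|.+1 by rewrite /TL /X /= !size_map -cardE.
    have le1 : ((#|'I_r| + size TL * 2 ^ size cs * d.+1) * d ^ 2 <= q + #|nonzeros a y| * b)%N.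
      rewrite card_ord sTL mulnDl /q -addnA leq_add ?leq_mul2r ?r_le ?orbT //.
      rewrite -mulSn /b -!mulnA leq_mul2l; apply/orP; right.
      by rewrite leq_mul2r leq_pexp2l ?orbT.
    apply: leq_trans (leq_add (leqnn _) le1) _.
    apply: source_bound Me0 (rich c) _ _ _.
    + by move: off_le; rewrite expnS.
    + by apply: leq_trans n1; rewrite leq_mul2r leq_mul2l Me !orbT.
    + exact: leq_divM.
have over t : t \in [set t : (size cs).-tuple 'I_n | `[< gen x d (fun T' => T' \in TL) (ann a cs t) >]] ->
    (1 <= 1 * #|[set E in traces d a nd | all (mem E) t]|)%N.
  rewrite inE => /asboolP gt; set S := ann a cs t in gt.
  have cS (I : {set 'I_r}) : (count (fun cs => cs.1 \in I) S = \sum_(c in I) bud c)%N.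
    by rewrite -count_cs -(colors_ann a t) -/S count_map.
  have v1 := vdim_one r_gt0 x_irr e_le x_X TX T_free size_T gt cS.
  have /vdim_gt0P[g Vg g0] : (0 < vdim d (pts S ++ T))%N by rewrite v1.
  have nc c := no_component r_gt0 x_irr e_le x_X TX T_free size_T gt cS Vg g0 (c := c).
  have ne := no_extra_zero r_gt0 x_irr e_le x_X TX uT T_free size_T gt cS Vg g0.
  have dg : (deg g <= d)%N by case/andP: Vg.
  have vg s : s \in pts S ++ T -> ev2 g s = 0 by case/andP: Vg => _ /vanishP; apply.
  have ptsS : pts S = map a t by apply: pts_ann.
  rewrite mul1n card_gt0; apply/set0Pn; exists (Zset a g); rewrite inE; apply/andP; split; last first.
    by apply/allP => i it /=; rewrite inE vg // mem_cat ptsS map_f.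
  rewrite inE; apply/asboolP; exists g; split=> //; last first.
    move=> h dh hE; apply: vdim_le1 Vg _ g0; first by rewrite v1.
    apply/andP; split=> //; apply/vanishP => s sS.
    have [i es] : exists i, s = a i.
      move: sS; rewrite mem_cat ptsS => /orP[/mapP[i _ ->]|/TX /mapP[i _ ->]]; by exists i.
    by rewrite es; apply: hE; rewrite inE -es vg.
  apply: leq_trans (trace_bound e_gt0 e_le).
  have sub : Zset a g \subset [set i | a i \in T] :|:
      \bigcup_c [set i | (ev2 g (a i) == 0) && (ev2 (x c) (a i) == 0)].
    apply/subsetP => i; rewrite !inE => gi; have [//|iT] := boolP (a i \in T).
    have yi : ev2 y (a i) = 0.
      apply/eqP; apply: contraLR gi; rewrite -yX => iX; exact: ne.
    have [c _ xc] : exists2 c, true & ev2 (x c) (a i) == 0.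
      by apply/exists_inP; move/eqP: yi; rewrite ev2_prod; apply: contraTT => /exists_inPn h;
        apply/prodf_neq0 => c _; apply: h.
    by apply/bigcupP; exists c => //; rewrite inE gi.
  apply: leq_trans (subset_leq_card sub) _; apply: leq_trans (leq_card_setU _ _) _.
  apply: leq_add.
    rewrite -size_T cardE -(size_map a); apply: uniq_leq_size.
      by rewrite map_inj_uniq // enum_uniq.
    by move=> s /mapP[i]; rewrite mem_enum inE => h ->.
  apply: leq_trans (leq_card_bigcup _ _) _; rewrite /e big_distrr /=; apply: leq_sum => c _.
  apply: leq_trans (few_common_zeros a_inj g0 (x0 c) (no_common_irr (x_irr c) (nc c))) _.
  by rewrite leq_mul2r dg orbT.
have := double_count (@traces_le R n d a nd) over; rewrite muln1 mul1n => dc.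
have w_gt0 : (0 < w)%N.
  rewrite /w divn_gt0 ?muln_gt0 ?Me0 //; apply: leq_trans n2; by rewrite leq_mul2l Me orbT.
have n_le : (n <= 8 * M ^ d * w)%N.
  have := ltn_ceil n (_ : 0 < 4 * M ^ e)%N; rewrite muln_gt0 Me0 -/w => /(_ isT) h.
  apply: leq_trans (ltnW h) _; apply: (@leq_trans (8 * M ^ e * w)); last first.
    by rewrite leq_mul2r leq_mul2l Me !orbT.
  rewrite (_ : 8 * M ^ e * w = 2 * w * (4 * M ^ e))%N; last by move: (M ^ e)%N (w); clear; lia.
  by rewrite leq_mul2r; apply/orP; right; lia.
(* By [D_split], [size cs] equals D e + e (d - e) - 2, which is exactly [d] when e = 1. *)
have K_ge : (d <= size cs)%N.
  have := size_cs; have := D_split (d - e) e; rewrite subnK //.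
  have := D2E e; move: e_gt0 e_le; clear; move: (size cs) (D d) (D e) (D _) => k u v z.
  move=> e0 ed h1 h2 h3; have : (e * (d - e) + 3 * e <= k + 2)%N by case: e e0 {ed} h1 h2 h3 => [|[|e]] // _ h1 h2 h3; nia.
  have [m ->] : exists m, d = (e + m)%N by exists (d - e)%N; lia.
  rewrite addKn; nia.
have pw k : (k <= D d)%N -> ((8 * M ^ d) ^ k <= (8 * M ^ d) ^ D d)%N.
  by move=> le; rewrite leq_pexp2l // muln_gt0 expn_gt0 M_gt0.
apply: (@leq_trans (N1 * #|traces d a nd|)); last by rewrite leq_mul2r leq_addl orbT.
apply: (@leq_trans (n ^ size cs)); first by rewrite leq_pexp2l.
apply: (@leq_trans ((8 * M ^ d * w) ^ size cs)); first by rewrite leq_exp2r // (leq_trans d_gt0).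
rewrite expnMn /N1 -mulnA leq_mul ?pw // mulnC.
apply: leq_trans cT _; apply: leq_trans dc _; rewrite leq_mul2l; apply/orP; right.
apply: (@leq_trans (nd.+1 ^ size cs)); last by rewrite leq_pexp2l.
by rewrite leq_exp2r // (leq_trans d_gt0).
Qed.

End Concentrated.

(** * Conics *)

Section Lines.
Variable R : realType.
Local Notation P := {mpoly R[2]}.
Local Notation point := (point R).
Implicit Types (f g h : P) (s t p q z : point) (u : vec R).

Definition hvec p : vec R := (1, p.1, p.2).
Definition aff u : P := u.1.1 *: 1 + u.1.2 *: 'X_0 + u.2 *: 'X_1.
Definition line s t := aff (cross (hvec s) (hvec t)).

Lemma aff_ev2 u p : ev2 (aff u) p = dot u (hvec p).
Proof.
have ev0 : ev2 'X_0 p = p.1 :> R by rewrite /ev2 mevalXU.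
have ev1 : ev2 'X_1 p = p.2 :> R by rewrite /ev2 mevalXU.
by rewrite /aff !ev2D !ev2Z ev2_1 ev0 ev1 /dot /= mulr1.
Qed.

Lemma aff_deg u : (deg (aff u) <= 1)%N.
Proof.
have d1 i : (deg ('X_i : P) <= 1)%N by rewrite -deg_le msizeX mdeg1.
rewrite /aff; apply: degD_le; first apply: degD_le.
- by apply: leq_trans (degZ_le _ _) _; rewrite /deg msize1.
- exact: leq_trans (degZ_le _ _) (d1 _).
- exact: leq_trans (degZ_le _ _) (d1 _).
Qed.

Lemma aff_neq0 u : u <> v0 R -> aff u != 0.
Proof.
move=> u0; apply/eqP => e; apply: u0.
have h p : dot u (hvec p) = 0 by rewrite -aff_ev2 e ev2_0.
have := h (0, 0); have := h (1, 0); have := h (0, 1); rewrite /dot /hvec /= => h1 h2 h3.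
by apply: vecP => /=; lra.
Qed.

Lemma lineE s t p : ev2 (line s t) p =
  s.1 * t.2 - s.2 * t.1 + (s.2 - t.2) * p.1 + (t.1 - s.1) * p.2.
Proof. by rewrite aff_ev2 /dot /hvec /cross /=; ring. Qed.

Lemma line_l s t : ev2 (line s t) s = 0. Proof. rewrite lineE; ring. Qed.
Lemma line_r s t : ev2 (line s t) t = 0. Proof. rewrite lineE; ring. Qed.
Lemma lineC s t p : ev2 (line s t) p = - ev2 (line t s) p. Proof. rewrite !lineE; ring. Qed.
Lemma line_rot s t p : ev2 (line s t) p = ev2 (line t p) s. Proof. rewrite !lineE; ring. Qed.

Lemma hvec_dist s t : s != t -> cross (hvec s) (hvec t) <> v0 R.
Proof.
move=> ne; rewrite /cross /hvec /v0 /= => -[_ e1 e2]; move/eqP: ne; apply.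
by case: s t e1 e2 => [x y] [x' y'] /= e1 e2; congr (_, _); lra.
Qed.

Lemma line_neq0 s t : s != t -> line s t != 0.
Proof. by move/hvec_dist/aff_neq0. Qed.

Lemma deg_line s t : s != t -> deg (line s t) = 1%N.
Proof.
move=> ne; have := aff_deg (cross (hvec s) (hvec t)); rewrite -/(line s t).
have : line s t \isn't a GRing.unit by apply/negP => /unit_ev2 h; have := h s; rewrite line_l eqxx.
by rewrite unitE_deg ?line_neq0 //; case: (deg _) => [|[|]].
Qed.

Lemma irr_line s t : s != t -> irr (line s t).
Proof.
move=> ne; have l0 := line_neq0 ne; have l1 := deg_line ne; split=> //.
  by rewrite unitE_deg // l1.
move=> f g e; have f0 : f != 0 by apply: contraNneq l0 => f0; rewrite e f0 mul0r.
have g0 : g != 0 by apply: contraNneq l0 => g0; rewrite e g0 mulr0.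
move: l1; rewrite e degM // !unitE_deg //.
move=> e1; have [_|f_gt0] := posnP (deg f); first by left.
by right; apply/eqP; move: e1 f_gt0; clear; lia.
Qed.

Lemma line_meet s t t' q : ev2 (line s t) q = 0 -> ev2 (line s t') q = 0 ->
  ev2 (line s t) t' != 0 -> q = s.
Proof.
rewrite !lineE; case: s t t' q => [a b] [a1 b1] [a2 b2] [x y] /= h1 h2 h3.
set D := _ + _ in h3; have [hx hy] : D * (x - a) = 0 /\ D * (y - b) = 0.
  split.
    rewrite (_ : D * _ = (a2 - a) * (a * b1 - b * a1 + (b - b1) * x + (a1 - a) * y) -
      (a1 - a) * (a * b2 - b * a2 + (b - b2) * x + (a2 - a) * y)); last by rewrite /D; ring.
    by rewrite h1 h2 !mulr0 subrr.
  rewrite (_ : D * _ = (b2 - b) * (a * b1 - b * a1 + (b - b1) * x + (a1 - a) * y) -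
      (b1 - b) * (a * b2 - b * a2 + (b - b2) * x + (a2 - a) * y)); last by rewrite /D; ring.
  by rewrite h1 h2 !mulr0 subrr.
move/eqP: hx; move/eqP: hy; rewrite !mulf_eq0 (negPf h3) /= !subr_eq0.
by move=> /eqP -> /eqP ->.
Qed.

Lemma line_conic s t f X : s != t -> f != 0 -> (deg f <= 2)%N -> ~ rdvd (line s t) f ->
  uniq X -> vanish X f -> vanish X (line s t) -> (size X <= 2)%N.
Proof.
move=> ne f0 df nd uX vf vl.
have := bezout f0 (line_neq0 ne) (no_common_irr (irr_line ne) nd) uX vf vl.
by rewrite deg_line // muln1 => /leq_trans; apply.
Qed.

End Lines.

(** * The net of conics through three points *)

Section Triple.
Variable R : realType.
Local Notation P := {mpoly R[2]}.
Local Notation point := (point R).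
Variables (n M : nat) (a : 'I_n -> point).
Hypothesis a_inj : injective a.
Implicit Types (f g : P).

Definition collinear3 i j := [set k | ev2 (line (a i) (a j)) (a k) == 0].

Variables i1 i2 i3 : 'I_n.
Local Notation s1 := (a i1).
Local Notation s2 := (a i2).
Local Notation s3 := (a i3).
Hypothesis noncoll : ev2 (line s1 s2) s3 != 0.
Hypothesis few12 : (#|collinear3 i1 i2| <= 3)%N.
Hypothesis few13 : (#|collinear3 i1 i3| <= 3)%N.
Hypothesis off_conic : forall f, f != 0 -> (deg f <= 2)%N ->
  exists i, ev2 f (a i) != 0 /\ ev2 (line s2 s3) (a i) != 0.
Hypothesis spread23 : (n < M * #|nonzeros a (line s2 s3)|)%N.
Hypothesis n_large : (18 * M <= n)%N.

Let S := [:: s1; s2; s3].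
(** The reflection of s2 in s3, a third point of the line s2 s3. A conic of the net with another
    point on this line contains the whole line and hence [z], so avoiding [z] excludes exactly the
    line that has no bound on its points. *)
Let z : point := (2 * s3.1 - s2.1, 2 * s3.2 - s2.2).

Let n13 : s1 != s3.
Proof. by apply: contraNneq noncoll => <-; rewrite line_l. Qed.
Let n23 : s2 != s3.
Proof. by apply: contraNneq noncoll => <-; rewrite line_r. Qed.
Let n12 : s1 != s2.
Proof. by apply: contraNneq noncoll => <-; rewrite lineE; apply/eqP; ring. Qed.

Lemma line_z (p q : point) : ev2 (line p q) z = 2 * ev2 (line p q) s3 - ev2 (line p q) s2.
Proof. rewrite !lineE /z /=; ring. Qed.

Lemma V_lines (p q p' q' : point) X :
  (forall s, s \in X -> ev2 (line p q) s = 0 \/ ev2 (line p' q') s = 0) ->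
  V 2 X (line p q * line p' q').
Proof.
move=> h; apply/andP; split; first exact: (degM_le (aff_deg _) (aff_deg _)).
by apply/vanishP => s /h[] e; rewrite ev2M e ?mul0r ?mulr0.
Qed.

Ltac V_lines_tac := by apply: V_lines => s; rewrite !inE -?orbA;
  repeat (case/orP; [move/eqP -> | ]); try move/eqP ->; rewrite ?line_l ?line_r; auto.

Lemma noncoll' : [/\ ev2 (line s2 s3) s1 != 0, ev2 (line s1 s3) s2 != 0, ev2 (line s2 s1) s3 != 0 &
  ev2 (line s3 s1) s2 != 0].
Proof.
have h1 : ev2 (line s2 s3) s1 != 0 by rewrite -line_rot.
have h2 : ev2 (line s3 s1) s2 != 0 by rewrite -line_rot.
by split; rewrite // lineC oppr_eq0.
Qed.

Lemma collinear_z f i : V 2 S f -> ev2 f (a i) = 0 -> a i != s2 -> a i != s3 ->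
  ev2 (line s2 s3) (a i) = 0 -> ev2 f z = 0.
Proof.
move=> Vf fi ni2 ni3 li; have [->|f0] := eqVneq f 0; first exact: ev2_0.
case/andP: Vf => df /vanishP vf.
have [[q ->]|nd] := pselect (rdvd (line s2 s3) f).
  by rewrite ev2M line_z line_l line_r mulr0 subr0 mulr0.
have /(_ [:: a i; s2; s3]) := line_conic n23 f0 df nd; rewrite /= !inE negb_or ni2 ni3 n23.
have fs2 : ev2 f s2 = 0 by apply: vf; rewrite !inE eqxx orbT.
have fs3 : ev2 f s3 = 0 by apply: vf; rewrite !inE eqxx !orbT.
by rewrite /vanish /= fi fs2 fs3 li line_l line_r !eqxx => /(_ isT isT isT).
Qed.

Lemma usableE i : i \in usable 2 a S z <-> a i != s1 /\ ev2 (line s2 s3) (a i) != 0.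
Proof.
have [h23 h13 h21 h31] := noncoll'; set p := a i.
split=> [|[ne l23]]; rewrite inE; last first.
  have [np2 np3] : p != s2 /\ p != s3.
    by split; apply: contraNneq l23 => ->; rewrite ?line_l ?line_r.
  apply/andP; split; apply/asboolP => h.
    have nz (x y x' y' : point) : ev2 (line x y) p != 0 -> ev2 (line x' y') p != 0 ->
        ~ V 2 S (line x y * line x' y').
      by move=> h1 h2 /h /eqP; rewrite ev2M mulf_eq0 (negPf h1) (negPf h2).
    have [l12|l12] := eqVneq (ev2 (line s1 s2) p) 0; last have [l13|l13] := eqVneq (ev2 (line s1 s3) p) 0.
    - have l13 : ev2 (line s1 s3) p != 0.
        by apply: contra ne => /eqP l13; apply/eqP; apply: line_meet l12 l13 noncoll.
      by case: (nz _ _ _ _ l13 l23); V_lines_tac.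
    - by case: (nz _ _ _ _ l12 l23); V_lines_tac.
    - by case: (nz _ _ _ _ l12 l13); V_lines_tac.
  have /h : V 2 S (line s1 s2 * line s3 p) by V_lines_tac.
  rewrite -/p !ev2M !line_z line_r mulr0 => /(_ erefl) /eqP.
  rewrite line_r line_l subr0 mulr0 sub0r !mulf_eq0 oppr_eq0 pnatr_eq0 (negPf noncoll) /=.
  by rewrite -line_rot (negPf l23).
move=> /andP[/asboolP nb /asboolP nbad].
have nS s : s \in S -> p != s.
  by move=> sS; apply/eqP => e; apply: nb => f /andP[_ /vanishP/(_ s sS)]; rewrite -/p e.
split; first by apply: nS; rewrite mem_head.
apply/eqP => li; apply: nbad => f Vf fi.
by apply: collinear_z Vf fi _ _ li; apply: nS; rewrite !inE eqxx ?orbT.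
Qed.

(** Two reducible conics cut out the fiber of p: the line s1 s2 with the line s3 p, and s1 s3 with
    s2 p. The fiber lies in {s1, s2, s3, p}, unless p is on s1 s2 or s1 s3; then it consists of at
    most three points of that line and one more point. *)
Lemma fib_le i : i \in usable 2 a S z -> (#|fib 2 a S i| <= 2 ^ 2)%N.
Proof.
move=> /usableE; set p := a i; move=> [np1 l23]; have [h23 h13 h21 h31] := noncoll'.
have fibP j : j \in fib 2 a S i ->
    [\/ j = i1, j = i2 /\ ev2 (line s1 s2) p != 0, j = i3 /\ ev2 (line s1 s3) p != 0 | j = i] \/
    (ev2 (line s1 s2) p = 0 /\ ev2 (line s1 s2) (a j) = 0 \/
     ev2 (line s1 s3) p = 0 /\ ev2 (line s1 s3) (a j) = 0).
  rewrite inE => /asboolP h.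
  have /h/eqP : V 2 (p :: S) (line s1 s2 * line s3 p) by V_lines_tac.
  have /h/eqP : V 2 (p :: S) (line s1 s3 * line s2 p) by V_lines_tac.
  rewrite !ev2M !mulf_eq0 => /orP[/eqP l13|/eqP l2p] /orP[/eqP l12|/eqP l3p].
  - by left; apply: Or41; apply: a_inj; apply: line_meet l12 l13 noncoll.
  - have [e|ne] := eqVneq (ev2 (line s1 s3) p) 0; first by right; right.
    left; apply: Or43; split=> //; apply: a_inj; apply: line_meet l3p _ (_ : ev2 (line s3 p) s1 != 0).
      by rewrite lineC l13 oppr0.
    by rewrite line_rot line_rot.
  - have [e|ne] := eqVneq (ev2 (line s1 s2) p) 0; first by right; left.
    left; apply: Or42; split=> //; apply: a_inj; apply: line_meet l2p _ (_ : ev2 (line s2 p) s1 != 0).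
      by rewrite lineC l12 oppr0.
    by rewrite line_rot line_rot.
  - left; apply: Or44; apply: a_inj; apply: (@line_meet _ p s2 s3).
    + by rewrite lineC l2p oppr0.
    + by rewrite lineC l3p oppr0.
    + by rewrite line_rot.
have c4 (i4 : 'I_n) : (#|[set i1; i2; i3; i4]| <= 4)%N.
  apply: leq_trans (leq_card_setU _ _) _; rewrite cards1 addn1 ltnS.
  apply: leq_trans (leq_card_setU _ _) _; rewrite cards1 addn1 ltnS.
  by rewrite cards2; case: (_ != _).
have [l12|l12] := eqVneq (ev2 (line s1 s2) p) 0.
  apply: (@leq_trans #|i3 |: collinear3 i1 i2|); last first.
    by apply: leq_trans (leq_card_setU _ _) _; rewrite cards1 add1n ltnS.
  apply: subset_leq_card; apply/subsetP => j /fibP; rewrite in_setU1 inE.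
  have l13 : ev2 (line s1 s3) p != 0.
    by apply: contra np1 => /eqP l13; apply/eqP; apply: line_meet l12 l13 noncoll.
  case=> [[->|[-> _]|[-> _]|->]|[[_ ->]|[e]]]; rewrite ?line_l ?line_r ?eqxx ?orbT //.
    by rewrite -/p l12 eqxx orbT.
  by rewrite e eqxx in l13.
have [l13|l13] := eqVneq (ev2 (line s1 s3) p) 0.
  apply: (@leq_trans #|i2 |: collinear3 i1 i3|); last first.
    by apply: leq_trans (leq_card_setU _ _) _; rewrite cards1 add1n ltnS.
  apply: subset_leq_card; apply/subsetP => j /fibP; rewrite in_setU1 inE.
  case=> [[->|[-> _]|[-> _]|->]|[[e]|[_ ->]]]; rewrite ?line_l ?line_r ?eqxx ?orbT //.
    by rewrite -/p l13 eqxx orbT.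
  by rewrite e eqxx in l12.
apply: leq_trans (c4 i); apply: subset_leq_card; apply/subsetP => j /fibP; rewrite !inE.
case=> [[->|[-> _]|[-> _]|->]|[[e]|[e]]]; rewrite ?eqxx ?orbT //.
  by rewrite e eqxx in l12.
by rewrite e eqxx in l13.
Qed.

Lemma triple_traces :
  (n <= 48 * M * #|[set E in traces 2 a 5 | all (mem E) [:: i1; i2; i3]]|)%N.
Proof.
have S_in s : s \in S -> exists i, a i = s.
  by rewrite !inE => /or3P[] /eqP ->; [exists i1|exists i2|exists i3].
have vdimS : vdim 2 S = 3%N.
  have := @vdim_indep R 2 S; rewrite /= !inE negb_or n12 n13 n23 => /(_ isT isT).
  by have := D2E 2; lia.
have off f : V 2 S f -> f != 0 -> exists2 i, i \in usable 2 a S z & ev2 f (a i) != 0.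
  move=> /andP[df /vanishP vf] f0; have [i [fi li]] := off_conic f0 df.
  exists i => //; apply/usableE; split=> //; apply: contraNneq fi => ->.
  by apply/eqP/vf; rewrite mem_head.
have key := net_traces S_in vdimS fib_le off.
have sub : nonzeros a (line s2 s3) \subset i1 |: usable 2 a S z.
  apply/subsetP => i; rewrite inE in_setU1 => li; have [//|ne] := eqVneq i i1.
  by apply/usableE; rewrite (inj_eq a_inj).
have h1 : (#|nonzeros a (line s2 s3)| <= 1 + #|usable 2 a S z|)%N.
  by apply: leq_trans (subset_leq_card sub) _; apply: leq_trans (leq_card_setU _ _) _; rewrite cards1.
have h2 := subset_leq_card (traces_over_map 2 a [:: i1; i2; i3]).
have nd5 : (2 * 2 ^ 2 + 3 - D 2 = 5)%N by have := D2E 2; lia.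
rewrite nd5 in key h2; move: key h1 h2 spread23 n_large; clear.
rewrite /= -/S; move: #|usable 2 a S z| #|nonzeros a _| #|traces_over 2 a 5 S| #|[set E in traces 2 a 5 | _]| => u v t t' key h1 h2 h3 h4.
have h5 : (v <= 24 * t' + 9)%N by move: key h1 h2; rewrite /S /=; lia.
have := leq_mul (leqnn M) h5; nia.
Qed.

End Triple.

(** * Triples whose first point lies on two poor connecting lines *)

Section GoodTriples.
Variable R : realFieldType.
Variables (I : finType) (L : I -> vec R).
Hypothesis L_dist : forall i j, i != j -> cross (L i) (L j) <> v0 R.
Hypothesis I_gt1 : (1 < #|I|)%N.
Hypothesis not_collinear : forall i m, cross (L i) m <> v0 R ->
  exists p q, [/\ p != q, dot (L i) (cross (L p) (L q)) != 0 & dot m (cross (L p) (L q)) != 0].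

Lemma good_at_thru i E : E \in good_at L i ->
  exists j, i != j /\ E = thru L (cross (L i) (L j)).
Proof.
rewrite inE => /andP[/goodP[[p [q [npq eE]]] _] iE].
have [pE qE] := thru_X L p q; rewrite -eE in pE qE.
have [j jE nij] : exists2 j, j \in E & i != j.
  by have [e|ne] := eqVneq i p; [exists q; rewrite ?e|exists p].
exists j; split=> //; have X0 := L_dist npq.
rewrite eE in iE jE; have [t t0 et] := thru_eq L_dist nij X0 iE jE.
by rewrite eE et thru_scl.
Qed.

Definition good_triples : {set 3.-tuple I} := [set t |
  [&& (#|thru L (cross (L (tnth t ord0)) (L (tnth t (inord 1))))| <= 3)%N,
      (#|thru L (cross (L (tnth t ord0)) (L (tnth t (inord 2))))| <= 3)%N &
      dot (L (tnth t ord0)) (cross (L (tnth t (inord 1))) (L (tnth t (inord 2)))) != 0]].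

(** A line [i] with at least two good crossings gives a triple for each of them: the second entry is
    taken on this crossing and the third on another good one. The first two entries determine the
    pair. *)
Lemma many_good_triples : (2 * #|I| <= 5 * #|good_triples|)%N.
Proof.
apply: leq_trans (many_good_pairs L_dist I_gt1 not_collinear) _; rewrite leq_mul2l /=.
pose PE := [set p : I * {set I} | (1 < #|good_at L p.1|)%N && (p.2 \in good_at L p.1)].
have -> : (\sum_(i | 1 < #|good_at L i|) #|good_at L i| = #|PE|)%N.
  rewrite -sum1_card (eq_bigl (fun p : I * {set I} => (1 < #|good_at L p.1|)%N && (p.2 \in good_at L p.1))); last first.
    by move=> p; rewrite inE.
  rewrite -(pair_big_dep (fun i => (1 < #|good_at L i|)%N) (fun i E => E \in good_at L i) (fun _ _ => 1%N)) /=.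
  by apply: eq_bigr => i _; rewrite sum1_card.
have /choice[phi hphi] : forall p : I * {set I}, exists t : 3.-tuple I, p \in PE ->
    [/\ t \in good_triples, tnth t ord0 = p.1 &
     p.2 = thru L (cross (L (tnth t ord0)) (L (tnth t (inord 1))))].
  move=> [i E]; have [|npe] := boolP ((i, E) \in PE); last by exists [tuple i; i; i].
  rewrite inE /= => /andP[gt1 Eg].
  have [F Fg neF] : exists2 F, F \in good_at L i & F != E.
    have /card_gt1P[F1 [F2 [h1 h2 ne]]] := gt1.
    by have [e|ne1] := eqVneq F1 E; [exists F2; rewrite // -e eq_sym|exists F1].
  have [j [nij eE]] := good_at_thru Eg; have [k [nik eF]] := good_at_thru Fg.
  exists [tuple i; j; k] => _; rewrite inE !(tnth_nth i) /= !inordK //=.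
  split=> //; have [/andP[/goodP[_ cE] _] /andP[/goodP[_ cF] _]] : (E \in good L) && (i \in E) /\ (F \in good L) && (i \in F).
    by move: Eg Fg; rewrite !inE.
  rewrite -eE -eF cE cF /=; apply: contra neF => /eqP e.
  have jF : j \in thru L (cross (L i) (L k)).
    by rewrite inE -[X in X == 0]opprK oppr_eq0 -mulN1r -dotZ -crossC dot_rot dot_rot e.
  have [iF _] := thru_X L i k; have [t t0 et] := thru_eq L_dist nij (L_dist nik) iF jF.
  by rewrite eF et thru_scl // eE.
apply: leq_trans (_ : #|phi @: PE| <= _)%N; last first.
  by apply: subset_leq_card; apply/subsetP => t /imsetP[p /hphi[h _ _] ->].
rewrite card_in_imset // => -[i E] [i' E'] /hphi[_ /= e1 e2] /hphi[_ /= e1' e2'] e.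
have ei : i = i' by rewrite -e1 e e1'.
by rewrite ei e2 e2' e.
Qed.

End GoodTriples.

Lemma tval3 (T : Type) (t : 3.-tuple T) :
  tval t = [:: tnth t ord0; tnth t (inord 1); tnth t (inord 2)].
Proof.
by case: t => -[|x [|y [|z [|]]]] // st; rewrite !(tnth_nth x) !inordK.
Qed.

Section ConicCase.
Variable R : realType.
Local Notation P := {mpoly R[2]}.
Local Notation point := (point R).
Variables (n M : nat) (a : 'I_n -> point).
Hypothesis a_inj : injective a.
Hypothesis n_large : (18 * M <= n)%N.
Hypothesis spread : forall f : P, f != 0 -> (deg f <= 2)%N -> (n < M * #|nonzeros a f|)%N.
Implicit Types (f g l : P).

Lemma M_gt0 : (0 < M)%N.
Proof.
by have := spread (oner_neq0 _); rewrite {1}/deg msize1 => /(_ isT); case: (M).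
Qed.

Lemma avoid f : f != 0 -> (deg f <= 2)%N -> exists i, ev2 f (a i) != 0.
Proof.
move=> f0 df; have : (0 < #|nonzeros a f|)%N.
  by have := spread f0 df; case: #|_| => //; rewrite muln0.
by case/card_gt0P => i; rewrite inE; exists i.
Qed.

Lemma few_zeros_line f i j : f != 0 -> ~ rdvd (line (a i) (a j)) f -> i != j ->
  (#|[set k | (ev2 f (a k) == 0%R) && (ev2 (line (a i) (a j)) (a k) == 0%R)]| <= deg f)%N.
Proof.
move=> f0 nd ne; have neq : a i != a j by rewrite (inj_eq a_inj).
rewrite -[leqRHS]muln1 -(deg_line neq).
have := few_common_zeros a_inj f0 (line_neq0 neq) (no_common_irr (irr_line neq) nd). apply.
Qed.

Lemma not_rdvd_line f i j s : ev2 (line (a i) (a j)) s = 0 -> ev2 f s != 0 ->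
  ~ rdvd (line (a i) (a j)) f.
Proof. by move=> ls /negP fs [q e]; apply: fs; rewrite e ev2M ls mulr0. Qed.

Section LineAndConic.
Variables (l f : P).
Hypothesis (l0 : l != 0) (dl : (deg l <= 1)%N) (f0 : f != 0) (df : (deg f <= 2)%N).
Hypothesis cover : forall i, ev2 f (a i) = 0 \/ ev2 l (a i) = 0.

(** If the chord [i2 i3] divides [f], take a point [i4] off it and off [l], which lies on the
    residual line. If [i2 i4] and [i3 i4] also divided [f], both would be the residual line, making
    the three points collinear. *)
Lemma chord : exists i j, [/\ i != j, ev2 l (a i) != 0, ev2 l (a j) != 0 &
  ~ rdvd (line (a i) (a j)) f].
Proof.
have [i2 [i3 [h2 h3 ne]]] : exists i j, [/\ i \in nonzeros a l, j \in nonzeros a l & i != j].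
  apply/card_gt1P; have := spread l0 (leqW dl); have := n_large; have := M_gt0.
  by case: #|_| => [|[|]] // hM h1; rewrite ?muln0 ?muln1 //; lia.
rewrite !inE in h2 h3.
have [[m em]|nd] := pselect (rdvd (line (a i2) (a i3)) f); last by exists i2, i3.
have neq : a i2 != a i3 by rewrite (inj_eq a_inj).
have m0 : m != 0 by apply: contraNneq f0 => m0; rewrite em m0 mul0r.
have dm : (deg m <= 1)%N by move: df; rewrite em degM ?line_neq0 // deg_line // addn1.
have [||i4] := avoid (_ : l * line (a i2) (a i3) != 0).
- by rewrite mulf_neq0 ?line_neq0.
- exact: (degM_le dl (aff_deg _)).
rewrite ev2M mulf_eq0 negb_or => /andP[l4 l234].
have m4 : ev2 m (a i4) = 0.
  case: (cover i4) => [|e]; last by rewrite e eqxx in l4.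
  by rewrite em ev2M => /eqP; rewrite mulf_eq0 (negPf l234) orbF => /eqP.
have n24 : i2 != i4 by apply: contraNneq l234 => <-; rewrite line_l.
have n34 : i3 != i4 by apply: contraNneq l234 => <-; rewrite line_r.
have dvm i : i != i4 -> rdvd (line (a i) (a i4)) f -> rdvd (line (a i) (a i4)) m.
  move=> nei; rewrite em => dv.
  have irr_l : irr (line (a i) (a i4)) by apply: irr_line; rewrite (inj_eq a_inj).
  case: (irr_prime irr_l dv) => // dv'; exfalso.
  by apply: not_rdvd_line l234 dv'; rewrite line_r.
have [d24|] := pselect (rdvd (line (a i2) (a i4)) f); last by exists i2, i4.
have [d34|] := pselect (rdvd (line (a i3) (a i4)) f); last by exists i3, i4.
have [c ec] := dvm _ n24 d24; have [c' ec'] := dvm _ n34 d34.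
have neq24 : a i2 != a i4 by rewrite (inj_eq a_inj).
have c0 : c != 0 by apply: contraNneq m0 => c0; rewrite ec c0 mul0r.
have uc : c \is a GRing.unit.
  by move: dm; rewrite unitE_deg // ec degM ?line_neq0 // deg_line // addn1 ltnS leqn0.
have : ev2 m (a i3) = 0 by rewrite ec' ev2M line_l mulr0.
rewrite ec ev2M => /eqP; rewrite mulf_eq0 (negPf (unit_ev2 _ uc)) /=.
move=> e; case/eqP: l234; move/eqP: e; rewrite !lineE => e; rewrite -[RHS]oppr0 -e; ring.
Qed.

Lemma line_and_conic : exists T : {set 3.-tuple 'I_n}, (n <= 3 * M * #|T|)%N /\
  forall t, t \in T -> (n <= 48 * M * #|[set E in traces 2 a 5 | all (mem E) t]|)%N.
Proof.
have [i2 [i3 [ne l2 l3 nd]]] := chord.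
set l23 := line (a i2) (a i3) in nd.
have neq : a i2 != a i3 by rewrite (inj_eq a_inj).
have ndl : ~ rdvd l23 l by apply: not_rdvd_line l2; rewrite line_l.
pose Y := [set i in nonzeros a f | ev2 l23 (a i) != 0].
have fl i : ev2 f (a i) != 0 -> ev2 l (a i) = 0.
  by move=> fi; case: (cover i) => // e; rewrite e eqxx in fi.
have lf i : ev2 l (a i) != 0 -> ev2 f (a i) = 0.
  by move=> li; case: (cover i) => // e; rewrite e eqxx in li.
have cl23 := few_zeros_line l0 ndl ne; have cf23 := few_zeros_line f0 nd ne.
rewrite -/l23 in cl23 cf23.
have cY : (#|nonzeros a f| <= #|Y| + 1)%N.
  rewrite -(cardsID [set i | ev2 l23 (a i) != 0] (nonzeros a f)); apply: leq_add.
    by apply: subset_leq_card; apply/subsetP => i; rewrite !inE.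
  apply: leq_trans dl; apply: leq_trans cl23; apply: subset_leq_card; apply/subsetP => i.
  by rewrite !inE negbK => /andP[-> /fl ->]; rewrite eqxx.
pose tup i := [tuple i; i2; i3].
have tup_inj : injective tup by move=> i j /(congr1 (fun t => tnth t ord0)).
exists [set tup i | i in Y]; rewrite card_imset //; split.
  have := spread f0 df; have := n_large; have := M_gt0; move: cY; clear.
  move: #|_| #|_| => u v h1 h2 h3 h4; have := leq_mul (leqnn M) h1; nia.
move=> t /imsetP[i iY ->]; rewrite inE in iY; case/andP: iY; rewrite inE => fi li.
have few j : ev2 l (a j) != 0 -> (#|collinear3 a i j| <= 3)%N.
  move=> lj; have nij : i != j by apply: contraNneq lj => <-; rewrite fl.
  have h1 : ~ rdvd (line (a i) (a j)) l by apply: not_rdvd_line lj; rewrite line_r.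
  have h2 : ~ rdvd (line (a i) (a j)) f by apply: not_rdvd_line fi; rewrite line_l.
  apply: leq_trans (leq_add (leq_trans (few_zeros_line l0 h1 nij) dl)
    (leq_trans (few_zeros_line f0 h2 nij) df)).
  apply: leq_trans (leq_card_setU _ _); apply: subset_leq_card; apply/subsetP => k.
  by rewrite !inE => ->; rewrite !andbT; case: (cover k) => ->; rewrite eqxx ?orbT.
apply: triple_traces (few _ l2) (few _ l3) _ (spread (line_neq0 neq) (leqW (aff_deg _))) n_large => //.
  by rewrite line_rot.
move=> g g0 dg; apply: contrapT => no.
have sub : nonzeros a g \subset [set k | (ev2 l (a k) == 0%R) && (ev2 l23 (a k) == 0%R)] :|:
    [set k | (ev2 f (a k) == 0%R) && (ev2 l23 (a k) == 0%R)].
  apply/subsetP => k; rewrite !inE => gk.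
  have -> : ev2 l23 (a k) == 0 by apply: contraT => lk; case: no; exists k.
  by rewrite !andbT; case: (cover k) => ->; rewrite eqxx ?orbT.
have := leq_trans (subset_leq_card sub) (leq_trans (leq_card_setU _ _)
   (leq_add (leq_trans cl23 dl) (leq_trans cf23 df))).
have := spread g0 dg; have := n_large; have := M_gt0; clear; move: #|_| => u h1 h2 h3 h4.
by have := leq_mul (leqnn M) h4; lia.
Qed.

End LineAndConic.

(** The lines of the arrangement are now the points of A and its crossings their connecting lines.
    Noncollinearity of crossings follows by choosing p off the line through [a i] and [m], then q
    off the two lines joining p to [a i] and to [m]. *)
Lemma no_line_and_conic :
  (forall u f, u <> v0 R -> f != 0 -> (deg f <= 2)%N ->
     exists i, ev2 f (a i) != 0 /\ ev2 (aff u) (a i) != 0) ->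
  exists T : {set 3.-tuple 'I_n}, (n <= 3 * M * #|T|)%N /\
  forall t, t \in T -> (n <= 48 * M * #|[set E in traces 2 a 5 | all (mem E) t]|)%N.
Proof.
move=> off; pose L i := hvec (a i).
have L_dist i j : i != j -> cross (L i) (L j) <> v0 R.
  by move=> ne; apply: hvec_dist; rewrite (inj_eq a_inj).
have sw (x y w : vec R) : dot (cross y x) w = - dot x (cross y w) by dot_ring.
have gt1 : (1 < #|'I_n|)%N.
  by rewrite card_ord; apply: leq_trans n_large; have := M_gt0; lia.
have not_coll i m : cross (L i) m <> v0 R -> exists p q,
    [/\ p != q, dot (L i) (cross (L p) (L q)) != 0 & dot m (cross (L p) (L q)) != 0].
  move=> im0; have [||p [_ hp]] := off _ 1 im0; rewrite ?oner_neq0 // /deg ?msize1 //.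
  rewrite aff_ev2 in hp.
  have pi0 : cross (L p) (L i) <> v0 R.
    by apply: L_dist; apply: contraNneq hp => ->; rewrite dotC dot_crossl.
  have pm0 : cross (L p) m <> v0 R.
    by move=> e; move: hp; rewrite dotC -/(L p) dot_rot crossC e vscl_v0 dot0 eqxx.
  have [|q [h1 h2]] := off _ _ pi0 (aff_neq0 pm0); first exact: leqW (aff_deg _).
  rewrite !aff_ev2 in h1 h2; exists p, q; split.
  - by apply: contraNneq h2 => <-; rewrite dotC dot_crossl.
  - by move: h2; rewrite sw oppr_eq0.
  - by move: h1; rewrite sw oppr_eq0.
have cT := many_good_triples L_dist gt1 not_coll.
exists (good_triples L); split.
  by rewrite card_ord in cT; have := M_gt0; move: cT; clear; move: #|_| => u; nia.
move=> t; rewrite inE => /and3P[].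
set i1 := tnth t ord0; set i2 := tnth t (inord 1); set i3 := tnth t (inord 2).
have et : tval t = [:: i1; i2; i3] := tval3 t.
have eC i j : thru L (cross (L i) (L j)) = collinear3 a i j.
  by apply/setP => k; rewrite !inE aff_ev2 dotC.
rewrite !eC et => h12 h13 nc.
have nc' : ev2 (line (a i1) (a i2)) (a i3) != 0.
  by rewrite aff_ev2 dotC dot_rot.
have neq : a i2 != a i3.
  by apply: contraNneq nc' => ->; rewrite line_r.
apply: triple_traces nc' h12 h13 _ (spread (line_neq0 neq) (leqW (aff_deg _))) n_large => //.
by move=> f f0 df; apply: off => //; apply: hvec_dist.
Qed.

Lemma conic_traces : (n ^ 2 <= 18000 * M ^ 2 * #|traces 2 a 5|)%N.
Proof.
have [T [cT hT]] : exists T : {set 3.-tuple 'I_n}, (n <= 3 * M * #|T|)%N /\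
  forall t, t \in T -> (n <= 48 * M * #|[set E in traces 2 a 5 | all (mem E) t]|)%N.
  have [/no_line_and_conic//|/existsNP[u /existsNP[f /not_implyP[u0 /not_implyP[f0 /not_implyP[df no]]]]]] :=
    pselect (forall u f, u <> v0 R -> f != 0 -> (deg f <= 2)%N ->
       exists i, ev2 f (a i) != 0 /\ ev2 (aff u) (a i) != 0).
  apply: (line_and_conic (aff_neq0 u0) (aff_deg u) f0 df) => i.
  have [|fi] := eqVneq (ev2 f (a i)) 0; [by left|right].
  by apply/eqP; apply: contraT => ui; case: no; exists i.
have := double_count (@traces_le R n 2 a 5) hT; rewrite -mulnn.
(* A trace of at most 5 points contains at most 125 triples, and 3 * 48 * 125 = 18000. *)
have -> : (5 ^ 3 = 125)%N by [].
move=> h; apply: leq_trans (leq_mul cT (leqnn n)) _; rewrite -mulnA.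
apply: leq_trans (leq_mul (leqnn _) h) _; rewrite -mulnn.
by apply: eq_leq; move: #|traces _ _ _| => u; ring.
Qed.

End ConicCase.

(** * Determined curves *)

Theorem many_traces d : (0 < d)%N -> exists C, forall (R : realType) n (a : 'I_n -> point R),
  injective a -> (C <= n)%N ->
  (forall f : {mpoly R[2]}, f != 0 -> (deg f <= d)%N -> exists i, ev2 f (a i) != 0) ->
  (n ^ d <= C * #|traces d a (2 * d ^ 2 + 3 - D d)|)%N.
Proof.
(* With this [M], if no curve of degree at most [d] meets the concentration condition, each of them
   misses more than n/M points. *)
move=> d_gt0; pose M := (conc_ratio d ^ d.+1)%N.
have [C1 conc] := concentrated_case d_gt0.
have [C2 spr] : exists C, forall (R : realType) n (a : 'I_n -> point R), injective a -> (C <= n)%N ->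
    (forall f : {mpoly R[2]}, f != 0 -> (deg f <= d)%N -> (n < M * #|nonzeros a f|)%N) ->
    (n ^ d <= C * #|traces d a (2 * d ^ 2 + 3 - D d)|)%N.
  have [e2|] := eqVneq d 2%N; last exact: spread_case.
  rewrite e2; have -> : (2 * 2 ^ 2 + 3 - D 2 = 5)%N by have := D2E 2; lia.
  exists (18 * M + 18000 * M ^ 2)%N => R n a a_inj n_ge spread.
  apply: leq_trans (conic_traces a_inj _ spread) _; last by rewrite leq_mul2r leq_addl orbT.
  by apply: leq_trans n_ge; rewrite leq_addr.
exists (C1 + C2)%N => R n a a_inj n_ge not_on.
have [h|nconc] := pselect (exists f : {mpoly R[2]}, [/\ f != 0, (deg f <= d)%N &
    (#|nonzeros a f| * conc_ratio d ^ (deg f).+1 <= n)%N]).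
  have := conc R n a a_inj (leq_trans (leq_addr _ _) n_ge) not_on h.
  by move/leq_trans; apply; rewrite leq_mul2r leq_addr orbT.
have spread (f : {mpoly R[2]}) : f != 0 -> (deg f <= d)%N -> (n < M * #|nonzeros a f|)%N.
  move=> f0 df; rewrite ltnNge; apply/negP => h; apply: nconc; exists f; split=> //.
  apply: leq_trans h; rewrite mulnC leq_mul2r leq_pexp2l ?orbT //.
  exact: ltnW (conc_ratio_gt1 d_gt0).
have := spr R n a a_inj (leq_trans (leq_addl _ _) n_ge) spread.
by move/leq_trans; apply; rewrite leq_mul2r leq_addl orbT.
Qed.

Section Curves.
Variable R : realType.
Local Notation P := {mpoly R[2]}.
Implicit Types f g : P.

Lemma deg_X0n k : 'X_0 ^+ k != 0 :> P /\ deg ('X_0 ^+ k : P) = k.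
Proof.
have X0 : 'X_0 != 0 :> P by rewrite -msize_poly_eq0 msizeX.
elim: k => [|k [k0 dk]]; first by rewrite expr0 oner_eq0 /deg msize1.
rewrite exprS mulf_neq0 // degM // dk {1}/deg msizeX mdeg1 //.
Qed.

(** Padding with powers of a variable turns the hypothesis on curves of degree exactly [d] into one
    on all nonzero polynomials of degree at most [d]. *)
Lemma curve_of_small_deg d f : f != 0 -> (deg f <= d)%N ->
  exists g, msize g = d.+1 /\ forall z, ev2 f z = 0 -> ev2 g z = 0.
Proof.
move=> f0 df; have [X0 dX] := deg_X0n (d - deg f); exists (f * 'X_0 ^+ (d - deg f)); split.
  by rewrite msizeS ?mulf_neq0 // degM // dX subnKC.
by move=> z fz; rewrite ev2M fz mul0r.
Qed.

(** Uniqueness forces degree exactly [d]: otherwise [f] times a variable would be another solution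
    of degree at most [d], not proportional to [f]. *)
Lemma trace_curve d n nd (a : 'I_n -> point R) E : E \in traces d a nd ->
  exists f, [/\ E = Zset a f, (#|E| <= nd)%N, is_curve d (zero_set f) &
    forall C, is_curve d C -> (forall i, zero_set f (a i) -> C (a i)) -> zero_set f = C].
Proof.
rewrite inE => /asboolP[f [f0 df eE cE uniq_f]]; exists f.
have deg_f : deg f = d.
  apply/eqP; rewrite eqn_leq df leqNgt; apply/negP => lt.
  have [X0 dX] := deg_X0n 1.
  have [||c ec] := uniq_f (f * 'X_0 ^+ 1).
  - by rewrite degM // dX addn1.
  - by move=> i; rewrite eE inE ev2M => /eqP ->; rewrite mul0r.
  have := degZ_le c f; rewrite -ec degM // dX addn1 ltnn //.
split=> //; first by exists f; rewrite msizeS // deg_f.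
move=> C [p [sp ->]] sub; have p0 : p != 0 by rewrite -msize_poly_eq0 sp.
have [||c ep] := uniq_f p; first by rewrite /deg sp.
  by move=> i; rewrite eE inE => /sub /eqP.
have c0 : c != 0 by apply: contraNneq p0 => c0; rewrite ep c0 scale0r.
by apply/funext => z; rewrite /zero_set ep ev2Z mulf_eq0 (negPf c0).
Qed.

End Curves.

Theorem theorem5 (R : realType) (d : nat) (hd : (0 < d)%N) :
  exists c2 c3 : R, 0 < c2 /\ 0 < c3 /\
    forall A : seq (point R), uniq A -> c2 < (size A)%:R ->
      ~ (exists C, is_curve d C /\ forall z, z \in A -> C z) ->
      O_card_ge d ((3 * (d ^ 2)%:R - 3 * d%:R + 4) / 2) A
        (c3 * (size A)%:R ^+ d).
Proof.
have [C many] := many_traces hd.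
(* The successor keeps both constants positive even if [C] is 0. *)
exists C.+1%:R, C.+1%:R^-1; rewrite invr_gt0 ltr0Sn; do !split=> //.
move=> A uA; rewrite ltr_nat => sA not_curve.
pose a (i : 'I_(size A)) := tnth (in_tuple A) i.
have aE i : a i = nth (0, 0) A i by rewrite /a (tnth_nth (0, 0)).
have a_inj : injective a.
  by move=> i j; rewrite !aE => /eqP; rewrite nth_uniq // => /eqP /val_inj.
have a_in z : z \in A -> exists i, z = a i by move=> /(tnthP (in_tuple A)).
have A_map : A = map a (enum 'I_(size A)).
  by rewrite -[LHS]/(tval (in_tuple A)) -[in LHS](map_tnth_enum (in_tuple A)).
have countA f : count (zero_set f) A = #|Zset a f|.
  rewrite [X in count _ X]A_map count_map -sum1_count big_enum_cond sum1dep_card.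
  by apply: eq_card => i; rewrite !inE.
have not_on (f : {mpoly R[2]}) : f != 0 -> (deg f <= d)%N -> exists i, ev2 f (a i) != 0.
  move=> f0 df; apply: contrapT => no; apply: not_curve.
  have [g [sg fg]] := curve_of_small_deg f0 df; exists (zero_set g); split; first by exists g.
  move=> z /a_in[i ->]; apply/eqP/fg/eqP; apply: contraT => fi; case: no; by exists i.
have := many R _ a a_inj (ltnW (ltnW sA)) not_on.
set nd := (_ - _)%N; set G := traces d a nd => le_G.
have /choice[F hF] : forall E, exists f, E \in G -> [/\ E = Zset a f, (#|E| <= nd)%N, is_curve d (zero_set f) &
    forall C, is_curve d C -> (forall i, zero_set f (a i) -> C (a i)) -> zero_set f = C].
  move=> E; have [/trace_curve[f hf]|_] := boolP (E \in G); [by exists f|by exists 0].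
exists #|G|, (fun k => zero_set (F (enum_val k))); split; last split.
- move=> k l e; apply: enum_val_inj.
  have [-> _ _ _] := hF _ (enum_valP k); have [-> _ _ _] := hF _ (enum_valP l).
  by apply/setP => i; rewrite !inE; have := congr1 (fun p : pred _ => p (a i)) e.
- move=> k; have [eE cE curve uniq_f] := hF _ (enum_valP k); split.
    split=> // C' curve' sub; apply: uniq_f => // i; apply: sub.
    by rewrite A_map map_f // mem_enum.
  rewrite countA -eE; apply: (@le_trans _ _ nd%:R); first by rewrite ler_nat.
  have e : (nd * 2 + 3 * d = 3 * d ^ 2 + 4)%N.
    by rewrite /nd; have := D2E d; move: hd; rewrite -mulnn; clear; nia.
  by move/(congr1 (fun k => k%:R : R)): e; rewrite !natrD !natrM; lra.
- rewrite mulrC ler_pdivrMr ?ltr0Sn // -natrX -natrM ler_nat mulnC.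
  by apply: leq_trans le_G _; rewrite leq_mul2r leqnSn orbT.
Qed.
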